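(* Every finitely generated free pronilpotent group is a (profinite) duality group over $\widehat{\mathbb{Z}}$.
   Context: Let $\Lambda$ be a commutative profinite ring and $G$ a profinite group, $\Lambda[[G]]=\varprojlim\Lambda_j[G_i]$ the completed group ring ($\Lambda_j$, $G_i$ the finite quotients). $\mathrm{cd}_\Lambda(G)$ is the projective dimension of the trivial module $\Lambda$ in profinite $\Lambda[[G]]$-modules. With $P_\bullet\to\Lambda$ a projective resolution by profinite $\Lambda[[G]]$-modules, $H^k_\Lambda(G,M)=H^k(\mathrm{Hom}_{\Lambda[[G]]}(P_\bullet,M))$ (continuous homomorphisms) and $H_k^\Lambda(G,M)=H_k(P_\bullet\widehat\otimes_{\Lambda[[G]]}M)$; $\widehat\otimes$ is the completed tensor product (over $\Lambda$ with diagonal $G$-action). $G$ is a profinite duality group over $\Lambda$ of dimension $n$ if $\mathrm{cd}_\Lambda(G)=n$, $H^k_\Lambda(G,L)$ is finite for every finite $\Lambda[[G]]$-module $L$ and every $k$, and there is a profinite $\Lambda[[G]]$-module $D_\Lambda$ such that for every profinite $\Lambda[[G]]$-module $M$ and every integer $k$ there exists an isomorphism $H_k^\Lambda(G,M\widehat\otimes_\Lambda D_\Lambda)\to H_\Lambda^{n-k}(G,M)$. It is a duality group over $\Lambda$ if it is one of some dimension $n$. *)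

(* Defs.v *)
From HB Require Import structures.
From mathcomp Require Import all_boot all_order all_algebra all_fingroup all_solvable.
From mathcomp Require Import ring_quotient.
From mathcomp Require Import boolp classical_sets functions cardinality topology.

Set Implicit Arguments.
Unset Strict Implicit.
Unset Printing Implicit Defensive.

Import GRing.Theory.
Local Open Scope classical_set_scope.
Local Open Scope ring_scope.
Local Open Scope quotient_scope.

Definition profinite_space (T : topologicalType) : Prop :=
  [/\ compact [set: T], hausdorff_space T & totally_disconnected [set: T]].

HB.mixin Record isProfiniteGroup G of monoid.Group G & Topological G := {
  profinite_mulg_continuous : continuous (fun z : G * G => (z.1 * z.2)%g);
  profinite_invg_continuous : continuous (fun x : G => (x^-1)%g);
  profinite_group_space : profinite_space G
}.

#[short(type="profiniteGroupType")]
HB.structure Definition ProfiniteGroup :=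
  {G of monoid.Group G & Topological G & isProfiniteGroup G}.

(* Only declared to join the algebraic and topological hierarchies. *)
HB.structure Definition TopZmodule := {M of GRing.Zmodule M & Topological M}.

#[short(type="topPzRingType")]
HB.structure Definition TopPzRing := {R of GRing.PzRing R & Topological R}.

HB.mixin Record isProfiniteComRing R of GRing.ComNzRing R & Topological R := {
  profinite_ring_add_continuous : continuous (fun z : R * R => z.1 + z.2);
  profinite_ring_opp_continuous : continuous (fun x : R => - x);
  profinite_mulr_continuous : continuous (fun z : R * R => z.1 * z.2);
  profinite_ring_space : profinite_space R
}.

#[short(type="profiniteComRingType")]
HB.structure Definition ProfiniteComRing :=
  {R of GRing.ComNzRing R & Topological R & isProfiniteComRing R}.

HB.mixin Record isProfiniteModule (A : topPzRingType) M
    of GRing.Lmodule A M & Topological M := {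
  profinite_mod_add_continuous : continuous (fun z : M * M => z.1 + z.2);
  profinite_mod_opp_continuous : continuous (fun x : M => - x);
  profinite_scale_continuous : continuous (fun z : A * M => z.1 *: z.2);
  profinite_module_space : profinite_space M
}.

#[short(type="profiniteModType")]
HB.structure Definition ProfiniteModule (A : topPzRingType) :=
  {M of GRing.Lmodule A M & Topological M & isProfiniteModule A M}.

Local Notation quot_repr := generic_quotient.repr.

(* Quotients of a profinite group by open normal subgroups: they are finite, and
   equipped with a [finGroupType] structure. *)
Section OpenNormal.
Local Open Scope group_scope.

Record open_normal (G : profiniteGroupType) := OpenNormal {
  onormal :> {pred G};
  onormal1 : 1 \in onormal;
  onormalV : forall x y, x \in onormal -> y \in onormal -> x^-1 * y \in onormal;
  onormalJ : forall x y, x \in onormal -> x ^ y \in onormal;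
  onormal_open : open [set x | x \in onormal]
}.

Variables (G : profiniteGroupType) (N : open_normal G).
Implicit Types x y z : G.

Lemma onormalI x : x \in N -> x^-1 \in N.
Proof. by move=> xN; rewrite -[x^-1]mulg1 onormalV // onormal1. Qed.

Lemma onormalM x y : x \in N -> y \in N -> x * y \in N.
Proof. by move=> xN yN; rewrite -[x]invgK onormalV // onormalI. Qed.

Definition qgroup_rel : rel G := fun x y => x^-1 * y \in N.

Lemma qgroup_relP : equiv_class_of qgroup_rel.
Proof.
split=> [x|x y|y x z]; rewrite /qgroup_rel.
- by rewrite mulVg onormal1.
- by apply/idP/idP => /onormalI; rewrite invgM invgK.
- by move=> xy yz; have := onormalM xy yz; rewrite mulgA mulgK.
Qed.

Canonical qgroup_equiv := EquivRelPack qgroup_relP.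
Canonical qgroup_enc := defaultEncModRel qgroup_rel.

Definition qgroup : Type := {eq_quot qgroup_rel}.
HB.instance Definition _ := EqQuotient.on qgroup.
HB.instance Definition _ := Choice.on qgroup.

Lemma qgroupP x y : reflect (\pi_qgroup x = \pi_qgroup y) (x^-1 * y \in N).
Proof. by apply: (iffP idP) => [|/eqmodP //]; move=> ?; apply/eqmodP. Qed.

Definition qmul (a b : qgroup) : qgroup := \pi_qgroup (quot_repr a * quot_repr b).
Definition qone : qgroup := \pi_qgroup 1.
Definition qinv (a : qgroup) : qgroup := \pi_qgroup (quot_repr a)^-1.

Lemma repr_qgroup x : x^-1 * quot_repr (\pi_qgroup x) \in N.
Proof. by apply/qgroupP; rewrite reprK. Qed.

Lemma qmulE x y : qmul (\pi_qgroup x) (\pi_qgroup y) = \pi_qgroup (x * y).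
Proof.
apply/esym/qgroupP; rewrite invgM.
set x' := quot_repr _; set y' := quot_repr _.
have -> : y^-1 * x^-1 * (x' * y') = (x^-1 * x') ^ y * (y^-1 * y').
  by rewrite /conjg !mulgA mulgK.
by rewrite onormalM ?repr_qgroup // onormalJ // repr_qgroup.
Qed.

Lemma qinvE x : qinv (\pi_qgroup x) = \pi_qgroup x^-1.
Proof.
apply/esym/qgroupP; rewrite invgK; set x' := quot_repr _.
have -> : x * x'^-1 = ((x^-1 * x')^-1) ^ x^-1.
  by rewrite /conjg invgM !invgK !mulgA mulgK.
by rewrite onormalJ // onormalI // repr_qgroup.
Qed.

Lemma qgroup_pi (a : qgroup) : exists x, a = \pi_qgroup x.
Proof. by exists (quot_repr a); rewrite reprK. Qed.

Lemma qgroup_mulA : associative qmul.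
Proof.
move=> a b c; have [x ->] := qgroup_pi a; have [y ->] := qgroup_pi b.
have [z ->] := qgroup_pi c.
by rewrite !qmulE mulgA.
Qed.

Lemma qgroup_mul1 : left_id qone qmul.
Proof. by move=> a; have [x ->] := qgroup_pi a; rewrite qmulE mul1g. Qed.

Lemma qgroup_mulV : left_inverse qone qinv qmul.
Proof. by move=> a; have [x ->] := qgroup_pi a; rewrite qinvE qmulE mulVg. Qed.

Lemma coset_open x : open [set y | x^-1 * y \in N].
Proof.
have cx : continuous (fun y : G => x^-1 * y).
  move=> y; have cy : (fun y : G => (x^-1, y)) @ y --> (x^-1, y).
    by apply: cvg_pair; [exact: cvg_cst|exact: cvg_id].
  exact: (cvg_comp _ (fun z : (G * G)%type => z.1 * z.2) cy (@profinite_mulg_continuous G (x^-1, y))).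
by have /continuousP /(_ _ (@onormal_open G N)) := cx.
Qed.

Lemma qgroup_finite : exists s : seq qgroup, forall a, a \in s.
Proof.
have [cptG _ _] := profinite_group_space (s := G).
pose pG : ptopologicalType := HB.pack (G : Type) (Topological.class G) (isPointed.Build G 1).
have {}cptG : @compact pG setT by exact: cptG.
move: cptG; rewrite compact_cover => /(_ G setT (fun x => [set y | x^-1 * y \in N])).
case=> [x _|x _|D _ cov].
- exact: coset_open.
- by exists x => //=; rewrite mulVg onormal1.
exists [seq \pi_qgroup x | x <- finmap.enum_fset D] => a.
have [x xD /= xa] := cov (quot_repr a) I.
by apply/mapP; exists x => //; rewrite -[a]reprK; apply/esym/qgroupP.
Qed.

Definition qgroup_enum : seq qgroup := undup (projT1 (cid qgroup_finite)).

Lemma mem_qgroup_enum a : a \in qgroup_enum.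
Proof. by rewrite mem_undup; exact: (projT2 (cid qgroup_finite)). Qed.

Lemma qgroup_enumK : pcancel (index^~ qgroup_enum)
  (fun n => nth None [seq Some a | a <- qgroup_enum] n).
Proof.
move=> a; have lt_a : (index a qgroup_enum < size qgroup_enum)%N.
  by rewrite index_mem mem_qgroup_enum.
by rewrite (nth_map a) // nth_index // mem_qgroup_enum.
Qed.

HB.instance Definition _ := isCountable.Build qgroup qgroup_enumK.

Lemma qgroup_enumP : Finite.axiom qgroup_enum.
Proof.
by move=> a; rewrite count_uniq_mem ?undup_uniq // mem_qgroup_enum.
Qed.

HB.instance Definition _ := isFinite.Build qgroup qgroup_enumP.
HB.instance Definition _ :=
  Finite_isGroup.Build qgroup qgroup_mulA qgroup_mul1 qgroup_mulV.

Lemma pi_qgroupM x y : \pi_qgroup (x * y) = \pi_qgroup x * \pi_qgroup y.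
Proof. by rewrite -qmulE. Qed.

End OpenNormal.

(* In a compact ring the open ideals are those with a finite discrete quotient.
   [idealr_closed] makes them proper: dropping the zero quotient does not change
   the inverse limit defining the completed group ring. *)
Record open_ideal (R : profiniteComRingType) := OpenIdeal {
  oideal :> R -> bool;
  oideal_closed : idealr_closed oideal;
  oideal_open : open [set x | oideal x]
}.

HB.instance Definition _ (R : profiniteComRingType) (I : open_ideal R) :=
  isIdealr.Build R (oideal I) (oideal_closed I).

Definition oidealr (R : profiniteComRingType) (I : open_ideal R) : idealr R :=
  oideal I.

Definition qring (R : profiniteComRingType) (I : open_ideal R) : comNzRingType :=
  {ideal_quot (oidealr I)}.

Section GroupRing.
Variables (R : pzRingType) (Q : finGroupType).

(* The alias hides the pointwise product of [{ffun Q -> R}]; the product is the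
   convolution [gr_mul]. *)
Definition group_ring : Type := {ffun Q -> R}.
HB.instance Definition _ := GRing.Zmodule.on group_ring.

Implicit Types a b c : group_ring.

Definition gr_one : group_ring := [ffun q => (q == 1%g)%:R].
Definition gr_mul a b : group_ring :=
  [ffun q => \sum_x a x * b (x^-1 * q)%g].

Lemma gr_mulA : associative gr_mul.
Proof.
move=> a b c; apply/ffunP => q; rewrite !ffunE.
under eq_bigr do rewrite ffunE big_distrr /=.
under [RHS]eq_bigr do rewrite ffunE big_distrl /=.
rewrite [RHS]exchange_big /=; apply: eq_bigr => x _.
rewrite [RHS](reindex_inj (mulgI x)) /=; apply: eq_bigr => y _.
by rewrite mulKg invgM mulgA mulrA.
Qed.

Lemma gr_mul1l : left_id gr_one gr_mul.
Proof.
move=> a; apply/ffunP => q; rewrite ffunE (bigD1 1%g) //= big1 => [|x /negPf x1].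
  by rewrite ffunE eqxx mul1r invg1 mul1g addr0.
by rewrite ffunE x1 mul0r.
Qed.

Lemma gr_mul1r : right_id gr_one gr_mul.
Proof.
move=> a; apply/ffunP => q; rewrite ffunE (bigD1 q) //= big1 => [|x xq].
  by rewrite ffunE mulVg eqxx mulr1 addr0.
rewrite ffunE -(inj_eq (mulgI x)) mulKVg mulg1 eq_sym (negPf xq) mulr0.
by [].
Qed.

Lemma gr_mulDl : left_distributive gr_mul +%R.
Proof.
move=> a b c; apply/ffunP => q; rewrite !ffunE -big_split /=.
by apply: eq_bigr => x _; rewrite !ffunE mulrDl.
Qed.

Lemma gr_mulDr : right_distributive gr_mul +%R.
Proof.
move=> a b c; apply/ffunP => q; rewrite !ffunE -big_split /=.
by apply: eq_bigr => x _; rewrite !ffunE mulrDr.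
Qed.

HB.instance Definition _ := GRing.Zmodule_isPzRing.Build group_ring
  gr_mulA gr_mul1l gr_mul1r gr_mulDl gr_mulDr.

Definition gr_monom (r : R) (g : Q) : group_ring :=
  [ffun q => if q == g then r else 0].

Lemma gr_monomM r s g h : gr_monom r g * gr_monom s h = gr_monom (r * s) (g * h)%g.
Proof.
apply/ffunP => q; rewrite !ffunE (bigD1 g) //= big1 => [|x /negPf xg]; last first.
  by rewrite ffunE xg mul0r.
rewrite !ffunE eqxx addr0 -(inj_eq (mulgI g) (g^-1 * q)%g) mulKVg.
by case: eqP; rewrite ?mulr0.
Qed.

Lemma gr_monom1 : gr_monom 1 1%g = 1.
Proof. by apply/ffunP => q; rewrite !ffunE; case: eqP. Qed.

Lemma gr_monomD r s g : gr_monom (r + s) g = gr_monom r g + gr_monom s g.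
Proof. by apply/ffunP => q; rewrite !ffunE; case: eqP; rewrite ?addr0. Qed.

Definition gr_inv a : group_ring := [ffun q => a q^-1%g].

End GroupRing.

Lemma gr_monom_central (R : comPzRingType) (Q : finGroupType) (r : R)
  (a : group_ring R Q) : gr_monom r 1%g * a = a * gr_monom r 1%g.
Proof.
apply/ffunP => q; rewrite !ffunE (bigD1 1%g) //= big1 => [|x /negPf x1]; last first.
  by rewrite ffunE x1 mul0r.
rewrite (bigD1 q) //= big1 => [|x /negPf xq]; last first.
  by rewrite ffunE -(inj_eq (mulgI x)) mulKVg mulg1 eq_sym xq mulr0.
by rewrite !ffunE eqxx mulVg eqxx !addr0 invg1 mul1g mulrC.
Qed.

Section GroupRingMap.
Variables (R S : pzRingType) (Q T : finGroupType).
Variables (f : {rmorphism R -> S}) (h : {multiplicative Q -> T}).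

Definition gr_map (a : group_ring R Q) : group_ring S T :=
  [ffun t => \sum_(q | h q == t) f (a q)].

Lemma gr_map_is_zmod_morphism : zmod_morphism gr_map.
Proof.
move=> a b; apply/ffunP => t; rewrite !ffunE -sumrB.
by apply: eq_bigr => q _; rewrite !ffunE rmorphB.
Qed.

Let h1 : h 1%g = 1%g.
Proof. by apply: (mulgI (h 1%g)); rewrite -gmulfM !mulg1. Qed.

Let hV x : h x^-1%g = (h x)^-1%g.
Proof. by apply: (mulgI (h x)); rewrite -gmulfM !mulgV h1. Qed.

Lemma gr_map_is_monoid_morphism : monoid_morphism gr_map.
Proof.
split=> [|a b]; apply/ffunP => t; rewrite !ffunE.
  under eq_bigr do rewrite ffunE rmorph_nat.
  rewrite -natr_sum; congr (_ %:R).
  rewrite big_mkcond (bigD1 1%g) //= big1 => [|x /negPf ->].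
    by rewrite h1 eqxx addn0 eq_sym; case: (t == _).
  by case: ifP.
under eq_bigr do rewrite ffunE rmorph_sum.
rewrite exchange_big /= (partition_big h predT) //=; apply: eq_bigr => u _.
rewrite ffunE big_distrl /=; apply: eq_bigr => x /eqP hx.
rewrite ffunE big_distrr /= (reindex_inj (mulgI x)) /=.
apply: eq_big => [y|y _]; last by rewrite mulKg rmorphM.
by rewrite gmulfM hx -(inj_eq (mulgI u) (h y)) mulKVg.
Qed.

HB.instance Definition _ := GRing.isZmodMorphism.Build (group_ring R Q)
  (group_ring S T) gr_map gr_map_is_zmod_morphism.
HB.instance Definition _ := GRing.isMonoidMorphism.Build (group_ring R Q)
  (group_ring S T) gr_map gr_map_is_monoid_morphism.

Lemma gr_map_monom r g : gr_map (gr_monom r g) = gr_monom (f r) (h g).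
Proof.
apply/ffunP => t; rewrite !ffunE big_mkcond (bigD1 g) //= big1 => [|x /negPf xg].
  by rewrite ffunE eqxx addr0 eq_sym.
by rewrite ffunE xg rmorph0; case: ifP.
Qed.

Lemma gr_map_inv a : gr_map (gr_inv a) = gr_inv (gr_map a).
Proof.
apply/ffunP => t; rewrite !ffunE (reindex_inj invg_inj) /=.
apply: eq_big => [q|q _]; first by rewrite hV -(inj_eq invg_inj) invgK.
by rewrite ffunE invgK.
Qed.

End GroupRingMap.

(* Functoriality of the transition maps plays no role in the definition of the
   limit, hence is not required. *)
Record inverse_system := InverseSystem {
  is_index : Type;
  is_le : is_index -> is_index -> Prop;
  is_obj : is_index -> pzRingType;
  is_map : forall i j, is_le i j -> {rmorphism is_obj j -> is_obj i}
}.

Record invlim (S : inverse_system) : Type := InvLim {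
  il_val : forall i : is_index S, is_obj i;
  il_compat : forall i j (ij : is_le i j), is_map ij (il_val j) = il_val i
}.

Section InverseLimit.
Variable S : inverse_system.
Local Notation L := (invlim S).
Implicit Types x y z : L.

Lemma il_eq x y : (forall i, il_val x i = il_val y i) -> x = y.
Proof.
case: x y => [x cx] [y cy] /= exy; have xy := functional_extensionality_dep exy.
by clear exy; subst y; congr InvLim; exact: Prop_irrelevance.
Qed.

HB.instance Definition _ := gen_eqMixin L.
HB.instance Definition _ := gen_choiceMixin L.

Definition il_zero : L.
Proof. by exists (fun=> 0) => i j ij; rewrite rmorph0. Defined.
Definition il_one : L.
Proof. by exists (fun=> 1) => i j ij; rewrite rmorph1. Defined.
Definition il_opp x : L.
Proof.
by exists (fun i => - il_val x i) => i j ij; rewrite rmorphN il_compat.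
Defined.
Definition il_add x y : L.
Proof.
exists (fun i => il_val x i + il_val y i) => i j ij.
by rewrite rmorphD !il_compat.
Defined.
Definition il_mul x y : L.
Proof.
exists (fun i => il_val x i * il_val y i) => i j ij.
by rewrite rmorphM !il_compat.
Defined.

Lemma il_addA : associative il_add.
Proof. by move=> x y z; apply: il_eq => i /=; rewrite addrA. Qed.
Lemma il_addC : commutative il_add.
Proof. by move=> x y; apply: il_eq => i /=; rewrite addrC. Qed.
Lemma il_add0 : left_id il_zero il_add.
Proof. by move=> x; apply: il_eq => i /=; rewrite add0r. Qed.
Lemma il_addN : left_inverse il_zero il_opp il_add.
Proof. by move=> x; apply: il_eq => i /=; rewrite addNr. Qed.
HB.instance Definition _ := GRing.isZmodule.Build L
  il_addA il_addC il_add0 il_addN.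

Lemma il_mulA : associative il_mul.
Proof. by move=> x y z; apply: il_eq => i /=; rewrite mulrA. Qed.
Lemma il_mul1l : left_id il_one il_mul.
Proof. by move=> x; apply: il_eq => i /=; rewrite mul1r. Qed.
Lemma il_mul1r : right_id il_one il_mul.
Proof. by move=> x; apply: il_eq => i /=; rewrite mulr1. Qed.
Lemma il_mulDl : left_distributive il_mul il_add.
Proof. by move=> x y z; apply: il_eq => i /=; rewrite mulrDl. Qed.
Lemma il_mulDr : right_distributive il_mul il_add.
Proof. by move=> x y z; apply: il_eq => i /=; rewrite mulrDr. Qed.
HB.instance Definition _ := GRing.Zmodule_isPzRing.Build L
  il_mulA il_mul1l il_mul1r il_mulDl il_mulDr.

Definition il_prod (x : L) : prod_topology (fun i : is_index S => discrete_topology (is_obj i)) :=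
  il_val x.
(* Subspace topology of the product of the discrete stages. *)
HB.instance Definition _ := Topological.copy L (initial_topology il_prod).

Lemma il_cvg (F : set_system L) x : Filter F ->
  (forall i, F [set y | il_val y i = il_val x i]) -> F --> x.
Proof.
move=> FF Fx A; rewrite (@nbhsE (initial_topology il_prod)).
move=> [_ [[B oB <-] Bx] BA]; apply: filterS BA _.
have: il_prod @ F --> il_prod x.
  apply/cvg_sup => i C.
  rewrite (@nbhsE (initial_topology _)) => -[_ [[D oD <-] Dx] DC].
  suff: F (il_prod @^-1` C) by [].
  apply: filterS (Fx i) => y yx; apply: DC.
  by move: Dx; rewrite /preimage /mkset /il_prod yx.
by apply; apply: open_nbhs_nbhs.
Qed.

Lemma il_val_open (i : is_index S) (a : is_obj i) : open [set x : L | il_val x i = a].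
Proof.
have ci : continuous (fun x : L => il_val x i : discrete_topology (is_obj i)).
  move=> x; apply: (cvg_comp il_prod (@^~ i)).
    exact: (@initial_continuous _ _ il_prod).
  exact: (@proj_continuous {classic is_index S}
    (fun i : is_index S => discrete_topology (is_obj i)) i).
by have /continuousP /(_ [set a]) := ci; apply; exact: discrete_open.
Qed.

Lemma il_continuous (T : topologicalType) (f : T -> L) :
  (forall i t, \forall u \near t, il_val (f u) i = il_val (f t) i) ->
  continuous f.
Proof. by move=> fP t; apply: il_cvg => i; exact: fP. Qed.

Lemma il_near x i : \forall y \near x, il_val y i = il_val x i.
Proof. by apply: open_nbhs_nbhs; split; [exact: il_val_open|]. Qed.

Lemma il_add_continuous : continuous (fun z : L * L => z.1 + z.2).
Proof.
apply: il_continuous => i [x y].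
by exists ([set u | il_val u i = il_val x i], [set u | il_val u i = il_val y i]);
  [split; exact: il_near|move=> [u v] [/= -> ->]].
Qed.

Lemma il_mul_continuous : continuous (fun z : L * L => z.1 * z.2).
Proof.
apply: il_continuous => i [x y].
by exists ([set u | il_val u i = il_val x i], [set u | il_val u i = il_val y i]);
  [split; exact: il_near|move=> [u v] [/= -> ->]].
Qed.

Lemma il_opp_continuous : continuous (fun x : L => - x : L).
Proof.
apply: il_continuous => i x; near=> y => /=; congr (- _).
by near: y; exact: il_near.
Unshelve. all: by end_near. Qed.

Lemma il_zero_dimensional : zero_dimensional L.
Proof.
move=> x y xy; have [i xyi] : exists i, il_val x i <> il_val y i.
  by apply/not_existsP => xyi; case/eqP: xy; apply: il_eq => i; exact: contrapT.
exists [set z | il_val z i = il_val x i]; split=> //; last exact/nesym.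
split; first exact: il_val_open.
rewrite -[X in closed X]setCK; apply: open_closedC.
rewrite (_ : ~` _ = \bigcup_(a in [set a | a <> il_val x i])
                      [set z | il_val z i = a]).
  by apply: bigcup_open => a _; exact: il_val_open.
by apply/seteqP; split=> z /= => [zx|[a /= ax za]]; [exists (il_val z i)|rewrite za].
Qed.

Lemma il_profinite : (forall i : is_index S, finite_set [set: is_obj i]) ->
  profinite_space L.
Proof.
move=> finS; split; last 1 first.
- exact/zero_dimension_totally_disconnected/il_zero_dimensional.
- rewrite compact_ultra => F FU _.
  have FP (i : is_index S) : exists a : is_obj i, F [set x | il_val x i = a].
    have := finite_compact (finS i : finite_set [set: discrete_topology (is_obj i)]).
    move=> /(_ ((fun x : L => il_val x i : discrete_topology _) @ F)) [|a [_ Fa]].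
      exact: filterT.
    exists a; have [//|nFa] := in_ultra_setVsetC [set x | il_val x i = a] FU.
    by have [b [/= + ba]] := Fa (~` [set a]) [set a] nFa (discrete_set1 a).
  pose a i := projT1 (cid (FP i)).
  have Fa i : F [set x | il_val x i = a i] := projT2 (cid (FP i)).
  have ca i j (ij : is_le i j) : is_map ij (a j) = a i.
    have [x [/= xi xj]] := filter_ex (filterI (Fa i) (Fa j)).
    by rewrite -xi -xj il_compat.
  by exists (InvLim ca); split=> //; apply: il_cvg => i.
- move=> x y xy; apply/eqP/negP => /negP /il_zero_dimensional [U [[oU cU] Ux Uy]].
  have [] := xy U (~` U); [exact: open_nbhs_nbhs| |by move=> z []].
  by apply: open_nbhs_nbhs; split=> //; exact: closed_openC.
Qed.

End InverseLimit.

(* Inverse limit of the rings Z/(n+2), ordered by divisibility of the moduli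
   ('Z_1 is not the zero ring in MathComp). *)
Section Zhat.

Definition zp_red m n (mn : (m.+2 %| n.+2)%N) (x : 'Z_(n.+2)) : 'Z_(m.+2) :=
  inZp (x : nat).

Section ZpRed.
Variables (m n : nat) (mn : (m.+2 %| n.+2)%N).

Lemma zp_redE x : (zp_red mn x : nat) = (x %% m.+2)%N.
Proof. by []. Qed.

Lemma zp_red_is_zmod_morphism : zmod_morphism (zp_red mn).
Proof.
suff redD : {morph zp_red mn : x y / x + y} by
  move=> x y; apply: (addIr (zp_red mn y)); rewrite -redD !subrK.
move=> x y; apply: val_inj => /=.
by rewrite modn_dvdm // modnDm.
Qed.

Lemma zp_red_is_monoid_morphism : monoid_morphism (zp_red mn).
Proof.
split=> [|x y]; apply: val_inj => /=; first by rewrite modn_dvdm.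
by rewrite modn_dvdm // modnMm.
Qed.

HB.instance Definition _ := GRing.isZmodMorphism.Build 'I_(n.+2) 'I_(m.+2)
  (zp_red mn) zp_red_is_zmod_morphism.
HB.instance Definition _ := GRing.isMonoidMorphism.Build 'I_(n.+2) 'I_(m.+2)
  (zp_red mn) zp_red_is_monoid_morphism.
End ZpRed.

Definition zhat_system : inverse_system :=
  @InverseSystem nat (fun m n => (m.+2 %| n.+2)%N)
    (fun n => 'Z_(n.+2) : pzRingType) (fun m n mn => zp_red mn).

Definition Zhat : Type := invlim zhat_system.
HB.instance Definition _ := GRing.PzRing.on Zhat.
HB.instance Definition _ := Topological.on Zhat.

Lemma zhat_mulC : commutative (@GRing.mul Zhat).
Proof. by move=> x y; apply: il_eq => n; exact: (@mulrC 'I_(n.+2)). Qed.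
HB.instance Definition _ := GRing.PzRing_hasCommutativeMul.Build Zhat zhat_mulC.

Lemma zhat_oner_neq0 : 1 != 0 :> Zhat.
Proof.
by apply/eqP => /(congr1 (fun x : Zhat => il_val x 0%N)).
Qed.
HB.instance Definition _ := GRing.PzSemiRing_isNonZero.Build Zhat zhat_oner_neq0.

Lemma zhat_profinite : profinite_space Zhat.
Proof.
by apply: il_profinite => n; exact: (@finite_finset 'I_(n.+2)).
Qed.

HB.instance Definition _ := isProfiniteComRing.Build Zhat
  (@il_add_continuous zhat_system) (@il_opp_continuous zhat_system)
  (@il_mul_continuous zhat_system) zhat_profinite.

End Zhat.

Section QuotientRing.
Variables (R : profiniteComRingType) (I : open_ideal R).

Definition qpi (x : R) : qring I := \pi_(qring I) x.

Lemma qpi_is_zmod_morphism : zmod_morphism qpi.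
Proof. exact: pi_is_zmod_morphism. Qed.
Lemma qpi_is_monoid_morphism : monoid_morphism qpi.
Proof. exact: pi_is_monoid_morphism. Qed.
HB.instance Definition _ := GRing.isZmodMorphism.Build R (qring I) qpi
  qpi_is_zmod_morphism.
HB.instance Definition _ := GRing.isMonoidMorphism.Build R (qring I) qpi
  qpi_is_monoid_morphism.

Lemma qpi_surj (a : qring I) : exists x, a = qpi x.
Proof. by exists (quot_repr a); rewrite /qpi reprK. Qed.

Lemma qpi_eq x y : (qpi x == qpi y) = oideal I (x - y).
Proof. by rewrite /qpi -Quotient.idealrBE. Qed.

End QuotientRing.

Section QuotientMaps.
Variables (R : profiniteComRingType) (G : profiniteGroupType).
Variables (I J : open_ideal R) (IJ : forall x, oideal J x -> oideal I x).
Variables (N M : open_normal G) (NM : {subset onormal M <= onormal N}).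

Definition qring_map of (forall x, oideal J x -> oideal I x) :=
  fun a : qring J => qpi I (quot_repr a).

Definition qgroup_map of {subset onormal M <= onormal N} :=
  fun a : qgroup M => \pi_(qgroup N) (quot_repr a).

Lemma qring_mapE x : qring_map IJ (qpi J x) = qpi I x.
Proof.
apply/eqP; rewrite qpi_eq; apply: IJ.
by rewrite -qpi_eq /qpi reprK.
Qed.

Lemma qgroup_mapE x : qgroup_map NM (\pi_(qgroup M) x) = \pi_(qgroup N) x.
Proof. by apply/esym/qgroupP/NM/repr_qgroup. Qed.

Lemma qring_map_is_zmod_morphism : zmod_morphism (qring_map IJ).
Proof.
move=> a b; have [x ->] := qpi_surj a; have [y ->] := qpi_surj b.
by rewrite -rmorphB !qring_mapE rmorphB.
Qed.

Lemma qring_map_is_monoid_morphism : monoid_morphism (qring_map IJ).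
Proof.
split=> [|a b]; first by rewrite -(rmorph1 (qpi J)) qring_mapE rmorph1.
have [x ->] := qpi_surj a; have [y ->] := qpi_surj b.
by rewrite -rmorphM !qring_mapE rmorphM.
Qed.

Lemma qgroup_mapM : {morph qgroup_map NM : a b / (a * b)%g}.
Proof.
move=> a b; have [x ->] := qgroup_pi a; have [y ->] := qgroup_pi b.
by rewrite -pi_qgroupM !qgroup_mapE pi_qgroupM.
Qed.

HB.instance Definition _ := GRing.isZmodMorphism.Build (qring J) (qring I)
  (qring_map IJ) qring_map_is_zmod_morphism.
HB.instance Definition _ := GRing.isMonoidMorphism.Build (qring J) (qring I)
  (qring_map IJ) qring_map_is_monoid_morphism.
HB.instance Definition _ := isMultiplicative.Build (qgroup M) (qgroup N)
  (qgroup_map NM) qgroup_mapM.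

End QuotientMaps.

Section CompletedGroupRing.
Variables (R : profiniteComRingType) (G : profiniteGroupType).

Definition cgr_index : Type := (open_ideal R * open_normal G)%type.

Definition cgr_le (i j : cgr_index) : Prop :=
  (forall x, oideal j.1 x -> oideal i.1 x) /\ {subset onormal j.2 <= onormal i.2}.

Definition cgr_system : inverse_system :=
  @InverseSystem cgr_index cgr_le
    (fun i => group_ring (qring i.1) (qgroup i.2) : pzRingType)
    (fun i j ij => gr_map (qring_map (proj1 ij)) (qgroup_map (proj2 ij))).

(* The completed group ring R[[G]], limit of (R/I)[G/N] over the open ideals I of R
   and the open normal subgroups N of G. *)
Definition cgr : Type := invlim cgr_system.
HB.instance Definition _ := GRing.PzRing.on cgr.
HB.instance Definition _ := Topological.on cgr.

(* The image of r g in R[[G]]. *)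
Definition cgr_monom (r : R) (g : G) : cgr.
Proof.
exists (fun i : is_index cgr_system => gr_monom (qpi i.1 r) (\pi_(qgroup i.2) g)).
by move=> i j ij; rewrite /= gr_map_monom /= qring_mapE qgroup_mapE.
Defined.

Definition cgr_scal (r : R) : cgr := cgr_monom r 1%g.

Definition cgr_elt (g : G) : cgr := cgr_monom 1 g.

(* The anti-automorphism of R[[G]] extending g |-> g^-1. *)
Definition cgr_inv (a : cgr) : cgr.
Proof.
exists (fun i : is_index cgr_system => gr_inv (il_val a i)) => i j ij.
by rewrite -(il_compat a ij) /= gr_map_inv.
Defined.

Lemma cgr_scal_is_zmod_morphism : zmod_morphism cgr_scal.
Proof.
move=> r s; apply/eqP; rewrite eq_sym subr_eq eq_sym; apply/eqP/il_eq => i /=.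
by rewrite -gr_monomD -rmorphD subrK.
Qed.

Lemma cgr_scal_is_monoid_morphism : monoid_morphism cgr_scal.
Proof.
split=> [|r s]; apply: il_eq => i /=.
  by rewrite rmorph1 -gr_monom1.
by rewrite gr_monomM rmorphM -pi_qgroupM mulg1.
Qed.

HB.instance Definition _ := GRing.isZmodMorphism.Build R cgr cgr_scal
  cgr_scal_is_zmod_morphism.
HB.instance Definition _ := GRing.isMonoidMorphism.Build R cgr cgr_scal
  cgr_scal_is_monoid_morphism.

Lemma cgr_scal_central r (a : cgr) : cgr_scal r * a = a * cgr_scal r.
Proof. by apply: il_eq => i; exact: gr_monom_central. Qed.

Lemma cgr_scal_continuous : continuous cgr_scal.
Proof.
apply: il_continuous => i r; near=> s => /=; congr (gr_monom _ _).
apply/eqP; rewrite qpi_eq; near: s.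
have cr : continuous (fun s : R => s - r).
  move=> s; have cs : (fun s : R => (s, - r)) @ s --> (s, - r).
    by apply: cvg_pair; [exact: cvg_id|exact: cvg_cst].
  exact: (cvg_comp _ (fun z : (R * R)%type => z.1 + z.2) cs
    (@profinite_ring_add_continuous R (s, - r))).
have /continuousP /(_ _ (oideal_open i.1)) oI := cr.
apply: (open_nbhs_nbhs (conj oI _)) => /=; rewrite subrr.
by case: (oideal_closed i.1).
Unshelve. all: by end_near. Qed.

End CompletedGroupRing.

(* Restriction of scalars along R -> R[[G]]. *)
Section Restriction.
Variables (R : profiniteComRingType) (G : profiniteGroupType).
Variable M : profiniteModType (cgr R G).

Definition restr : Type := M.
HB.instance Definition _ := GRing.Zmodule.on restr.
HB.instance Definition _ := Topological.on restr.

Definition restr_scale (r : R) (x : restr) : restr := cgr_scal G r *: (x : M).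

Lemma restr_scaleA r s x : restr_scale r (restr_scale s x) = restr_scale (r * s) x.
Proof. by rewrite /restr_scale scalerA -rmorphM. Qed.
Lemma restr_scale1 : left_id 1 restr_scale.
Proof. by move=> x; rewrite /restr_scale rmorph1 scale1r. Qed.
Lemma restr_scaleDr : right_distributive restr_scale +%R.
Proof. by move=> r x y; exact: scalerDr. Qed.
Lemma restr_scaleDl x : {morph restr_scale^~ x : r s / r + s}.
Proof. by move=> r s; rewrite /restr_scale rmorphD scalerDl. Qed.
HB.instance Definition _ := GRing.Zmodule_isLmodule.Build R restr
  restr_scaleA restr_scale1 restr_scaleDr restr_scaleDl.

Lemma restr_scale_continuous : continuous (fun z : R * restr => z.1 *: z.2).
Proof.
move=> [r x].
have cz : (fun z : (R * restr)%type => (cgr_scal G z.1, z.2 : M)) @ (r, x)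
    --> (cgr_scal G r, x : M).
  have c1 : (fun z : (R * restr)%type => cgr_scal G z.1) @ (r, x) --> cgr_scal G r.
    exact: (cvg_comp fst (cgr_scal G) cvg_fst (@cgr_scal_continuous R G r)).
  have c2 : (fun z : (R * restr)%type => z.2 : M) @ (r, x) --> (x : M).
    exact: cvg_snd.
  exact: cvg_pair c1 c2.
exact: (cvg_comp _ (fun z : (cgr R G * M)%type => z.1 *: z.2) cz
  (@profinite_scale_continuous _ M (cgr_scal G r, x))).
Qed.

HB.instance Definition _ := isProfiniteModule.Build R restr
  (@profinite_mod_add_continuous _ M) (@profinite_mod_opp_continuous _ M)
  restr_scale_continuous (@profinite_module_space _ M).

End Restriction.

(* The R-module Z / (Z :&: B), for submodules Z and B of V. *)
Section Subquotient.
Variables (R : pzRingType) (V : lmodType R).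

Record submodule := Submodule {
  submod_set :> V -> Prop;
  submod0 : submod_set 0;
  submodZD : forall a u v,
    submod_set u -> submod_set v -> submod_set (a *: u + v)
}.

Variables Z B : submodule.

Definition submod_pred (W : submodule) : {pred V} := fun v => `[< W v >].

Lemma submod_predP W : submod_closed (submod_pred W).
Proof.
split=> [|a u v]; first by apply/asboolP; exact: submod0.
by move=> /asboolP Wu /asboolP Wv; apply/asboolP; exact: submodZD.
Qed.
HB.instance Definition _ W :=
  GRing.isSubmodClosed.Build R V (submod_pred W) (submod_predP W).

Definition submod_type : Type := {v : V | v \in submod_pred Z}.
HB.instance Definition _ := SubChoice.on submod_type.
HB.instance Definition _ :=
  [SubChoice_isSubLmodule of submod_type by <:].

Definition submod_in : {pred submod_type} := fun z => `[< B (val z) >].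

Lemma submod_inP : submod_closed submod_in.
Proof.
split=> [|a u v]; first by apply/asboolP; rewrite raddf0; exact: submod0.
move=> /asboolP Wu /asboolP Wv; apply/asboolP.
by rewrite linearP; exact: submodZD.
Qed.
HB.instance Definition _ :=
  GRing.isSubmodClosed.Build R submod_type submod_in submod_inP.

Definition submod_in_closed : zmodClosed submod_type := submod_in.

Definition subquot : Type := Quotient.quot submod_in_closed.
HB.instance Definition _ := GRing.Zmodule.on subquot.

Definition sqpi (z : submod_type) : subquot :=
  \pi_(Quotient.quot submod_in_closed) z.

Lemma sqpi_is_zmod_morphism : zmod_morphism sqpi.
Proof. exact: pi_is_zmod_morphism. Qed.
HB.instance Definition _ := GRing.isZmodMorphism.Build submod_type subquot sqpi
  sqpi_is_zmod_morphism.

Lemma sqpi_surj (c : subquot) : exists z, c = sqpi z.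
Proof. by exists (quot_repr c); rewrite /sqpi reprK. Qed.

Lemma sqpiP y z : reflect (sqpi y = sqpi z) (y - z \in submod_in_closed).
Proof.
by rewrite Quotient.idealrBE; exact: eqP.
Qed.

Definition subquot_scale (r : R) (c : subquot) : subquot :=
  sqpi (r *: quot_repr c).

Lemma subquot_scaleE r z : subquot_scale r (sqpi z) = sqpi (r *: z).
Proof.
apply/sqpiP; rewrite -scalerBr.
have: quot_repr (sqpi z) - z \in submod_in.
  by apply/sqpiP; rewrite /sqpi reprK.
exact: (@rpredZ _ _ submod_in).
Qed.

Lemma subquot_scaleA r s c :
  subquot_scale r (subquot_scale s c) = subquot_scale (r * s) c.
Proof. by have [z ->] := sqpi_surj c; rewrite !subquot_scaleE scalerA. Qed.
Lemma subquot_scale1 : left_id 1 subquot_scale.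
Proof.
by move=> c; have [z ->] := sqpi_surj c; rewrite subquot_scaleE scale1r.
Qed.
Lemma subquot_scaleDr : right_distributive subquot_scale +%R.
Proof.
move=> r c d; have [y ->] := sqpi_surj c; have [z ->] := sqpi_surj d.
by rewrite -raddfD !subquot_scaleE -raddfD scalerDr.
Qed.
Lemma subquot_scaleDl c : {morph subquot_scale^~ c : r s / r + s}.
Proof.
move=> r s; have [z ->] := sqpi_surj c.
by rewrite !subquot_scaleE -raddfD scalerDl.
Qed.
HB.instance Definition _ := GRing.Zmodule_isLmodule.Build R subquot
  subquot_scaleA subquot_scale1 subquot_scaleDr subquot_scaleDl.

End Subquotient.

Section ProjectiveDimension.
Variable A : topPzRingType.

Definition is_hom (M N : profiniteModType A) (f : M -> N) : Prop :=
  linear f /\ continuous f.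

Definition projective_module (P : profiniteModType A) : Prop :=
  forall (M N : profiniteModType A) (f : M -> N) (g : P -> N),
    is_hom f -> (forall y, exists x, f x = y) -> is_hom g ->
    exists2 h : P -> M, is_hom h & forall x, f (h x) = g x.

Record proj_resolution (L : profiniteModType A) := ProjResolution {
  res_mod :> nat -> profiniteModType A;
  res_d : forall k, {linear res_mod k.+1 -> res_mod k};
  res_aug : {linear res_mod 0 -> L};
  res_projective : forall k, projective_module (res_mod k);
  res_d_continuous : forall k, continuous (res_d k);
  res_aug_continuous : continuous res_aug;
  res_aug_surjective : forall y, exists x, res_aug x = y;
  res_exact0 : forall x, res_aug x = 0 <-> exists y, res_d 0 y = x;
  res_exact : forall k x, res_d k x = 0 <-> exists y, res_d k.+1 y = x
}.

Definition proj_dim_le (L : profiniteModType A) (n : nat) : Prop :=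
  exists P : proj_resolution L, forall k, (n < k)%N -> forall x : P k, x = 0.

Definition proj_dim_eq (L : profiniteModType A) (n : nat) : Prop :=
  proj_dim_le L n /\ forall m, proj_dim_le L m -> (n <= m)%N.

End ProjectiveDimension.

Section ChainHomology.
Variables (R : profiniteComRingType) (T : nat -> profiniteModType R).
Variable d : forall k, {linear T k.+1 -> T k}.

Definition is_cycle (k : nat) : T k -> Prop :=
  match k with 0 => fun=> True | k'.+1 => fun x => d k' x = 0 end.

Definition is_boundary (k : nat) (x : T k) : Prop := exists y, d k y = x.

Lemma is_cycle0 k : is_cycle (0 : T k).
Proof. by case: k => [//|k] /=; exact: raddf0. Qed.

Lemma is_cycleZD k a (u v : T k) :
  is_cycle u -> is_cycle v -> is_cycle (a *: u + v).
Proof.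
case: k u v => [//|k] u v /= du dv.
by rewrite linearP du dv scaler0 addr0.
Qed.

Lemma is_boundary0 k : is_boundary (0 : T k).
Proof. by exists 0; rewrite raddf0. Qed.

Lemma is_boundaryZD k a (u v : T k) :
  is_boundary u -> is_boundary v -> is_boundary (a *: u + v).
Proof. by move=> [y <-] [z <-]; exists (a *: y + z); rewrite linearP. Qed.

Definition cycles k := Submodule (is_cycle0 k) (@is_cycleZD k).
Definition boundaries k := Submodule (is_boundary0 k) (@is_boundaryZD k).

Definition chain_homology (k : nat) : lmodType R :=
  subquot (cycles k) (boundaries k).

End ChainHomology.

Section Cohomology.
Variables (R : profiniteComRingType) (G : profiniteGroupType).
Variables (L : profiniteModType (cgr R G)) (P : proj_resolution L).
Variable M : profiniteModType (cgr R G).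

Definition cochain_space (k : nat) : lmodType R := P k -> restr M.

Definition is_cochain (k : nat) (f : cochain_space k) : Prop :=
  is_hom (f : P k -> M).

Lemma is_cochain0 k : is_cochain (0 : cochain_space k).
Proof.
split=> [a u v|]; last exact: cst_continuous.
by change (0 = a *: 0 + 0 :> M); rewrite scaler0 addr0.
Qed.

Lemma is_cochainZD k r (f g : cochain_space k) :
  is_cochain f -> is_cochain g -> is_cochain (r *: f + g).
Proof.
move=> [lf cf] [lg cg]; split=> [a u v|x].
  change (cgr_scal G r *: f (a *: u + v) + g (a *: u + v) =
    a *: (cgr_scal G r *: f u + g u) + (cgr_scal G r *: f v + g v) :> M).
  rewrite lf lg !scalerDr !scalerA cgr_scal_central -!addrA; congr (_ + _).
  by rewrite addrCA.
have cs : (fun u => (r, f u)) @ x --> (r, f x).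
  by apply: cvg_pair; [exact: cvg_cst|exact: cf].
have csf : (fun u => r *: f u : restr M) @ x --> (r *: f x : restr M).
  exact: (cvg_comp _ (fun z : (R * restr M)%type => z.1 *: z.2) cs
    (@restr_scale_continuous R G M (r, f x))).
have cg' : (fun u => g u : restr M) @ x --> (g x : restr M) by exact: cg.
exact: (cvg_comp _ (fun z : (M * M)%type => z.1 + z.2) (cvg_pair csf cg')
  (@profinite_mod_add_continuous _ M (r *: f x, g x))).
Qed.

Definition is_cocycle (k : nat) (f : cochain_space k) : Prop :=
  is_cochain f /\ forall x, f (res_d P k x) = 0.

Definition is_coboundary (k : nat) : cochain_space k -> Prop :=
  match k with
  | 0 => fun f => f = 0
  | k'.+1 => fun f => exists2 g : cochain_space k',
      is_cochain g & forall x, f x = g (res_d P k' x)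
  end.

Lemma is_cocycle0 k : is_cocycle (0 : cochain_space k).
Proof. by split; [exact: is_cochain0|]. Qed.

Lemma is_cocycleZD k r (f g : cochain_space k) :
  is_cocycle f -> is_cocycle g -> is_cocycle (r *: f + g).
Proof.
move=> [hf f0] [hg g0]; split; first exact: is_cochainZD.
move=> x; change (r *: f (res_d P k x) + g (res_d P k x) = 0).
by rewrite f0 g0 scaler0 addr0.
Qed.

Lemma is_coboundary0 k : is_coboundary (0 : cochain_space k).
Proof. by case: k => [//|k]; exists 0; [exact: is_cochain0|]. Qed.

Lemma is_coboundaryZD k r (f g : cochain_space k) :
  is_coboundary f -> is_coboundary g -> is_coboundary (r *: f + g).
Proof.
case: k f g => [|k] f g /=; first by move=> -> ->; rewrite scaler0 addr0.
move=> [f' hf ff] [g' hg gg]; exists (r *: f' + g'); first exact: is_cochainZD.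
move=> x; change (r *: f x + g x = r *: f' (res_d P k x) + g' (res_d P k x)).
by rewrite ff gg.
Qed.

Definition cocycles k := Submodule (is_cocycle0 k) (@is_cocycleZD k).
Definition coboundaries k := Submodule (is_coboundary0 k) (@is_coboundaryZD k).

Definition cohomology_nat (k : nat) : lmodType R :=
  subquot (cocycles k) (coboundaries k).

End Cohomology.

(* (Co)homology indexed by all integers, zero in negative degrees. *)
Definition int_graded (R : comPzRingType) (H : nat -> lmodType R) (k : int) : lmodType R :=
  match k with Posz m => H m | Negz _ => 'rV[R]_0 end.

Section TensorProducts.
Variable R : profiniteComRingType.

Definition is_bilinear (M N T : profiniteModType R) (t : M -> N -> T) : Prop :=
  [/\ forall n, linear (t^~ n), forall m, linear (t m)
    & continuous (fun z : M * N => t z.1 z.2)].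

(* Completed tensor products over R are characterized by their universal property
   among profinite R-modules. *)
Definition is_tensor (M N T : profiniteModType R) (t : M -> N -> T) : Prop :=
  is_bilinear t /\
  forall (Z : profiniteModType R) (b : M -> N -> Z), is_bilinear b ->
    exists! h : T -> Z, is_hom h /\ forall m n, h (t m n) = b m n.

Variable G : profiniteGroupType.
Implicit Types P M D T : profiniteModType (cgr R G).

Definition is_diag_tensor M D T (t : M -> D -> T) : Prop :=
  is_tensor (t : restr M -> restr D -> restr T) /\
  forall g m d, cgr_elt R g *: t m d = t (cgr_elt R g *: m) (cgr_elt R g *: d).

(* P is regarded as a right R[[G]]-module through g |-> g^-1. *)
Definition is_balanced P M (T : profiniteModType R) (t : P -> M -> T) : Prop :=
  is_bilinear (t : restr P -> restr M -> T) /\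
  forall a p m, t (cgr_inv a *: p) m = t p (a *: m).

Definition is_cgr_tensor P M (T : profiniteModType R) (t : P -> M -> T) : Prop :=
  is_balanced t /\
  forall (Z : profiniteModType R) (b : P -> M -> Z), is_balanced b ->
    exists! h : T -> Z, is_hom h /\ forall p m, h (t p m) = b p m.

(* The complex obtained by applying _ (x)_{R[[G]]} M to P. *)
Record tensor_complex (L : profiniteModType (cgr R G)) (P : proj_resolution L)
    (M : profiniteModType (cgr R G)) := TensorComplex {
  tc_mod :> nat -> profiniteModType R;
  tc_tensor : forall k, P k -> M -> tc_mod k;
  tc_tensorP : forall k, is_cgr_tensor (@tc_tensor k);
  tc_d : forall k, {linear tc_mod k.+1 -> tc_mod k};
  tc_d_continuous : forall k, continuous (tc_d k);
  tc_dE : forall k p m, tc_d k (tc_tensor p m) = tc_tensor (res_d P k p) m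
}.

End TensorProducts.

Section Duality.
Variables (R : profiniteComRingType) (G : profiniteGroupType).
Implicit Types L M D T : profiniteModType (cgr R G).

(* L is R with trivial action of G; u is then a homeomorphism, R being compact. *)
Definition trivial_module L : Prop :=
  exists u : R -> L,
    [/\ bijective u, continuous u, {morph u : x y / x + y},
        forall r x, u (r * x) = cgr_scal G r *: u x
      & forall g x, cgr_elt R g *: u x = u x].

Definition cohomology L (P : proj_resolution L) M : int -> lmodType R :=
  int_graded (cohomology_nat P M).

Definition homology L (P : proj_resolution L) M (X : tensor_complex P M) :
    int -> lmodType R :=
  int_graded (chain_homology (tc_d X)).

Definition cd_eq (n : nat) : Prop :=
  exists2 L, trivial_module L & proj_dim_eq L n.

Definition duality_group_of_dim (n : nat) : Prop :=
  [/\ cd_eq n,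
      forall L (P : proj_resolution L) M (k : int),
        trivial_module L -> finite_set [set: M] ->
        finite_set [set: cohomology P M k]
    & exists D, forall L (P : proj_resolution L) M T (t : M -> D -> T)
        (X : tensor_complex P T) (k : int),
        trivial_module L -> is_diag_tensor t ->
        exists f : {linear homology X k -> cohomology P M (n%:Z - k)}, bijective f].

Definition duality_group : Prop := exists n, duality_group_of_dim n.

End Duality.

Section FreePronilpotent.

(* An inverse limit of finite nilpotent groups: all finite continuous quotients
   are nilpotent. *)
Definition pronilpotent (G : profiniteGroupType) : Prop :=
  forall N : open_normal G, nilpotent [set: qgroup N]%G.

Definition free_pronilpotent_on (X : Type) (G : profiniteGroupType) (x : X -> G) : Prop :=
  pronilpotent G /\
  forall (H : profiniteGroupType) (y : X -> H), pronilpotent H ->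
    exists! f : G -> H,
      [/\ continuous f, {morph f : a b / (a * b)%g} & forall i, f (x i) = y i].

Definition fg_free_pronilpotent (G : profiniteGroupType) : Prop :=
  exists (d : nat) (x : 'I_d -> G), free_pronilpotent_on x.

End FreePronilpotent.

(* Main.v *)
(* Let A = Zhat[[G]], with G free pronilpotent on x_1, ..., x_d. There is a central
   idempotent e of A, fixed by g |-> g^-1, that acts as 1 on the trivial module and
   such that, at every finite level and for every prime r, each r-element g of the group
   satisfies r^k e (g - 1) = 0 for some k. The latter makes E ><| G pronilpotent for every
   profinite A-module E on which e acts as 1, so freeness provides derivations G -> E
   with prescribed values at the x_i; hence 0 -> (eA)^d -> eA -> Zhat -> 0, with
   (a_i) |-> sum_i a_i (x_i - 1), is a projective resolution.

   For d > 0 let D be the cokernel of a |-> (a (x_i^-1 - 1))_i from eA to (eA)^d,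
   generated by b_1, ..., b_d. The module M (x) D is the quotient of V^d, where
   V = M[[G]] is the module of M-valued measures on G, by the map sending the point mass
   m.g in the i-th factor to g (m (x) b_i), and the universal property of the tensor product
   computes its kernel up to e. The contraction of the resolution, transported to V,
   together with the vanishing of the measures invariant under right translation by
   some x_i (as G maps to Zhat with x_i |-> 1), then shows that
   f |-> (f(b) (x) b_j)_j and f |-> e sum_i f(b_i) (x) b_i induce isomorphisms
   H^0(G, M) -> H_1(G, M (x) D) and H^1(G, M) -> H_0(G, M (x) D). *)

From HB Require Import structures.
From mathcomp Require Import all_boot all_order all_algebra all_fingroup all_solvable.
From mathcomp Require Import ring_quotient zify.
From mathcomp Require Import boolp classical_sets functions cardinality topology.
Require Import Defs.

Set Implicit Arguments.
Unset Strict Implicit.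
Unset Printing Implicit Defensive.

Import GRing.Theory.
Local Open Scope classical_set_scope.
Local Open Scope ring_scope.
Local Open Scope quotient_scope.

Local Notation quot_repr := generic_quotient.repr.

(** * Profinite spaces *)

(** The universal property of G only tests pronilpotent groups, and for a general module E the group
    E ><| G is not one: an element of order prime to r may act nontrivially on an r-group. This
    forces the restriction to the principal block cut out by e, with the projective summands (eA)^n
    in place of free modules. About M nothing is assumed, and e need not act as 1 on M (x) D
    although it does on D; hence the kernel is only determined up to e, and the duality maps carry a
    factor e, which is consistent with complexes whose terms are powers of e (M (x) D).

    Since M (x) D is known only through its universal property, its elements are handled through V,
    which plays the part of M (x) A. V carries two commuting actions: left translation, matching the
    action on M (x) D, and a twisted right translation, matching the action on D. Left differences
    by x_i^-1 belong to the resolution, right differences by x_i to the presentation of D, and the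
    statements on cycles and boundaries are chases in the resulting double complex. *)

Lemma continuous_comp2 (T U V W : topologicalType) (h : U -> V -> W)
    (f : T -> U) (g : T -> V) :
  continuous (fun z : U * V => h z.1 z.2) -> continuous f -> continuous g ->
  continuous (fun t => h (f t) (g t)).
Proof.
move=> ch cf cg t.
exact: (cvg_comp _ (fun z : (U * V)%type => h z.1 z.2)
  (cvg_pair (cf t) (cg t)) (ch (f t, g t))).
Qed.

Lemma continuous_comp1 (T U V : topologicalType) (g : U -> V) (f : T -> U) :
  continuous g -> continuous f -> continuous (fun t => g (f t)).
Proof. by move=> cg cf t; apply: (cvg_comp f g (cf t)); exact: cg. Qed.

Lemma fst_continuous (T U : topologicalType) : continuous (fun z : T * U => z.1).
Proof. by move=> z; exact: cvg_fst. Qed.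

Lemma snd_continuous (T U : topologicalType) : continuous (fun z : T * U => z.2).
Proof. by move=> z; exact: cvg_snd. Qed.

Lemma pair_continuous (T U V : topologicalType) (f : T -> U) (g : T -> V) :
  continuous f -> continuous g -> continuous (fun t => (f t, g t)).
Proof. by move=> cf cg t; apply: cvg_pair; [exact: cf|exact: cg]. Qed.

Lemma closed_preimage (T U : topologicalType) (f : T -> U) (C : set U) :
  continuous f -> closed C -> closed [set t | C (f t)].
Proof. by move=> cf cC; move/continuous_closedP: cf; apply. Qed.

Lemma open_preimage (T U : topologicalType) (f : T -> U) (C : set U) :
  continuous f -> open C -> open [set t | C (f t)].
Proof. by move=> cf cC; move/continuousP: cf; apply. Qed.

Lemma compact_directed_nonempty (T : topologicalType) (I : Type) (f : I -> set T) :
  compact [set: T] -> inhabited I -> (forall i, closed (f i)) ->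
  (forall i, f i !=set0) ->
  (forall i j, exists k, f k `<=` f i `&` f j) -> exists x, forall i, f i x.
Proof.
move=> cT [i0] cf nf df; pose F := filter_from [set: I] f.
have FF : ProperFilter F.
  apply: filter_from_proper; last by move=> i _; exact: nf.
  apply: filter_from_filter; first by exists i0.
  by move=> i j _ _; have [k kij] := df i j; exists k.
have [x [_ clx]] := cT F FF (filterT : F [set: T]).
exists x => i; apply: cf => B xB; apply: clx => //.
by exists i.
Qed.

(** The intersection [Q] of the clopen neighbourhoods of [x] is connected: if it were the disjoint
    union of two closed parts, normality would give disjoint open sets around them, [shrink] a
    clopen set covered by these, and hence a clopen set containing [x] and missing one part. Total
    disconnectedness then leaves only [x] in [Q]. *)
Lemma profinite_zero_dimensional (T : topologicalType) :
  profinite_space T -> zero_dimensional T.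
Proof.
move=> [cT hT tT] x y xy.
pose clx := [set C : set T | clopen C /\ C x].
pose Q := [set z | forall C, clx C -> C z].
have Qx : Q x by move=> C [].
have shrink (O : set T) : open O -> Q `<=` O -> exists2 C, clx C & C `<=` O.
  move=> oO QO; apply: contrapT => noC.
  have [||||z Qz] := @compact_directed_nonempty T {C | clx C}
    (fun C => sval C `&` ~` O) cT.
  - by split; exists setT; split=> //; exact: clopenT.
  - by move=> [C [[oC cC] Cx]] /=; apply: closedI => //; exact: open_closedC.
  - move=> [C cC] /=; apply: contrapT => /nonemptyPn CO0; apply: noC.
    by exists C => // z Cz; apply: contrapT => nOz; have : set0 z by rewrite -CO0.
  - move=> [C [cC Cx]] [D [cD Dx]] /=.
    have CD : clx (C `&` D) by split; [exact: clopenI|split].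
    by exists (exist _ _ CD) => z /= [[]].
  - have oT : clx setT by split=> //; exact: clopenT.
    have [_ +] := Qz (exist _ _ oT); apply; apply: QO => C cC.
    by have [] := Qz (exist _ _ cC).
have cQ : closed Q.
  have -> : Q = \bigcap_(C in clx) C.
    by apply/seteqP; split=> [z Qz C cC|z Qz C cC]; exact: Qz.
  by apply: closed_bigI => C [[]].
have sepQ (B : set T) : B x -> closed B -> closed (Q `\` B) -> Q `<=` B.
  move=> Bx cB cQB.
  have /(_ B cB (~` (Q `\` B))) : normal_space T by exact: compact_normal.
  case=> [|O].
    rewrite /set_nbhs; apply/set_nbhsP; exists (~` (Q `\` B)); split=> //.
      exact: closed_openC.
    by move=> z Bz [].
  move=> /set_nbhsP [V [oV BV VO]] clO.
  pose W := ~` (closure O).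
  have oW : open W by exact/closed_openC/closed_closure.
  have QVW : Q `<=` V `|` W.
    move=> z Qz; have [Bz|nBz] := pselect (B z); first by left; exact: BV.
    by right => /clO; apply.
  have [C [[oC cC] Cx] CVW] := shrink _ (openU oV oW) QVW.
  have VW z : V z -> W z -> False.
    by move=> /VO Oz; apply; exact: subset_closure.
  have CVE : C `&` V = C `&` ~` W.
    apply/seteqP; split=> z [Cz Vz]; split=> //; first by move=> /(VW _ Vz).
    by have [] := CVW z Cz.
  have clCV : clx (C `&` V).
    split; last by split=> //; exact: BV.
    split; first exact: openI.
    by rewrite CVE; apply: closedI => //; exact: open_closedC.
  move=> z Qz; apply: contrapT => nBz; have [_ /VO Oz] := Qz _ clCV.
  by have /(_ (conj Qz nBz)) := clO z (subset_closure Oz).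
have conQ : connected Q.
  move=> B [b Bb] [O oO BO] [C cC BC].
  have cB : closed B by rewrite BC; exact: closedI.
  have cQB : closed (Q `\` B).
    rewrite BO setDIr setDv set0U; apply: closedI => //; exact: open_closedC.
  have BQ : B `<=` Q by rewrite BO => z [].
  have [Bx|nBx] := pselect (B x).
    by apply/seteqP; split=> //; exact: sepQ.
  have := sepQ (Q `\` B) (conj Qx nBx) cQB.
  rewrite setDD => /(_ _) sQ; exfalso; have [] // := sQ _ b; last exact: BQ.
  by apply: closedI.
have Qy : ~ Q y.
  move=> Qy; have : connected_component setT x y by exists Q.
  by rewrite tT // => /= yx; move: xy; rewrite yx eqxx.
have /existsNP [C /not_implyP [[cC Cx] nCy]] := Qy.
by exists C.
Qed.

Lemma zero_dimensional_hausdorff (T : topologicalType) :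
  zero_dimensional T -> hausdorff_space T.
Proof.
move=> zT x y xy; apply/eqP/negP => /negP /zT [U [[oU cU] Ux Uy]].
have [] := xy U (~` U); [exact: open_nbhs_nbhs| |by move=> z []].
by apply: open_nbhs_nbhs; split=> //; exact: closed_openC.
Qed.

Lemma zero_dimensional_profinite (T : topologicalType) :
  compact [set: T] -> zero_dimensional T -> profinite_space T.
Proof.
move=> cT zT; split=> //; first exact: zero_dimensional_hausdorff.
exact: zero_dimension_totally_disconnected.
Qed.

Lemma zero_dimensional_initial (T U : topologicalType) (f : T -> U) :
  continuous f -> injective f -> zero_dimensional U -> zero_dimensional T.
Proof.
move=> cf fI zU x y xy; have [|C [cC Cx Cy]] := zU (f x) (f y).
  by rewrite (inj_eq fI).
by exists (f @^-1` C); split=> //; exact: preimage_clopen.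
Qed.

Lemma profinite_clopen_nbhs (T : topologicalType) (x : T) (W : set T) :
  profinite_space T -> nbhs x W -> exists C, [/\ clopen C, C x & C `<=` W].
Proof.
move=> pT; have [cT hT _] := pT => /(zero_dimensional_cvg hT
  (profinite_zero_dimensional pT) cT) [C [Cx cC] CW].
by exists C.
Qed.

(** The tube lemma. It is what makes the largest invariant submodule, ideal or subgroup attached to
    an open condition open again. *)
Lemma compact_forall_open (T U : topologicalType) (P : T -> U -> Prop) :
  compact [set: U] -> open [set z : T * U | P z.1 z.2] ->
  open [set t | forall u, P t u].
Proof.
move=> cU oP; rewrite openE => t /= Pt.
have /compact_near_coveringP ncU := cU.
have := ncU T (nbhs t) P (nbhs_filter t); rewrite /interior /= => H.
have {H} : \near t, [set: U] `<=` P t.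
  apply: H => u _.
  have : nbhs (t, u) [set z : T * U | P z.1 z.2].
    by apply: open_nbhs_nbhs; split=> //=; exact: Pt.
  case=> [[A B] [/= tA uB] AB].
  by exists (B, A) => //= -[v s] [/= Bv As]; exact: (AB (s, v)).
by apply: filterS => s sP u; exact: sP.
Qed.

Lemma clopen_preimage_iff (T : topologicalType) (P Q : T -> Prop) :
  clopen [set t | P t] -> clopen [set t | Q t] -> clopen [set t | P t <-> Q t].
Proof.
move=> cP cQ.
rewrite (_ : [set t | P t <-> Q t] =
  ([set t | P t] `&` [set t | Q t]) `|` (~` [set t | P t] `&` ~` [set t | Q t])).
  by apply: clopenU; apply: clopenI => //; exact: clopenC.
apply/seteqP; split=> t /=.
  by move=> PQ; have [Pt|nPt] := pselect (P t); [left|right]; split => //; tauto.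
by move=> [[]|[]]; tauto.
Qed.

Lemma closed_image (T U : topologicalType) (f : T -> U) :
  compact [set: T] -> hausdorff_space U -> continuous f ->
  closed [set u | exists t, f t = u].
Proof.
move=> cT hU cf; rewrite (_ : [set u | _] = f @` setT).
  apply: compact_closed => //; apply: continuous_compact => //.
  exact: continuous_subspaceT.
by apply/seteqP; split=> u /= => [[t <-]|[t _ <-]]; exists t.
Qed.

(** * Profinite modules *)

Section SubmoduleTheory.
Variables (A : pzRingType) (V : lmodType A) (W : submodule V).

Lemma submodD u v : W u -> W v -> W (u + v).
Proof. by move=> Wu Wv; rewrite -[u]scale1r; exact: submodZD. Qed.

Lemma submodZ a u : W u -> W (a *: u).
Proof. by move=> Wu; rewrite -[X in W X]addr0; apply: submodZD => //; exact: submod0. Qed.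

Lemma submodN u : W u -> W (- u).
Proof. by move=> Wu; rewrite -scaleN1r; exact: submodZ. Qed.

Lemma submodB u v : W u -> W v -> W (u - v).
Proof. by move=> Wu Wv; apply: submodD => //; exact: submodN. Qed.

Lemma submod_sum (I : Type) (r : seq I) (P : pred I) (F : I -> V) :
  (forall i, P i -> W (F i)) -> W (\sum_(i <- r | P i) F i).
Proof. by move=> WF; elim/big_ind: _ => //; [exact: submod0|exact: submodD]. Qed.

Lemma submodBC u v : W (u - v) -> W (v - u).
Proof. by move=> /submodN; rewrite opprB. Qed.

Lemma submodB_trans v u w : W (u - v) -> W (v - w) -> W (u - w).
Proof. by move=> uv vw; have := submodD uv vw; rewrite addrA subrK. Qed.

End SubmoduleTheory.

Section ModuleContinuity.
Variables (A : topPzRingType) (M : profiniteModType A) (T : topologicalType).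
Implicit Types f g : T -> M.

Lemma continuousD f g :
  continuous f -> continuous g -> continuous (fun t => f t + g t).
Proof. by move=> cf cg; apply: (continuous_comp2 (@profinite_mod_add_continuous A M)). Qed.

Lemma continuousN f : continuous f -> continuous (fun t => - f t).
Proof. exact: (continuous_comp1 (@profinite_mod_opp_continuous A M)). Qed.

Lemma continuousB f g :
  continuous f -> continuous g -> continuous (fun t => f t - g t).
Proof. by move=> cf cg; apply: continuousD => //; exact: continuousN. Qed.

Lemma continuousZ (s : T -> A) f :
  continuous s -> continuous f -> continuous (fun t => s t *: f t).
Proof. by move=> cs cf; apply: (continuous_comp2 (@profinite_scale_continuous A M)). Qed.

Lemma continuousZr a f : continuous f -> continuous (fun t => a *: f t).
Proof. by move=> cf; apply: continuousZ => //; exact: cst_continuous. Qed.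

Lemma continuous_sum (I : Type) (r : seq I) (F : I -> T -> M) :
  (forall i, continuous (F i)) -> continuous (fun t => \sum_(i <- r) F i t).
Proof.
move=> cF; elim: r => [|i r IH].
  rewrite (_ : (fun _ => _) = fun=> 0); first exact: cst_continuous.
  by apply/funext => t; rewrite big_nil.
rewrite (_ : (fun _ => _) = fun t => F i t + \sum_(j <- r) F j t).
  exact: continuousD.
by apply/funext => t; rewrite big_cons.
Qed.

End ModuleContinuity.

Section OpenSubmodules.
Variables (A : topPzRingType) (M : profiniteModType A).
Implicit Types (O : submodule M) (x y : M).

Let pM := @profinite_module_space A M.

Lemma profinite_module_hausdorff : hausdorff_space M.
Proof. by have [] := pM. Qed.

Lemma profinite_module_compact : compact [set: M].
Proof. by have [] := pM. Qed.

Lemma module_closed_set1 x : closed [set x].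
Proof.
by apply: compact_closed; [exact: profinite_module_hausdorff|exact: compact_set1].
Qed.

Lemma closed_eq_fun (T : topologicalType) (f g : T -> M) :
  continuous f -> continuous g -> closed [set t | f t = g t].
Proof.
move=> cf cg.
rewrite (_ : [set t | f t = g t] = [set t | [set 0] (f t - g t)]).
  apply: closed_preimage; first exact: continuousB.
  exact: module_closed_set1.
by apply/seteqP; split=> t /= => [->|/eqP]; [rewrite subrr|rewrite subr_eq0 => /eqP].
Qed.

Lemma open_coset O (y : M) : open (O : set M) -> open [set x | O (x - y)].
Proof.
move=> oO; apply: (open_preimage (f := fun x => x - y)) => //.
by apply: continuousB; [move=> x; exact: cvg_id|exact: cst_continuous].
Qed.

Lemma near_submodule O y : open (O : set M) -> \forall x \near y, O (x - y).
Proof.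
move=> oO; apply: open_nbhs_nbhs; split; first exact: open_coset.
by rewrite /= subrr; exact: submod0.
Qed.

Lemma open_submodule_clopen O : open (O : set M) -> clopen (O : set M).
Proof.
move=> oO; split=> //; rewrite -[X in closed X]setCK; apply: open_closedC.
rewrite openE => y /= nOy; apply: filterS (near_submodule y oO) => x /= xy Ox.
by apply: nOy; have := submodB Ox xy; rewrite opprB addrC subrK.
Qed.

Lemma closed_coset O (y : M) : open (O : set M) -> closed [set x | O (x - y)].
Proof.
move=> /open_submodule_clopen [_ cO]; apply: (closed_preimage (f := fun x => x - y)) => //.
by apply: continuousB; [move=> x; exact: cvg_id|exact: cst_continuous].
Qed.

Hypothesis cA : compact [set: A].

(* [O] is the largest submodule under which a clopen neighbourhood of 0 is
   translation invariant. *)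
Lemma open_submodule_basis (W : set M) : nbhs (0 : M) W ->
  exists2 O : submodule M, open (O : set M) & O `<=` W.
Proof.
move=> /(profinite_clopen_nbhs pM) [C [cC C0 CW]].
pose o x := forall z : A * M, C (z.2 + z.1 *: x) <-> C z.2.
have o0 : o 0 by move=> z; rewrite scaler0 addr0.
have oZD a u v : o u -> o v -> o (a *: u + v).
  move=> ou ov z; rewrite scalerDr addrA scalerA.
  by rewrite (ov (z.1, z.2 + (z.1 * a) *: u)) (ou (z.1 * a, z.2)).
exists (Submodule o0 oZD); last first.
  by move=> x ox; apply: CW; move: (ox (1, 0)); rewrite /= scale1r add0r => ->.
apply: compact_forall_open.
  by rewrite -setXTT; apply: compact_setX => //; exact: profinite_module_compact.
have [||oP _] := clopen_preimage_iff
  (P := fun z : M * (A * M) => C (z.2.2 + z.2.1 *: z.1)) (Q := fun z => C z.2.2).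
- apply: (preimage_clopen (f := fun z : M * (A * M) => z.2.2 + z.2.1 *: z.1)) => //.
  apply: continuousD.
    exact: (continuous_comp1 (@snd_continuous A M) (@snd_continuous M (A * M)%type)).
  apply: continuousZ; last exact: fst_continuous.
  exact: (continuous_comp1 (@fst_continuous A M) (@snd_continuous M (A * M)%type)).
- apply: (preimage_clopen (f := fun z : M * (A * M) => z.2.2)) => //.
  exact: (continuous_comp1 (@snd_continuous A M) (@snd_continuous M (A * M)%type)).
exact: oP.
Qed.

Lemma open_submodule_sep x y : x <> y ->
  exists2 O : submodule M, open (O : set M) & ~ O (x - y).
Proof.
move=> xy; have nb : nbhs (0 : M) (~` [set x - y]).
  apply: open_nbhs_nbhs; split.
    apply: closed_openC; exact: module_closed_set1.
  by move=> /= /esym/eqP; rewrite subr_eq0 => /eqP.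
have [O oO Osub] := open_submodule_basis nb.
by exists O => // Oxy; exact: (Osub _ Oxy erefl).
Qed.

Lemma open_submodule_eq x y :
  (forall O : submodule M, open (O : set M) -> O (x - y)) -> x = y.
Proof.
by move=> xy; apply: contrapT => /open_submodule_sep [O oO]; apply; exact: xy.
Qed.

Lemma open_submodule_continuous (T : topologicalType) (f : T -> M) :
  (forall (O : submodule M) t, open (O : set M) -> \forall s \near t, O (f s - f t)) ->
  continuous f.
Proof.
move=> fP t W Wft.
have : nbhs (0 : M) [set x | W (f t + x)].
  have : (fun x => f t + x) @ 0 --> f t + 0.
    by apply: continuousD => x; [exact: cvg_cst|exact: cvg_id].
  by rewrite addr0; apply.
move=> /open_submodule_basis [O oO OW]; apply: filterS (fP O t oO) => s /OW /=.
by rewrite addrC subrK.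
Qed.

End OpenSubmodules.

(** * Powers, closed submodules and quotients of profinite modules *)

Section Power.
Variables (A : topPzRingType) (J : Type) (M : profiniteModType A).

Definition power : Type := J -> M.
HB.instance Definition _ := GRing.Lmodule.on power.
HB.instance Definition _ :=
  Topological.copy power (prod_topology (fun _ : {classic J} => M : topologicalType)).

Lemma power_proj_continuous j : continuous (fun f : power => f j).
Proof. exact: (@proj_continuous {classic J} (fun=> M : topologicalType) j). Qed.

Lemma power_continuous (T : topologicalType) (F : T -> power) :
  (forall j, continuous (fun t => F t j)) -> continuous F.
Proof.
move=> cF t; apply/cvg_sup => j W.
rewrite (@nbhsE (initial_topology _)) => -[_ [[U oU <-] Ut] UW].
suff : nbhs t [set s | U (F s j)] by apply: filterS => s; exact: UW.
by apply: (cF j t); apply: open_nbhs_nbhs.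
Qed.

Lemma power_add_continuous : continuous (fun z : power * power => z.1 + z.2).
Proof.
apply: power_continuous => j.
apply: (continuousD (f := fun z : power * power => z.1 j) (g := fun z => z.2 j)).
  exact: (continuous_comp1 (f := fun z : power * power => z.1) (@power_proj_continuous j) (@fst_continuous _ _)).
exact: (continuous_comp1 (@power_proj_continuous j) (@snd_continuous power power)).
Qed.

Lemma power_opp_continuous : continuous (fun x : power => - x).
Proof.
apply: power_continuous => j; apply: (continuousN (f := fun x : power => x j)).
exact: power_proj_continuous.
Qed.

Lemma power_scale_continuous : continuous (fun z : A * power => z.1 *: z.2).
Proof.
apply: power_continuous => j.
apply: (continuousZ (s := fst) (f := fun z : A * power => z.2 j)).
  exact: fst_continuous.
exact: (continuous_comp1 (@power_proj_continuous j) (@snd_continuous A power)).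
Qed.

Lemma power_profinite : profinite_space power.
Proof.
apply: zero_dimensional_profinite; last first.
  apply: (@zero_dimension_prod {classic J} (fun=> M : topologicalType)) => _.
  exact/profinite_zero_dimensional/profinite_module_space.
rewrite [X in compact X](_ : _ = [set f : power | forall j, [set: M] (f j)]).
  apply: (@tychonoff {classic J} (fun=> M : topologicalType) (fun=> setT)) => _.
  exact: profinite_module_compact.
by apply/seteqP; split.
Qed.

HB.instance Definition _ := isProfiniteModule.Build A power
  power_add_continuous power_opp_continuous power_scale_continuous power_profinite.

End Power.

Section ClosedSubmodule.
Variables (A : topPzRingType) (M : profiniteModType A).

Record closed_submodule := ClosedSubmodule {
  csub_set :> submodule M;
  csub_closed : closed (csub_set : set M)
}.

Variable K : closed_submodule.

Definition csub : Type := submod_type K.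
HB.instance Definition _ := GRing.Lmodule.on csub.
HB.instance Definition _ := SubChoice.on csub.
HB.instance Definition _ :=
  Topological.copy csub (initial_topology (val : submod_type K -> M)).

Definition csval (x : csub) : M := val x.

Lemma csvalP x : K (csval x).
Proof. by have /asboolP := valP x. Qed.

Definition csin (x : M) (Kx : K x) : csub := exist _ x (asboolT Kx).

Lemma csval_inj : injective csval.
Proof. exact: val_inj. Qed.

Lemma csval_is_linear : linear csval.
Proof. by move=> a x y; rewrite /csval linearP. Qed.
HB.instance Definition _ := GRing.isLinear.Build A csub M *:%R csval csval_is_linear.

Lemma csval_continuous : continuous csval.
Proof. exact: (@initial_continuous _ _ (val : submod_type K -> M)). Qed.

Lemma csub_continuous (T : topologicalType) (f : T -> csub) :
  continuous (fun t => csval (f t)) -> continuous f.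
Proof.
move=> cf; apply/continuousP => _ [U oU <-].
by move/continuousP: cf => /(_ _ oU).
Qed.

Lemma csub_add_continuous : continuous (fun z : csub * csub => z.1 + z.2).
Proof.
apply: csub_continuous.
rewrite [X in continuous X](_ : _ = fun z : csub * csub => csval z.1 + csval z.2).
  apply: continuousD.
    exact: (continuous_comp1 csval_continuous (@fst_continuous csub csub)).
  exact: (continuous_comp1 csval_continuous (@snd_continuous csub csub)).
by apply/funext => z; rewrite raddfD.
Qed.

Lemma csub_opp_continuous : continuous (fun x : csub => - x).
Proof.
apply: csub_continuous.
rewrite [X in continuous X](_ : _ = fun z : csub => - csval z).
  by apply: continuousN; exact: csval_continuous.
by apply/funext => z; rewrite raddfN.
Qed.

Lemma csub_scale_continuous : continuous (fun z : A * csub => z.1 *: z.2).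
Proof.
apply: csub_continuous.
rewrite [X in continuous X](_ : _ = fun z : A * csub => z.1 *: csval z.2).
  apply: continuousZ; first exact: fst_continuous.
  exact: (continuous_comp1 csval_continuous (@snd_continuous A csub)).
by apply/funext => z; rewrite linearZ.
Qed.

Lemma csub_profinite : profinite_space csub.
Proof.
apply: zero_dimensional_profinite; last first.
  apply: (zero_dimensional_initial csval_continuous csval_inj).
  exact/profinite_zero_dimensional/profinite_module_space.
have cK : compact (K : set M).
  apply: (subclosed_compact (@csub_closed K) (@profinite_module_compact A M)).
  by [].
move=> F FF _.
have FK : (csval @ F) (K : set M).
  by apply: (@filterS _ F _ setT) filterT => x _; exact: csvalP.
have [x [Kx clx]] := cK (csval @ F) (fmap_proper_filter _ _) FK.
exists (csin Kx); split=> // B C FB.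
rewrite (@nbhsE (initial_topology (val : submod_type K -> M))).
move=> [_ [[U oU <-] Ux] UC].
have FB' : (csval @ F) (csval @` B).
  by apply: (@filterS _ F _ B) FB => y By; exists y.
have [_ [[y By <-] Uy]] := clx _ U FB' (open_nbhs_nbhs (conj oU Ux)).
by exists y; split=> //; exact: UC.
Qed.

HB.instance Definition _ := isProfiniteModule.Build A csub
  csub_add_continuous csub_opp_continuous csub_scale_continuous csub_profinite.

End ClosedSubmodule.

Section QuotientModule.
Variables (A : topPzRingType) (cA : compact [set: A]) (M : profiniteModType A).
Variable K : closed_submodule M.

Definition full_submodule : submodule M :=
  @Submodule A M (fun=> True) Logic.I (fun _ _ _ _ _ => Logic.I).

(** The compactness proof is an argument of the type because the profinite structure depends on it:
    separating points of the quotient requires a basis of open submodules. *)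
Definition cquot of compact [set: A] : Type := subquot full_submodule K.
Local Notation Q := (cquot cA).
HB.instance Definition _ := GRing.Lmodule.on Q.

Definition cqpi (x : M) : Q :=
  sqpi K (exist _ x (asboolT Logic.I) : submod_type full_submodule).

Lemma cqpi_is_linear : linear cqpi.
Proof.
move=> a x y; rewrite /cqpi -[RHS]/(a *: sqpi K _ + sqpi K _).
rewrite -[a *: sqpi K _]/(subquot_scale a _) subquot_scaleE -raddfD.
by congr sqpi; exact: val_inj.
Qed.
HB.instance Definition _ := GRing.isLinear.Build A M Q *:%R cqpi cqpi_is_linear.

Lemma cqpi_surj (c : Q) : exists x, c = cqpi x.
Proof.
have [[x px] ->] := sqpi_surj c; exists x.
by congr sqpi; exact: val_inj.
Qed.

Lemma cqpi_eq x y : cqpi x = cqpi y <-> K (x - y).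
Proof.
by split=> [/sqpiP/asboolP //|Kxy]; apply/sqpiP/asboolP.
Qed.

Lemma cqpi0 x : cqpi x = 0 <-> K x.
Proof. by rewrite -(raddf0 cqpi) cqpi_eq subr0. Qed.

Definition cquot_open (U : set Q) : Prop := open (cqpi @^-1` U).

Lemma cquot_openT : cquot_open setT.
Proof. exact: openT. Qed.
Lemma cquot_openI U V : cquot_open U -> cquot_open V -> cquot_open (U `&` V).
Proof. exact: openI. Qed.
Lemma cquot_open_bigU (I : Type) (f : I -> set Q) :
  (forall i, cquot_open (f i)) -> cquot_open (\bigcup_i f i).
Proof.
by move=> fo; rewrite /cquot_open preimage_bigcup; apply: bigcup_open => i _; exact: fo.
Qed.
HB.instance Definition _ :=
  isOpenTopological.Build Q cquot_openT cquot_openI cquot_open_bigU.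

Lemma cqpi_continuous : continuous cqpi.
Proof. exact/continuousP. Qed.

Lemma cqpi_open (W : set M) : open W -> open (cqpi @` W).
Proof.
move=> oW; suff : open (cqpi @^-1` (cqpi @` W)) by [].
rewrite openE => z [w Ww /cqpi_eq Kwz].
have : nbhs z [set z' | W (z' + (w - z))].
  apply: open_nbhs_nbhs; split; last by rewrite /mkset [z + _]addrC subrK.
  apply: (open_preimage (f := fun z' => z' + (w - z))) => //.
  by apply: continuousD; [move=> x; exact: cvg_id|exact: cst_continuous].
apply: filterS => z' Wz'; exists (z' + (w - z)) => //.
by apply/cqpi_eq; rewrite addrC addKr.
Qed.

(** As [cqpi] is open, its product with the identity of [X] is still a quotient map. The joint
    continuity of the operations on [Q] is obtained from this one variable at a time. *)
Lemma cquot_continuous2 (X T : topologicalType) (f : X -> Q -> T) :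
  continuous (fun z : X * M => f z.1 (cqpi z.2)) ->
  continuous (fun z : X * Q => f z.1 z.2).
Proof.
move=> cf [x c] W; have [m ->] := cqpi_surj c => /= Wf.
have [[B1 B2] [/= xB1 mB2] BW] := cf (x, m) W Wf.
exists (B1, cqpi @` (B2^°)%classic); last first.
  by move=> [x' _] [/= Bx' [m' Bm' <-]]; apply: (BW (x', m')); split=> //; exact: interior_subset.
split=> //=; apply: open_nbhs_nbhs; split; first exact/cqpi_open/open_interior.
by exists m.
Qed.

Lemma cquot_add_continuous : continuous (fun z : Q * Q => z.1 + z.2).
Proof.
apply: (cquot_continuous2 (f := fun x y : Q => x + y)).
have H : continuous (fun z : M * Q => cqpi z.1 + z.2).
  apply: (cquot_continuous2 (f := fun (x : M) (y : Q) => cqpi x + y)).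
  rewrite (_ : (fun _ => _) = fun z : M * M => cqpi (z.1 + z.2)).
    exact: (continuous_comp1 cqpi_continuous (@profinite_mod_add_continuous A M)).
  by apply/funext => z; rewrite raddfD.
have H' : continuous (fun z : M * Q => z.2 + cqpi z.1).
  rewrite (_ : (fun _ => _) = fun z : M * Q => cqpi z.1 + z.2) //.
  by apply/funext => z; rewrite addrC.
exact: (continuous_comp1 H' (@swap_continuous Q M)).
Qed.

Lemma cquot_opp_continuous : continuous (fun x : Q => - x).
Proof.
have H : continuous (fun z : M * Q => - z.2).
  apply: (cquot_continuous2 (f := fun (_ : M) (y : Q) => - y)).
  rewrite (_ : (fun _ => _) = fun z : M * M => cqpi (- z.2)).
    apply: (continuous_comp1 cqpi_continuous).
    by apply: continuousN; exact: snd_continuous.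
  by apply/funext => z; rewrite raddfN.
apply: (continuous_comp1 (f := fun y : Q => (0 : M, y)) H).
by apply: pair_continuous; [exact: cst_continuous|move=> x; exact: cvg_id].
Qed.

Lemma cquot_scale_continuous : continuous (fun z : A * Q => z.1 *: z.2).
Proof.
apply: (cquot_continuous2 (f := fun (a : A) (y : Q) => a *: y)).
rewrite (_ : (fun _ => _) = fun z : A * M => cqpi (z.1 *: z.2)).
  exact: (continuous_comp1 cqpi_continuous (@profinite_scale_continuous A M)).
by apply/funext => z; rewrite linearZ.
Qed.

(** Two cosets are separated by a coset of the open submodule [S] = [K] + [O], where [O] is so small
    that [x - y + O] misses the closed set [K]. Such a coset is clopen and a union of cosets of
    [K]. *)
Lemma cquot_profinite : profinite_space Q.
Proof.
apply: zero_dimensional_profinite.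
  rewrite (_ : [set: Q] = cqpi @` [set: M]).
    apply: continuous_compact; last exact: profinite_module_compact.
    exact/continuous_subspaceT/cqpi_continuous.
  by apply/seteqP; split=> // c _; have [x ->] := cqpi_surj c; exists x.
move=> a b; have [x ->] := cqpi_surj a; have [y ->] := cqpi_surj b.
move=> /eqP; rewrite cqpi_eq => nK.
have nb : nbhs (0 : M) [set z | ~ K (x - y + z)].
  apply: open_nbhs_nbhs; split; last by rewrite /mkset addr0.
  apply: closed_openC; apply: (closed_preimage (f := fun z => x - y + z)).
    by apply: continuousD; [exact: cst_continuous|move=> z; exact: cvg_id].
  exact: csub_closed.
have [O oO OK] := open_submodule_basis cA nb.
pose KO z := exists2 k, K k & O (z - k).
have KO0 : KO 0 by exists 0; [exact: submod0|rewrite subr0; exact: submod0].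
have KOZD c u v : KO u -> KO v -> KO (c *: u + v).
  move=> [k Kk Ok] [l Kl Ol]; exists (c *: k + l); first exact: submodZD.
  by rewrite opprD addrACA -scalerBr; exact: submodZD.
pose S := Submodule KO0 KOZD.
have oS : open (S : set M).
  rewrite openE => z [k Kk Ok]; apply: filterS (near_submodule z oO) => z' Oz'.
  by exists k => //; exact: (submodB_trans Oz').
have KS k : K k -> S k by move=> Kk; exists k => //; rewrite subrr; exact: submod0.
exists [set c | exists2 z, c = cqpi z & S (z - x)].
have preS : cqpi @^-1` [set c | exists2 z, c = cqpi z & S (z - x)] =
    [set z | S (z - x)].
  apply/seteqP; split=> z /= => [[z' /cqpi_eq Kz S'z]|Sz]; last by exists z.
  by apply: (@submodB_trans _ _ S z') => //; exact: KS.
split.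
- split.
    rewrite -[open _]/(open (cqpi @^-1` _)) preS; exact: open_coset.
  rewrite -openC -[open _]/(open (~` (cqpi @^-1` _))) preS openC.
  exact: closed_coset.
- by exists x => //; rewrite subrr; exact: submod0.
- move=> [z /cqpi_eq Kyz Sz].
  have [k Kk Ok] : S (y - x) by apply: (@submodB_trans _ _ S z) => //; exact: KS.
  by apply: (OK _ Ok); rewrite addrA -(opprB x y) subrr add0r; exact: submodN.
Qed.

HB.instance Definition _ := isProfiniteModule.Build A Q
  cquot_add_continuous cquot_opp_continuous cquot_scale_continuous cquot_profinite.

End QuotientModule.

Section DenseExtension.
Variables (A : topPzRingType) (cA : compact [set: A]) (E : profiniteModType A).
Variables (X : topologicalType) (Gamma : X -> E -> Prop).

(* The value at x is a cluster point of the values at points near x; modulo an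
   open submodule these are eventually constant. *)
Lemma dense_extension :
  closure [set x | exists z, Gamma x z] = setT ->
  (forall O : submodule E, open (O : set E) -> exists phi : X -> E,
    (forall x, \forall y \near x, O (phi y - phi x)) /\
    (forall x z, Gamma x z -> O (phi x - z))) ->
  exists2 F : X -> E, continuous F & forall x z, Gamma x z -> F x = z.
Proof.
move=> dG phiP.
have lim (x : X) : exists z : E, forall O : submodule E, open (O : set E) ->
    forall phi : X -> E, (forall x, \forall y \near x, O (phi y - phi x)) ->
    (forall x z, Gamma x z -> O (phi x - z)) -> O (phi x - z).
  pose B (V : set X) := [set z | exists2 y, V y & Gamma y z].
  pose F := filter_from (nbhs x) B.
  have FF : ProperFilter F.
    apply: filter_from_proper; last first.
      move=> V xV; have : closure [set x | exists z, Gamma x z] x by rewrite dG.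
      by move=> /(_ V xV) [y [[z Gyz] Vy]]; exists z; exists y.
    apply: filter_from_filter; first by exists setT; exact: filterT.
    move=> V W xV xW; exists (V `&` W); first exact: filterI.
    by move=> z [y [Vy Wy] Gyz]; split; exists y.
  have [z [_ clz]] := @profinite_module_compact A E F FF (filterT : F setT).
  exists z => O oO phi phi_lc phiG.
  have [||w [[y Vy Gyw] Ow]] := clz (B [set y | O (phi y - phi x)]) [set w | O (w - z)].
  - by exists [set y | O (phi y - phi x)] => //; exact: phi_lc.
  - exact: near_submodule.
  apply: submodB_trans (submodB_trans (phiG _ _ Gyw) Ow).
  exact/submodBC/Vy.
pose F x := projT1 (cid (lim x)).
have FP x : forall O : submodule E, open (O : set E) ->
    forall phi : X -> E, (forall x, \forall y \near x, O (phi y - phi x)) ->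
    (forall x z, Gamma x z -> O (phi x - z)) -> O (phi x - F x).
  exact: (projT2 (cid (lim x))).
exists F.
  apply: (open_submodule_continuous cA) => O x oO.
  have [phi [phi_lc phiG]] := phiP O oO.
  apply: filterS (phi_lc x) => y Oyx.
  apply: submodB_trans (submodB_trans Oyx (FP x O oO phi phi_lc phiG)).
  exact/submodBC/(FP y).
move=> x z Gxz; apply: (open_submodule_eq cA) => O oO.
have [phi [phi_lc phiG]] := phiP O oO.
by apply: submodB_trans (phiG _ _ Gxz); exact/submodBC/(FP x).
Qed.

End DenseExtension.

(** * Profinite groups and completed group rings *)

Lemma locally_constant_finite (T : topologicalType) (S : Type) (f : T -> S) :
  compact [set: T] -> (forall x, \forall y \near x, f y = f x) ->
  exists s : seq T, forall x, exists2 y, List.In y s & f x = f y.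
Proof.
move=> cT lc.
have [[t0 _]|/forallNP T0] := pselect (exists t : T, True); last first.
  by exists [::] => x; case: (T0 x).
pose pT : ptopologicalType :=
  HB.pack (T : Type) (Topological.class T) (isPointed.Build T t0).
have {cT} : @compact pT setT by exact: cT.
rewrite compact_cover => /(_ T setT (fun x => [set y | f y = f x]^°)%classic).
case=> [x _|x _|D _ cov].
- exact: open_interior.
- by exists x => //; exact: lc.
exists (finmap.enum_fset D) => x; have [y yD xy] := cov x I.
exists y; last exact: (interior_subset xy).
have {}yD : y \in (finmap.enum_fset D : seq T) by exact: yD.
elim: (finmap.enum_fset D) yD => [//|z s IH] /=.
by rewrite inE => /orP[/eqP ->|/IH]; [left|right].
Qed.

Lemma finite_set_list (S : Type) (s : seq S) :
  (forall x, List.In x s) -> finite_set [set: S].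
Proof.
move=> sP; apply: (@sub_finite_set _ _ [set x | List.In x s]) => [x _|].
  exact: sP.
elim: s {sP} => [|x s IH]; first exact: finite_set0.
rewrite (_ : [set _ | _] = [set x] `|` [set y | List.In y s]).
  by rewrite finite_setU.
by apply/seteqP; split=> y /= [->|?]; by [left|right].
Qed.

Lemma finite_set_surj (S T : Type) (f : S -> T) :
  finite_set [set: S] -> (forall y, exists x, f x = y) -> finite_set [set: T].
Proof.
move=> fS sf; rewrite (_ : [set: T] = f @` setT); first exact: finite_image.
by apply/seteqP; split=> // y _; have [x <-] := sf y; exists x.
Qed.

Lemma finite_set_inj (S T : Type) (f : S -> T) :
  injective f -> finite_set [set: T] -> finite_set [set: S].
Proof.
move=> fI fT; rewrite (_ : setT = f @^-1` [set: T]) //.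
by apply: finite_preimage => // x y _ _; exact: fI.
Qed.

Lemma finite_set_ffun (Q : finType) (S : eqType) :
  finite_set [set: S] -> finite_set [set: {ffun Q -> S}].
Proof.
move=> /finite_seqP [s sE].
have sP (x : S) : (index x s < size s)%N.
  by rewrite index_mem; have : [set` s] x by rewrite -sE.
pose F (f : {ffun Q -> S}) := [ffun q => Ordinal (sP (f q))].
apply: (@finite_set_inj _ _ F).
  move=> f g fg; apply/ffunP => q.
  have /(congr1 val) /= := congr1 (fun h : {ffun Q -> 'I_(size s)} => h q) fg.
  rewrite !ffunE /= => fgq.
  by rewrite -(nth_index (f q) (_ : f q \in s)) ?fgq ?nth_index // -index_mem.
exact: finite_finset.
Qed.

Section OpenNormalSubgroups.
Variable G : profiniteGroupType.

Lemma profinite_group_compact : compact [set: G].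
Proof. by have [] := @profinite_group_space G. Qed.

Lemma continuousM (T : topologicalType) (f g : T -> G) :
  continuous f -> continuous g -> continuous (fun t => (f t * g t)%g).
Proof. by move=> cf cg; apply: (continuous_comp2 (@profinite_mulg_continuous G)). Qed.

Lemma continuousV (T : topologicalType) (f : T -> G) :
  continuous f -> continuous (fun t => (f t)^-1%g).
Proof. exact: (continuous_comp1 (@profinite_invg_continuous G)). Qed.

(* The subgroup is the largest one under which [F] is invariant on both sides
   (a syntactic congruence). *)
Lemma open_normal_invariant (Y : topologicalType) (S : Type) (F : G -> Y -> S) :
  compact [set: Y] ->
  (forall z : G * Y, \forall w \near z, F w.1 w.2 = F z.1 z.2) ->
  exists N : open_normal G,
    forall n, n \in N -> forall g g' y, F (g * n * g')%g y = F (g * g')%g y.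
Proof.
move=> cY lcF.
pose o h := forall z : G * (G * Y), F (z.1 * h * z.2.1)%g z.2.2 = F (z.1 * z.2.1)%g z.2.2.
have lc2 (T : topologicalType) (f : T -> G) (y : T -> Y) (t : T) :
    continuous f -> continuous y -> \forall s \near t, F (f s) (y s) = F (f t) (y t).
  by move=> cf cy; apply: (pair_continuous cf cy) (lcF (f t, y t)).
have oo : open (o : set G).
  apply: (@compact_forall_open G (G * (G * Y))%type
    (fun h z => F (z.1 * h * z.2.1)%g z.2.2 = F (z.1 * z.2.1)%g z.2.2)).
    rewrite -setXTT; apply: compact_setX; first exact: profinite_group_compact.
    by rewrite -setXTT; apply: compact_setX => //; exact: profinite_group_compact.
  have c1 : continuous (fun z : G * (G * (G * Y)) => z.1) by exact: fst_continuous.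
  have c2 : continuous (fun z : G * (G * (G * Y)) => z.2) by exact: snd_continuous.
  have c21 := continuous_comp1 (@fst_continuous G (G * Y)%type) c2.
  have c22 := continuous_comp1 (@snd_continuous G (G * Y)%type) c2.
  have c221 := continuous_comp1 (@fst_continuous G Y) c22.
  have c222 := continuous_comp1 (@snd_continuous G Y) c22.
  rewrite openE => t /= Ft.
  have lt := lc2 _ _ _ t (continuousM (continuousM c21 c1) c221) c222.
  have rt := lc2 _ _ _ t (continuousM c21 c221) c222.
  by apply: filterS2 lt rt => s /= lts rts; rewrite lts rts.
have o1 : (1%g : G) \in (fun h => `[< o h >] : bool).
  by apply/asboolP => z; rewrite mulg1.
have oV x y : x \in (fun h => `[< o h >] : bool) -> y \in (fun h => `[< o h >] : bool) ->
    (x^-1 * y)%g \in (fun h => `[< o h >] : bool).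
  move=> /asboolP ox /asboolP oy; apply/asboolP => -[g [g' z]] /=.
  rewrite mulgA (oy ((g * x^-1)%g, (g', z))) /=.
  have := ox ((g * x^-1)%g, (g', z)); rewrite /= mulgVK => <-.
  by [].
have oJ x y : x \in (fun h => `[< o h >] : bool) -> (x ^ y)%g \in (fun h => `[< o h >] : bool).
  move=> /asboolP ox; apply/asboolP => -[g [g' z]] /=.
  have := ox ((g * y^-1)%g, ((y * g')%g, z)); rewrite /= /conjg.
  by rewrite !mulgA mulgVK.
have oO : open [set x | x \in (fun h => `[< o h >] : bool)].
  rewrite (_ : [set _ | _] = (o : set G)) //.
  by apply/seteqP; split=> x /asboolP.
exists (OpenNormal o1 oV oJ oO) => n /asboolP on g g' y.
exact: (on (g, (g', y))).
Qed.

Definition open_normal_meet (N M : open_normal G) : open_normal G.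
Proof.
exists (fun x => (x \in N) && (x \in M)).
- by apply/andP; split; exact: onormal1.
- by move=> x y /andP[xN xM] /andP[yN yM]; apply/andP; split; exact: onormalV.
- by move=> x y /andP[xN xM]; apply/andP; split; exact: onormalJ.
- rewrite (_ : [set _ | _] = [set x | x \in N] `&` [set x | x \in M]).
    by apply: openI; exact: onormal_open.
  by apply/seteqP; split=> x /= => [/andP|xNM]; last exact/andP.
Defined.

Lemma qgroup_pi_near (N : open_normal G) (x : G) :
  \forall y \near x, \pi_(qgroup N) y = \pi_(qgroup N) x.
Proof.
apply: filterS (open_nbhs_nbhs (conj (coset_open N x) _)) => [y /= xy|].
  exact/esym/qgroupP.
by rewrite /mkset mulVg onormal1.
Qed.

End OpenNormalSubgroups.

Lemma il_le_val (S : inverse_system) (i j : is_index S) (a b : invlim S) :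
  is_le i j -> il_val a j = il_val b j -> il_val a i = il_val b i.
Proof. by move=> ij ab; rewrite -(il_compat a ij) ab il_compat. Qed.

Section OpenIdeals.
Variable R : profiniteComRingType.

Lemma profinite_ring_compact : compact [set: R].
Proof. by have [] := @profinite_ring_space R. Qed.

Definition rreg (S : profiniteComRingType) : Type := S.
HB.instance Definition _ (S : profiniteComRingType) := GRing.Lmodule.copy (rreg S) S^o.
HB.instance Definition _ (S : profiniteComRingType) := Topological.copy (rreg S) S.
HB.instance Definition _ (S : profiniteComRingType) := isProfiniteModule.Build S (rreg S)
  (@profinite_ring_add_continuous S) (@profinite_ring_opp_continuous S)
  (@profinite_mulr_continuous S) (@profinite_ring_space S).

Definition annihilating (E : profiniteModType R) (O : submodule E) (r : R) : Prop :=
  forall x : E, O (r *: x).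

Lemma annihilating_open (E : profiniteModType R) (O : submodule E) :
  open (O : set E) -> open (annihilating O).
Proof.
move=> oO; apply: (@compact_forall_open R E (fun r x => O (r *: x))).
  exact: profinite_module_compact.
by apply: (open_preimage (f := fun z : R * E => z.1 *: z.2)) => //;
  exact: profinite_scale_continuous.
Qed.

(** The point [x0] outside [O] keeps 1 out of the ideal, which [open_ideal] requires to be proper.
    When [O] is everything, [open_submodule_ideal] takes any open ideal. *)
Lemma annihilating_ideal (E : profiniteModType R) (O : submodule E) (x0 : E) :
  open (O : set E) -> ~ O x0 ->
  exists I : open_ideal R, forall r, oideal I r -> annihilating O r.
Proof.
move=> oO nO; have cl : idealr_closed (fun r => `[< annihilating O r >]).
  split.
  - by apply/asboolP => x; rewrite scale0r; exact: submod0.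
  - by apply/asboolP => /(_ x0); rewrite scale1r.
  move=> a u v /asboolP ou /asboolP ov; apply/asboolP => x.
  by rewrite scalerDl -scalerA; apply: submodZD.
have op : open [set r | (fun r => `[< annihilating O r >]) r].
  rewrite (_ : [set _ | _] = annihilating O); first exact: annihilating_open.
  by apply/seteqP; split=> r /asboolP.
by exists (OpenIdeal cl op) => r /asboolP.
Qed.

Lemma open_ideal_inhabited : inhabited (open_ideal R).
Proof.
have [|O oO nO] := @open_submodule_sep R (rreg R) profinite_ring_compact (1 : R) 0.
  by apply/eqP; exact: oner_neq0.
by have [I _] := annihilating_ideal oO nO; exists.
Qed.

Lemma open_submodule_ideal (E : profiniteModType R) (O : submodule E) :
  open (O : set E) -> exists I : open_ideal R, forall r, oideal I r -> annihilating O r.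
Proof.
move=> oO; have [[x0 nO]|/forallNP allO] := pselect (exists x, ~ O x).
  exact: annihilating_ideal nO.
have [I] := open_ideal_inhabited.
by exists I => r _ x; apply: contrapT; exact: allO.
Qed.

Definition open_ideal_meet (I J : open_ideal R) : open_ideal R.
Proof.
exists (fun x => oideal I x && oideal J x).
  have [I0 I1 IZ] := oideal_closed I; have [J0 J1 JZ] := oideal_closed J.
  split.
  - by apply/andP; split.
  - by rewrite negb_and I1.
  - by move=> a u v /andP[Iu Ju] /andP[Iv Jv]; apply/andP; split; [exact: IZ|exact: JZ].
rewrite (_ : [set _ | _] = [set x | oideal I x] `&` [set x | oideal J x]).
  by apply: openI; exact: oideal_open.
by apply/seteqP; split=> x /= => [/andP|xNM]; last exact/andP.
Defined.

Lemma qring_finite (I : open_ideal R) : finite_set [set: qring I].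
Proof.
have [s sP] : exists s : seq R, forall x, exists2 y, List.In y s & qpi I x = qpi I y.
  apply: (@locally_constant_finite R _ (qpi I)); first exact: profinite_ring_compact.
  move=> x; have : open [set y : R | oideal I (y - x)].
    apply: (open_preimage (f := fun y : R => y - x) (C := [set y | oideal I y])); last exact: oideal_open.
    by apply: (continuousB (A := R) (M := rreg R)); [move=> y; exact: cvg_id|exact: cst_continuous].
  move=> oI; apply: filterS (open_nbhs_nbhs (conj oI _)) => [y /= Iyx|].
    by apply/eqP; rewrite qpi_eq.
  by rewrite /mkset subrr; have [] := oideal_closed I.
apply: (@finite_set_list _ [seq qpi I x | x <- s]) => a.
have [x ->] := qpi_surj a; have [y ys ->] := sP x.
exact: List.in_map.
Qed.

End OpenIdeals.

Lemma gr_invM (S : comPzRingType) (Q : finGroupType) (a b : group_ring S Q) :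
  gr_inv (a * b) = gr_inv b * gr_inv a.
Proof.
apply/ffunP => q; rewrite !ffunE.
rewrite [RHS](reindex_inj (mulgI q)) /=; apply: eq_bigr => x _.
by rewrite !ffunE !invgM !invgK mulKg mulrC.
Qed.

Section CgrTopology.
Variables (R : profiniteComRingType) (G : profiniteGroupType).
Local Notation A := (cgr R G).
Implicit Types (a b : A) (i j : is_index (cgr_system R G)).

Definition cgr_meet i j : cgr_index R G :=
  (open_ideal_meet i.1 j.1, open_normal_meet i.2 j.2).

Lemma cgr_meetl i j : cgr_le i (cgr_meet i j).
Proof. by split=> x /andP[]. Qed.

Lemma cgr_meetr i j : cgr_le j (cgr_meet i j).
Proof. by split=> x /andP[]. Qed.

Lemma cgr_profinite : profinite_space A.
Proof.
apply: il_profinite => i; exact/finite_set_ffun/qring_finite.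
Qed.

Lemma cgr_compact : compact [set: A].
Proof. by have [] := cgr_profinite. Qed.

Definition cgr_sum (s : seq (R * G)) : A := \sum_(z <- s) cgr_monom z.1 z.2.

Lemma open_normal_inhabited : inhabited (open_normal G).
Proof.
exists; exists predT => //.
by rewrite (_ : [set _ | _] = setT) ?seteqP //; exact: openT.
Qed.

Lemma cgr_index_inhabited : inhabited (cgr_index R G).
Proof.
have [I] := open_ideal_inhabited R; have [N] := open_normal_inhabited.
by exists; exact: (I, N).
Qed.

Lemma il_val_sum i (J : Type) (s : seq J) (F : J -> A) :
  il_val (\sum_(z <- s) F z) i = \sum_(z <- s) il_val (F z) i.
Proof. by elim: s => [|z s IH]; rewrite ?big_nil ?big_cons //= IH. Qed.

Lemma cgr_sum_surj i (c : @is_obj (cgr_system R G) i) : exists s, il_val (cgr_sum s) i = c.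
Proof.
exists [seq (quot_repr (c q), quot_repr q) | q <- index_enum (qgroup i.2)].
rewrite /cgr_sum big_map il_val_sum /=.
apply/ffunP => q; rewrite sum_ffunE (bigD1 q) //= big1 => [|q' /negPf q'q].
  by rewrite ffunE reprK eqxx addr0 /qpi reprK.
by rewrite ffunE reprK eq_sym q'q.
Qed.

Lemma cgr_nbhs a (W : set A) : nbhs a W ->
  exists i, forall b, il_val b i = il_val a i -> W b.
Proof.
pose F := filter_from [set: cgr_index R G] (fun i => [set b : A | il_val b i = il_val a i]).
have FF : Filter F.
  apply: filter_from_filter; first by have [i] := cgr_index_inhabited; exists i.
  move=> i j _ _; exists (cgr_meet i j) => // b /= ab.
  by split; [exact: (@il_le_val (cgr_system R G) _ _ _ _ (cgr_meetl i j) ab)|exact: (@il_le_val (cgr_system R G) _ _ _ _ (cgr_meetr i j) ab)].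
have Fa : F --> a by apply: il_cvg => i; exists i.
by move=> /Fa [i _ iW]; exists i => b; exact: iW.
Qed.

Lemma cgr_sum_dense : closure [set a | exists s, a = cgr_sum s] = setT.
Proof.
apply/seteqP; split=> // a _ W /cgr_nbhs [i iW].
have [s sa] := cgr_sum_surj (il_val a i).
by exists (cgr_sum s); split; [exists s|exact: iW].
Qed.

(** Finite sums of monomials are dense. Most identities over the completed group ring are reduced in
    this way to group elements. *)
Lemma cgr_ind (K : set A) : closed K -> K 0 ->
  (forall a b, K a -> K b -> K (a + b)) -> (forall r g, K (cgr_monom r g)) ->
  forall a, K a.
Proof.
move=> cK K0 KD Km a; apply: cK.
have : closure [set a | exists s, a = cgr_sum s] a by rewrite cgr_sum_dense.
apply: closureS => _ [s ->].
by rewrite /cgr_sum; elim/big_ind: _ => // i _; exact: Km.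
Qed.

Definition cgr_reg : Type := A.
HB.instance Definition _ := GRing.Lmodule.copy cgr_reg A^o.
HB.instance Definition _ := Topological.copy cgr_reg A.
HB.instance Definition _ := isProfiniteModule.Build A cgr_reg
  (@il_add_continuous (cgr_system R G)) (@il_opp_continuous (cgr_system R G))
  (@il_mul_continuous (cgr_system R G)) cgr_profinite.

Lemma cgr_monomM r s (g h : G) :
  cgr_monom r g * cgr_monom s h = cgr_monom (r * s) (g * h)%g :> A.
Proof. by apply: il_eq => i /=; rewrite gr_monomM rmorphM -pi_qgroupM. Qed.

Lemma cgr_monomE r (g : G) : cgr_monom r g = cgr_scal G r * cgr_elt R g.
Proof. by rewrite cgr_monomM mulr1 mul1g. Qed.

Lemma cgr_eltM (g h : G) : cgr_elt R (g * h)%g = cgr_elt R g * cgr_elt R h.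
Proof. by rewrite cgr_monomM mulr1. Qed.

Lemma cgr_elt1 : cgr_elt R (1%g : G) = 1.
Proof. by rewrite -(rmorph1 (cgr_scal G)). Qed.

Lemma cgr_elt_continuous : continuous (@cgr_elt R G).
Proof.
apply: il_continuous => i g; apply: filterS (qgroup_pi_near i.2 g) => h /= hg.
by rewrite hg.
Qed.

Lemma cgr_inv_monom r (g : G) : cgr_inv (cgr_monom r g : A) = cgr_monom r g^-1%g.
Proof.
apply: il_eq => i /=; apply/ffunP => q; rewrite !ffunE.
rewrite (_ : \pi_(qgroup i.2) g^-1%g = (\pi_(qgroup i.2) g)^-1%g).
  by rewrite -(inj_eq invg_inj) invgK.
exact/esym/qinvE.
Qed.

Lemma cgr_inv_additive : {morph @cgr_inv R G : a b / a + b}.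
Proof. by move=> a b; apply: il_eq => i /=; apply/ffunP => q; rewrite !ffunE. Qed.

Lemma cgr_invB : zmod_morphism (@cgr_inv R G).
Proof.
move=> a b; apply: (addIr (cgr_inv b)); rewrite -cgr_inv_additive !subrK.
by [].
Qed.
HB.instance Definition _ := GRing.isZmodMorphism.Build A A (@cgr_inv R G) cgr_invB.

Lemma cgr_inv_sum (J : finType) (F : J -> A) :
  cgr_inv (\sum_j F j) = \sum_j cgr_inv (F j).
Proof. exact: raddf_sum. Qed.

Lemma cgr_invK : involutive (@cgr_inv R G).
Proof. by move=> a; apply: il_eq => i /=; apply/ffunP => q; rewrite !ffunE invgK. Qed.

Lemma cgr_invM a b : cgr_inv (a * b) = cgr_inv b * cgr_inv a.
Proof. by apply: il_eq => i; exact: gr_invM. Qed.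

Lemma cgr_inv_continuous : continuous (@cgr_inv R G).
Proof.
by apply: il_continuous => i a; apply: filterS (il_near a i) => b /= ->.
Qed.

Lemma cgr_inv_scal (r : R) : cgr_inv (cgr_scal G r) = cgr_scal G r.
Proof. by rewrite cgr_inv_monom invg1. Qed.

Lemma cgr_inv_elt (g : G) : cgr_inv (cgr_elt R g : A) = cgr_elt R g^-1%g.
Proof. exact: cgr_inv_monom. Qed.

End CgrTopology.

(** * Integration over G, and modules from continuous actions *)

Section FiniteLevelSum.
Variables (R : profiniteComRingType) (G : profiniteGroupType).
Local Notation A := (cgr R G).
Variables (E : lmodType R) (O : submodule E) (i : cgr_index R G) (b : G -> E).
Hypothesis annO : forall r x, oideal i.1 r -> O (r *: x).
Hypothesis invO : forall g n, n \in onormal i.2 -> O (b (g * n)%g - b g).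

(** A Riemann sum for the integral of [b] against [a], taken at level [i] with arbitrary
    representatives of coefficients and cosets; it is therefore additive and correct only modulo
    [O]. *)
Definition level_sum (a : A) : E :=
  \sum_(q : qgroup i.2) quot_repr ((il_val a i : group_ring _ _) q) *: b (quot_repr q).

Let lift_eq (c d : R) x : qpi i.1 c = qpi i.1 d -> O (c *: x - d *: x).
Proof. by move=> /eqP; rewrite qpi_eq -scalerBl => /annO. Qed.

Lemma level_sumD a a' : O (level_sum (a + a') - (level_sum a + level_sum a')).
Proof.
rewrite /level_sum -big_split -sumrB /=; apply: submod_sum => q _.
rewrite -scalerDl; apply: lift_eq; rewrite rmorphD /= /qpi !reprK.
by rewrite ffunE.
Qed.

Lemma level_sum0 : O (level_sum 0).
Proof.
apply: submod_sum => q _; rewrite -[X in O X]subr0 -[X in _ - X](scale0r (b (quot_repr q))).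
by apply: lift_eq; rewrite raddf0 /qpi reprK ffunE.
Qed.

Lemma level_sum_monom r g : O (level_sum (cgr_monom r g) - r *: b g).
Proof.
rewrite /level_sum (bigD1 (\pi_(qgroup i.2) g)) //= addrC -addrA; apply: submodD.
  apply: submod_sum => q qg; rewrite -[X in O X]subr0.
  rewrite -[X in _ - X](scale0r (b (quot_repr q))); apply: lift_eq.
  by rewrite raddf0 /qpi reprK ffunE (negPf qg).
apply: (@submodB_trans _ _ O (r *: b (quot_repr (\pi_(qgroup i.2) g)))).
  by apply: lift_eq; rewrite /qpi reprK ffunE eqxx.
rewrite -scalerBr; apply: submodZ.
rewrite -[quot_repr _](mulKVg g); apply: invO; exact: repr_qgroup.
Qed.

Lemma level_sum_sum (s : seq (R * G)) :
  O (level_sum (cgr_sum s) - \sum_(z <- s) z.1 *: b z.2).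
Proof.
rewrite /cgr_sum; elim: s => [|z s IH]; first by rewrite !big_nil subr0; exact: level_sum0.
rewrite !big_cons; apply: submodB_trans (level_sumD _ _) _.
rewrite opprD addrACA; apply: submodD => //; exact: level_sum_monom.
Qed.

End FiniteLevelSum.

Section Integral.
Variables (R : profiniteComRingType) (G : profiniteGroupType).
Local Notation A := (cgr R G).
Variables (E : profiniteModType R) (Y : topologicalType) (b : G -> Y -> E).
Hypothesis cY : compact [set: Y].
Hypothesis cb : continuous (fun z : G * Y => b z.1 z.2).

Let cR := @profinite_ring_compact R.

Lemma locally_constant_mod (O : submodule E) : open (O : set E) ->
  exists N : open_normal G,
    forall n, n \in N -> forall g y, O (b (g * n)%g y - b g y).
Proof.
move=> oO; have [|N NP] := @open_normal_invariant G Y (set E)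
    (fun g y => [set z | O (z - b g y)]) cY.
  move=> z; have bz : \forall w \near z, O (b w.1 w.2 - b z.1 z.2).
    exact: (@cb z _ (near_submodule (b z.1 z.2) oO)).
  apply: filterS bz => w /= Ow.
  by apply/seteqP; split=> x /= Ox; apply: (submodB_trans Ox) => //; exact: submodBC.
exists N => n nN g y; have := NP n nN g 1%g y; rewrite !mulg1 => /seteqP [+ _].
by apply; rewrite /= subrr; exact: submod0.
Qed.

(** The values on finite sums of monomials are forced, and [level_sum] approximates them modulo each
    open submodule, so [dense_extension] applies. The parameter space [Y] is there for joint
    continuity: with [Y] = [E] and [b] an action of G, the result is a continuous scalar
    multiplication. *)
Lemma cgr_integral : exists F : A -> Y -> E,
  [/\ continuous (fun z : A * Y => F z.1 z.2),
      forall a a' y, F (a + a') y = F a y + F a' y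
    & forall r g y, F (cgr_monom r g) y = r *: b g y].
Proof.
pose Gamma (z : A * Y) (e : E) := exists2 s, z.1 = cgr_sum s &
  e = \sum_(w <- s) w.1 *: b w.2 z.2.
have [||F cF FG] := @dense_extension R cR E (A * Y)%type Gamma.
- apply/seteqP; split=> // -[a y] _ W [[W1 W2] [/= aW1 yW2] sW].
  have : closure [set a | exists s, a = cgr_sum s] a by rewrite cgr_sum_dense.
  move=> /(_ W1 aW1) [_ [[s ->] Ws]]; exists (cgr_sum s, y); split.
    by exists (\sum_(w <- s) w.1 *: b w.2 y); exists s.
  by apply: sW; split=> //=; exact: nbhs_singleton.
- move=> O oO; have [I IP] := open_submodule_ideal oO.
  have [N NP] := locally_constant_mod oO.
  exists (fun z => level_sum (I, N) (b^~ z.2) z.1); split; last first.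
    move=> [a y] e [s /= -> ->].
    apply: level_sum_sum => [r x /IP|g n nN]; [exact|exact: NP].
  move=> [a y].
  have cS : continuous (fun y' => level_sum (I, N) (b^~ y') a).
    rewrite /level_sum; apply: continuous_sum => q.
    apply: continuousZr; apply: (continuous_comp1 (f := fun y' => (quot_repr q, y')) cb).
    by apply: pair_continuous; [exact: cst_continuous|move=> ?; exact: cvg_id].
  exists ([set a' | il_val a' ((I, N) : is_index (cgr_system R G)) = il_val a ((I, N) : is_index (cgr_system R G))],
    [set y' | O (level_sum (I, N) (b^~ y') a - level_sum (I, N) (b^~ y) a)]).
    split; first exact: (@il_near (cgr_system R G) a (I, N)).
    exact: (@cS y _ (near_submodule _ oO)).
  by move=> [a' y'] [/= aa' Oy]; rewrite {1}/level_sum aa'.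
exists (fun a y => F (a, y)); split.
- rewrite (_ : (fun _ => _) = F) //; by apply/funext; case.
- have ind (P : set A) : closed P -> (forall s, P (cgr_sum s)) -> forall a, P a.
    move=> cP Ps a; apply: cP; have : closure [set a | exists s, a = cgr_sum s] a.
      by rewrite cgr_sum_dense.
    by apply: closureS => _ [s ->].
  have cFy y : continuous (fun a => F (a, y)).
    apply: (continuous_comp1 (f := fun a => (a, y)) cF).
    by apply: pair_continuous; [move=> ?; exact: cvg_id|exact: cst_continuous].
  have cDl (a : A) : continuous (fun a' : A => a + a').
    apply: (@continuousD A (cgr_reg R G) A (fun=> a) id); first exact: cst_continuous.
    by move=> ?; exact: cvg_id.
  move=> a a' y; move: a; apply: (ind [set a | F (a + a', y) = F (a, y) + F (a', y)]).
    apply: closed_eq_fun; last first.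
      by apply: continuousD; [exact: cFy|exact: cst_continuous].
    apply: (continuous_comp1 (f := fun a => a + a') (cFy y)).
    rewrite (_ : (fun _ => _) = fun a => a' + a); first exact: cDl.
    by apply/funext => a; rewrite addrC.
  move=> s; move: a'; apply: (ind [set a' | F (cgr_sum s + a', y) = F (cgr_sum s, y) + F (a', y)]).
    apply: closed_eq_fun; last first.
      by apply: continuousD; [exact: cst_continuous|exact: cFy].
    exact: (continuous_comp1 (f := fun a => cgr_sum s + a) (cFy y) (cDl _)).
  move=> s'; have FS s0 : F (cgr_sum s0, y) = \sum_(w <- s0) w.1 *: b w.2 y.
    by apply: FG; exists s0.
  by rewrite /= /cgr_sum -big_cat -/(cgr_sum _) !FS big_cat.
- move=> r g y; apply: FG; exists [:: (r, g)]; first by rewrite /cgr_sum big_seq1.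
  by rewrite big_seq1.
Qed.

End Integral.

Section ActionModulo.
Variables (R : profiniteComRingType) (G : profiniteGroupType).
Local Notation A := (cgr R G).
Variables (E : profiniteModType A) (O : submodule E) (i : cgr_index R G).
Hypothesis oO : open (O : set E).
Hypothesis annO : forall r x, oideal i.1 r -> O (cgr_scal G r *: x).
Hypothesis invO : forall n x, n \in onormal i.2 -> O (cgr_elt R n *: x - x).

Lemma restr_submodZD (r : R) (u v : restr E) : O u -> O v -> O (r *: u + v).
Proof. exact: submodZD. Qed.

Definition restr_submodule : submodule (restr E) :=
  Submodule (submod0 O : (O : set E) (0 : restr E)) restr_submodZD.

(** Modulo [O], the action on [x] agrees with [level_sum] for the orbit map of [x], and that sum
    sees only the component at level [i]. *)
Lemma cgr_action_mod (a b : A) (x : E) :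
  il_val a (i : is_index (cgr_system R G)) = il_val b (i : is_index (cgr_system R G)) ->
  O (a *: x - b *: x).
Proof.
pose f (g : G) : restr E := cgr_elt R g *: x.
have fN g n : n \in onormal i.2 -> restr_submodule (f (g * n)%g - f g).
  move=> nN; rewrite /f cgr_eltM -scalerA.
  have H := submodZ (cgr_elt R g) (invO x nN).
  by rewrite scalerBr in H; exact: H.
have fI (r : R) (y : restr E) : oideal i.1 r -> restr_submodule (r *: y) by exact: annO.
have cl : closed (O : set E) by have [] := open_submodule_clopen oO.
have H : forall a, restr_submodule ((a *: x : restr E) - level_sum i f a).
  apply: cgr_ind.
  - apply: (closed_preimage (f := fun a : A => (a *: x : restr E) - level_sum i f a) (C := O)) => //.
    apply: (continuousB (M := restr E)).
      by apply: (continuousZ (M := E)); [move=> ?; exact: cvg_id|exact: cst_continuous].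
    move=> c W Wc; apply: filterS (@il_near (cgr_system R G) c i) => c' /= cc'.
    by rewrite /level_sum cc'; exact: nbhs_singleton.
  - rewrite scale0r sub0r; apply: (@submodN _ _ restr_submodule); exact: level_sum0.
  - move=> c d Hc Hd; have Hcd := level_sumD f fI c d.
    rewrite scalerDl; apply: (@submodB_trans _ _ restr_submodule (level_sum i f c + level_sum i f d)).
      by rewrite opprD addrACA; exact: submodD.
    exact: submodBC.
  - move=> r g; apply: submodBC.
    rewrite (_ : (cgr_monom r g *: x : restr E) = r *: f g).
      exact: (level_sum_monom fI fN r g).
    by rewrite cgr_monomE -scalerA.
move=> ab; apply: (@submodB_trans _ _ restr_submodule (level_sum i f a)) => //.
by rewrite /level_sum ab; exact/submodBC/H.
Qed.

End ActionModulo.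

Section ActionExtension.
Variables (R : profiniteComRingType) (G : profiniteGroupType) (E : profiniteModType R).
Local Notation A := (cgr R G).

Record gaction := GAction {
  gact :> G -> E -> E;
  gact_linear : forall g, linear (gact g);
  gact1 : forall x, gact 1%g x = x;
  gactM : forall g h x, gact (g * h)%g x = gact g (gact h x);
  gact_continuous : continuous (fun z : G * E => gact z.1 z.2)
}.

Variable s : gaction.

Lemma gact0 g : s g 0 = 0.
Proof.
have := @gact_linear s g (-1) 0 0; rewrite scaler0 addr0 => ->.
by rewrite scaleN1r addNr.
Qed.

Lemma gactZ g r x : s g (r *: x) = r *: s g x.
Proof. by have := @gact_linear s g r x 0; rewrite gact0 !addr0. Qed.

Lemma gactD g x y : s g (x + y) = s g x + s g y.
Proof. by have := @gact_linear s g 1 x y; rewrite !scale1r. Qed.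

(** An alias of [E], to carry the structure of R[[G]]-module that [cgr_integral] extracts from the
    action, with [E] itself as parameter space. *)
Definition gmod of gaction : Type := E.
Local Notation M := (gmod s).
HB.instance Definition _ := GRing.Zmodule.on M.
HB.instance Definition _ := Topological.on M.

Let int := cgr_integral (@profinite_module_compact R E) (@gact_continuous s).

Definition gmod_scale : A -> M -> M := projT1 (cid int).

Let gmod_scaleP : [/\ continuous (fun z : A * M => gmod_scale z.1 z.2),
  forall a a' y, gmod_scale (a + a') y = gmod_scale a y + gmod_scale a' y
  & forall r g (y : E), gmod_scale (cgr_monom r g) y = r *: s g y].
Proof. exact: (projT2 (cid int)). Qed.

Lemma gmod_scale_continuous : continuous (fun z : A * M => gmod_scale z.1 z.2).
Proof. by have [] := gmod_scaleP. Qed.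

Lemma gmod_scaleDl y : {morph gmod_scale^~ y : a b / a + b}.
Proof. by have [_ + _] := gmod_scaleP => H a b; exact: H. Qed.

Lemma gmod_scale_monom r g (y : E) : gmod_scale (cgr_monom r g) y = r *: s g y.
Proof. by have [_ _] := gmod_scaleP. Qed.

Let scale_l y : continuous (gmod_scale^~ y).
Proof.
apply: (continuous_comp1 (f := fun a => (a, y)) gmod_scale_continuous).
by apply: pair_continuous; [move=> ?; exact: cvg_id|exact: cst_continuous].
Qed.

Let scale_r a : continuous (gmod_scale a).
Proof.
apply: (continuous_comp1 (f := fun y => (a, y)) gmod_scale_continuous).
by apply: pair_continuous; [exact: cst_continuous|move=> ?; exact: cvg_id].
Qed.

Lemma gmod_scale0l y : gmod_scale 0 y = 0.
Proof. by apply: (addIr (gmod_scale 0 y)); rewrite -gmod_scaleDl !add0r. Qed.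

Lemma gmod_scaleDr : right_distributive gmod_scale +%R.
Proof.
move=> a x y; move: a; apply: cgr_ind.
- apply: (closed_eq_fun (M := E)); first exact: scale_l.
  by apply: (continuousD (M := E)); exact: scale_l.
- by rewrite !gmod_scale0l addr0.
- by move=> a b Ha Hb; rewrite !gmod_scaleDl Ha Hb addrACA.
- move=> r g; rewrite !gmod_scale_monom.
  by rewrite -scalerDr gactD.
Qed.

Lemma gmod_scale1 : left_id 1 gmod_scale.
Proof.
move=> x; rewrite -(rmorph1 (cgr_scal G)) gmod_scale_monom.
by rewrite gact1 scale1r.
Qed.

Lemma gmod_scale0r a : gmod_scale a 0 = 0.
Proof. by apply: (addIr (gmod_scale a 0)); rewrite -gmod_scaleDr !add0r. Qed.

Lemma gmod_scaleA a b x : gmod_scale a (gmod_scale b x) = gmod_scale (a * b) x.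
Proof.
move: a; apply: cgr_ind.
- apply: (closed_eq_fun (M := E)); first exact: scale_l.
  apply: (continuous_comp1 (f := fun a => a * b) (@scale_l x)).
  apply: (continuousZ (M := cgr_reg R G)); last exact: cst_continuous.
  by move=> ?; exact: cvg_id.
- by rewrite mul0r !gmod_scale0l.
- by move=> a c Ha Hc; rewrite mulrDl !gmod_scaleDl Ha Hc.
move=> r g; move: b; apply: cgr_ind.
- apply: (closed_eq_fun (M := E)); first exact: (continuous_comp1 (@scale_r _) (@scale_l x)).
  apply: (continuous_comp1 (f := fun b => cgr_monom r g * b) (@scale_l x)).
  apply: (continuousZr (M := cgr_reg R G)).
  by move=> ?; exact: cvg_id.
- by rewrite mulr0 !gmod_scale0l gmod_scale0r.
- by move=> a c Ha Hc; rewrite mulrDr !gmod_scaleDl gmod_scaleDr Ha Hc.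
move=> r' h; rewrite cgr_monomM !gmod_scale_monom gactM -scalerA; congr (_ *: _).
by rewrite gactZ.
Qed.

HB.instance Definition _ := GRing.Zmodule_isLmodule.Build A M
  gmod_scaleA gmod_scale1 gmod_scaleDr gmod_scaleDl.
HB.instance Definition _ := isProfiniteModule.Build A M
  (@profinite_mod_add_continuous R E) (@profinite_mod_opp_continuous R E)
  gmod_scale_continuous (@profinite_module_space R E).

Lemma gmod_monom r g (y : M) : cgr_monom r g *: y = r *: s g y :> E.
Proof. exact: gmod_scale_monom. Qed.

Lemma gmod_elt g (y : M) : cgr_elt R g *: y = s g y :> E.
Proof. by rewrite gmod_monom scale1r. Qed.

Lemma gmod_scal r (y : M) : cgr_scal G r *: y = r *: (y : E) :> E.
Proof. by rewrite gmod_monom gact1. Qed.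

End ActionExtension.

(** * The block idempotent *)

Lemma mulrn_mod (V : zmodType) (x : V) (m a b : nat) :
  x *+ m = 0 -> (a = b %[mod m])%N -> x *+ a = x *+ b.
Proof.
move=> xm ab; have red c : x *+ c = x *+ (c %% m).
  by rewrite {1}(divn_eq c m) mulrnDr mulnC mulrnA xm mul0rn add0r.
by rewrite red ab -red.
Qed.

(* The class of [y * k] modulo [m] is the idempotent of Z/m that vanishes on the
   r-primary part and is 1 on the prime-to-r part. *)
Lemma prime_to_inverse (m r a : nat) : (0 < m)%N -> prime r ->
  exists y K, (y * y * r ^ a = y %[mod m])%N /\ (r ^ K * (y * r ^ a) = r ^ K %[mod m])%N.
Proof.
move=> m0 pr; pose K := logn r m; pose m' := (m`_r^')%N.
have mE : m = (r ^ K * m')%N by rewrite -p_part partnC.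
have cop b : coprime (r ^ b) m'.
  by apply: coprimeXl; rewrite prime_coprime // -p'natE // part_pnat.
have m'0 : (0 < m')%N by exact: part_gt0.
have rKa : (0 < r ^ (K + a))%N by rewrite expn_gt0 prime_gt0.
case: (egcdnP m' rKa) => u v uv _.
have {uv} uv : (u * r ^ (K + a) = v * m' + 1)%N.
  by rewrite uv; congr (_ + _)%N; apply/eqP; exact: cop.
have y1 : (u * r ^ K * r ^ a = 1 %[mod m'])%N.
  by rewrite -mulnA -expnD uv modnMDl.
(* [u * r ^ K] is 0 modulo [r ^ K] and inverse to [r ^ a] modulo [m']; both congruences are checked
   on these two coprime factors of [m]. *)
exists (u * r ^ K)%N, K; rewrite mE; split; apply/eqP; rewrite chinese_remainder //; apply/andP; split.
- have d1 : (r ^ K %| u * r ^ K)%N by rewrite dvdn_mull.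
  by rewrite (eqP (dvdn_mulr _ (dvdn_mulr _ d1))) (eqP d1).
- by rewrite -mulnA -modnMmr y1 modnMmr muln1.
- by rewrite (eqP (dvdn_mulr _ (dvdnn _))) modnn.
- by rewrite -modnMmr y1 modnMmr muln1.
Qed.

Section FiniteIdempotent.
Variables (S : comNzRingType) (Q : finGroupType).
Local Notation B := (group_ring S Q).
Implicit Types (a b c : B) (g : Q).

Definition aug a : S := \sum_q a q.

Lemma augM a b : aug (a * b) = aug a * aug b.
Proof.
rewrite /aug; under eq_bigr do rewrite ffunE.
rewrite exchange_big /= big_distrl /=; apply: eq_bigr => x _.
rewrite -big_distrr /=; congr (_ * _).
by rewrite [RHS](reindex_inj (mulgI x^-1%g)).
Qed.

Lemma augB a b : aug (a - b) = aug a - aug b.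
Proof. by rewrite /aug -sumrB; apply: eq_bigr => q _; rewrite !ffunE. Qed.

Lemma augMn a n : aug (a *+ n) = aug a *+ n.
Proof. by rewrite /aug -sumrMnl; apply: eq_bigr => q _; rewrite ffunMnE. Qed.

Lemma aug_monom (s : S) g : aug (gr_monom s g) = s.
Proof.
rewrite /aug (bigD1 g) //= big1 => [|q /negPf qg]; rewrite ffunE ?eqxx ?addr0 //.
by rewrite qg.
Qed.

Lemma aug1 : aug 1 = 1.
Proof. by rewrite -gr_monom1 aug_monom. Qed.

(** The last field says that r-elements act trivially on the prime-to-r part of the block. It is
    restricted to the primes in [ps] so that the idempotent can be built as a product with one
    factor per prime. *)
Record block_idem (ps : pred nat) (e : B) : Prop := BlockIdem {
  block_idemM : e * e = e;
  block_central : forall b, e * b = b * e;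
  block_inv : gr_inv e = e;
  block_aug : aug e = 1;
  block_torsion : forall r g, prime r -> ps r -> (r.-elt g)%g ->
    exists K, (e * (gr_monom 1 g - 1)) *+ (r ^ K) = 0
}.

Section Norm.
Variable H : {group Q}.
Hypothesis nH : (H <| [set: Q]%G)%g.

Definition gr_norm : B := [ffun q => (q \in H)%:R].

Lemma gr_norm_central b : gr_norm * b = b * gr_norm.
Proof.
apply/ffunP => q; rewrite !ffunE.
rewrite (reindex_inj invg_inj) (reindex_inj (mulIg q^-1%g)) /=.
apply: eq_bigr => x _; rewrite !ffunE !invgM !invgK mulgVK mulrC.
have qN : q \in ('N(H))%g by have /fintype.subsetP nHs := normal_norm nH; apply: nHs; rewrite inE.
by rewrite -(memJ_norm (q * x^-1)%g qN) /conjg !mulgA mulVg mul1g.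
Qed.

Lemma gr_norm_mul g : g \in H -> gr_norm * gr_monom 1 g = gr_norm.
Proof.
move=> gH; apply/ffunP => q; rewrite !ffunE (bigD1 (q * g^-1)%g) //= big1 => [|x xq].
  by rewrite !ffunE invgM invgK mulgVK eqxx mulr1 addr0 groupMr // groupV.
rewrite !ffunE; case: eqP => [xg|]; last by rewrite mulr0.
by case/eqP: xq; rewrite -xg invgM invgK mulKVg.
Qed.

Lemma gr_norm_sum : gr_norm = \sum_(g in H) gr_monom 1 g.
Proof.
apply/ffunP => q; rewrite sum_ffunE ffunE big_mkcond (bigD1 q) //= big1 => [|g gq].
  by rewrite ffunE eqxx addr0; case: ifP.
by case: ifP => //; rewrite ffunE eq_sym (negPf gq).
Qed.

Lemma gr_normM : gr_norm * gr_norm = gr_norm *+ #|H|.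
Proof.
rewrite {2}gr_norm_sum big_distrr /= -sumr_const.
by apply: eq_bigr => g gH; exact: gr_norm_mul.
Qed.

Lemma gr_norm_inv : gr_inv gr_norm = gr_norm.
Proof. by apply/ffunP => q; rewrite !ffunE groupV. Qed.

Lemma aug_norm : aug gr_norm = #|H|%:R.
Proof.
rewrite /aug -sum1_card natr_sum [RHS]big_mkcond /=; apply: eq_bigr => q _.
by rewrite ffunE; case: (q \in H).
Qed.

End Norm.

Lemma gr_inv1 : gr_inv 1 = 1 :> B.
Proof. by apply/ffunP => q; rewrite !ffunE invg_eq1. Qed.

Lemma gr_invB a b : gr_inv (a - b) = gr_inv a - gr_inv b.
Proof. by apply/ffunP => q; rewrite !ffunE. Qed.

Lemma gr_invMn a n : gr_inv (a *+ n) = gr_inv a *+ n.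
Proof. by apply/ffunP => q; rewrite !(ffunE, ffunMnE). Qed.

Hypothesis nilQ : nilpotent [set: Q]%G.

(** Let [N] be the norm of [H], of order [k]. Where r is invertible, N/k is the idempotent
    projecting to the [H]-invariants. The factor [y] inverts [k] on the prime-to-r part of Z/m and
    vanishes on the r-part, so that [1 - u] is N/k on the former and 1 on the latter. By nilpotence
    [H] is a Sylow subgroup containing every r-element, and N (g - 1) = 0 for these. *)
Lemma block_idem1 (m r : nat) : (0 < m)%N -> m%:R = 0 :> S -> prime r ->
  exists e, block_idem (pred1 r) e.
Proof.
move=> m0 mS pr; pose H : {group Q} := ('O_r([set: Q]))%G.
have nH : (H <| [set: Q]%G)%g by exact: pcore_normal.
have [l Ha] : exists l, #|H| = (r ^ l)%N.
  by have /p_natP [l lP] := pcore_pgroup r [set: Q]%G; exists l.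
have [y [K [yk yK]]] := prime_to_inverse l m0 pr; set k := (r ^ l)%N in Ha yk yK.
pose N := gr_norm H; pose u : B := (k%:R - N) *+ y.
have mB (b : B) : b *+ m = 0.
  by apply/ffunP => q; rewrite ffunMnE ffunE -mulr_natr mS mulr0.
have NN : N * N = N *+ k by rewrite gr_normM // Ha.
have uu : u * u = u.
  rewrite /u mulrnAl mulrnAr -mulrnA.
  rewrite (_ : (k%:R - N) * (k%:R - N) = (k%:R - N) *+ k).
    by rewrite -mulrnA; apply: mulrn_mod (mB _) _; rewrite mulnC.
  by rewrite mulrBr mulr_natr mulrBl mulr_natl NN subrr subr0.
have uC b : u * b = b * u.
  rewrite /u mulrnAl mulrnAr mulrBl mulrBr gr_norm_central //.
  by rewrite mulr_natl mulr_natr.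
exists (1 - u); split.
- by rewrite mulrBl mul1r mulrBr mulr1 uu subrr subr0.
- by move=> b; rewrite mulrBl mulrBr uC mul1r mulr1.
- by rewrite gr_invB gr_inv1 /u gr_invMn gr_invB gr_invMn gr_inv1 gr_norm_inv.
- rewrite augB aug1 /u augMn augB aug_norm Ha augMn aug1.
  by rewrite subrr mul0rn subr0.
move=> _ g _ /eqP -> rg.
have gH : g \in H.
  by rewrite (mem_normal_Hall (nilpotent_pcore_Hall r nilQ) (pcore_normal _ _)) ?inE.
exists K; rewrite mulrBl mul1r /u mulrnAl mulrBl.
rewrite [N * _]mulrBr mulr1 gr_norm_mul // subrr subr0 mulr_natl -mulrnA mulrnBl -mulrnA.
apply/eqP; rewrite subr_eq0; apply/eqP/(mulrn_mod (mB _)).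
by rewrite -yK mulnC [(k * y)%N]mulnC.
Qed.

Lemma block_idemI ps r e f : block_idem ps e -> block_idem (pred1 r) f ->
  block_idem (fun s => (s == r) || ps s) (e * f).
Proof.
move=> [ee eC ei ea et] [ff fC fi fa ft]; split.
- by rewrite mulrA -[e * f * e]mulrA fC mulrA ee -mulrA ff.
- by move=> b; rewrite -mulrA fC mulrA eC mulrA.
- by rewrite gr_invM ei fi eC.
- by rewrite augM ea fa mul1r.
move=> s g prs /orP[sr|pss] sg.
  have [K HK] := ft s g prs sr sg; exists K.
  by rewrite -mulrA -mulrnAr HK mulr0.
have [K HK] := et s g prs pss sg; exists K.
by rewrite eC -mulrA -mulrnAr HK mulr0.
Qed.

Lemma block_idem_exists : finite_set [set: S] -> exists e, block_idem predT e.
Proof.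
move=> finS.
have [m m0 mS] : exists2 m, (0 < m)%N & m%:R = 0 :> S.
  have : ~ injective (fun n : nat => n%:R : S).
    by move=> /finite_set_inj /(_ finS); exact: infinite_nat.
  move=> /existsNP [n1 /existsNP [n2 /not_implyP [n12 /eqP neq]]].
  wlog lt12 : n1 n2 n12 neq / (n1 < n2)%N.
    by move=> W; case: (ltngtP n1 n2) neq => // lt _; [apply: (W n1 n2)|apply: (W n2 n1)];
      rewrite // neq_ltn lt ?orbT.
  exists (n2 - n1)%N; first by rewrite subn_gt0.
  by rewrite natrB ?n12 ?subrr // ltnW.
have [e He] : exists e, block_idem (mem (primes #|Q|)) e.
  have: all prime (primes #|Q|) by apply/allP => p; rewrite mem_primes => /andP[].
  elim: (primes #|Q|) => [_|r rs IH /= /andP[pr /IH [e He]]].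
    exists 1; split=> //; rewrite ?mulr1 ?gr_inv1 ?aug1 //.
    by move=> b; rewrite mul1r mulr1.
  have [f Hf] := block_idem1 m0 mS pr; exists (e * f).
  have [H1 H2 H3 H4 H5] := block_idemI He Hf.
  by split=> // s g prs; rewrite inE; exact: H5.
exists e; case: He => H1 H2 H3 H4 H5; split=> // r g pr _ rg.
have [rQ|rQ] := boolP (r \in primes #|Q|); first exact: H5.
have -> : g = 1%g.
  apply/eqP; rewrite -order_eq1; apply: contraR rQ => g1.
  have /p_natP [[|l] gl] := rg; first by rewrite gl eqxx in g1.
  rewrite mem_primes pr /=; apply/andP; split; first by apply/card_gt0P; exists g.
  rewrite -cardsT; apply: (@dvdn_trans #[g]%g); first by rewrite gl expnS dvdn_mulr.
  by apply: (@order_dvdG _ [set: Q]%G); rewrite inE.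
by exists 0%N; rewrite gr_monom1 subrr mulr0.
Qed.

End FiniteIdempotent.

Section CompletedIdempotent.
Variables (R : profiniteComRingType) (G : profiniteGroupType).
Hypothesis nilG : pronilpotent G.
Local Notation A := (cgr R G).
Local Notation index := (is_index (cgr_system R G)).

Definition block_at (i : index) (c : group_ring (qring i.1) (qgroup i.2)) : Prop :=
  block_idem predT c.

Lemma block_at_map (i j : index) (ij : is_le i j) (a : A) :
  block_at (il_val a j) -> block_at (il_val a i).
Proof.
move=> [aa aC ai a1 at_].
have surj b : exists b', @is_map (cgr_system R G) i j ij b' = b.
  have [s <-] := @cgr_sum_surj R G i b; exists (il_val (cgr_sum s) j).
  exact: il_compat.
rewrite -(il_compat a ij); split.
- by rewrite -rmorphM aa.
- by move=> b; have [b' <-] := surj b; rewrite -!rmorphM; apply: (congr1 (is_map ij)); exact: aC.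
- by rewrite /= -gr_map_inv ai.
- rewrite /aug; under eq_bigr do rewrite ffunE.
  rewrite -(rmorph1 (qring_map (proj1 ij))) -a1 /aug rmorph_sum /=.
  by rewrite [RHS](partition_big (qgroup_map (proj2 ij)) predT).
move=> r g pr _ rg.
have [x gx] := qgroup_pi g.
have phiM : {in [set: qgroup j.2]%G &, {morph qgroup_map (proj2 ij) : y z / (y * z)%g}}.
  by move=> y z _ _; exact: qgroup_mapM.
pose phi : {morphism [set: qgroup j.2]%G >-> qgroup i.2} := Morphism phiM.
(* A lift of the r-element [g] need not be an r-element, but its r-constituent is one and still maps
   to [g]. *)
pose h := ((\pi_(qgroup j.2) x : qgroup j.2).`_r)%g.
have hg : qgroup_map (proj2 ij) h = g.
  rewrite -[LHS]/(phi h) /h morph_constt ?inE //= qgroup_mapE -gx.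
  exact: constt_p_elt.
have [K HK] := at_ r h pr isT (p_elt_constt _ _); exists K.
have := congr1 (is_map ij) HK; rewrite rmorph0 => <-.
rewrite rmorphMn rmorphM rmorphB rmorph1.
by rewrite /= gr_map_monom rmorph1 /= hg.
Qed.

(** A compatible family is found by compactness: the elements whose component at level [i] is a
    block idempotent form nonempty closed sets, directed because the property passes to coarser
    levels. *)
Lemma block_idem_cgr : exists e : A, forall i, block_at (il_val e i).
Proof.
have [||||e eP] := @compact_directed_nonempty A index
  (fun i => [set a | block_at (il_val a i)]) (@cgr_compact R G).
- exact: cgr_index_inhabited.
- move=> i; rewrite -[X in closed X]setCK; apply: open_closedC.
  rewrite openE => a /= na; apply: filterS (@il_near (cgr_system R G) a i) => b /= ab.
  by rewrite ab.
- move=> i; have [c cP] := block_idem_exists (nilG i.2) (qring_finite i.1).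
  by have [s sc] := @cgr_sum_surj R G i c; exists (cgr_sum s); rewrite /= sc.
- move=> i j; exists (cgr_meet i j) => a /= ak; split.
    exact: (@block_at_map i (cgr_meet i j) (cgr_meetl i j)).
  exact: (@block_at_map j (cgr_meet i j) (cgr_meetr i j)).
by exists e.
Qed.

Definition blk : A := projT1 (cid block_idem_cgr).

Let blkP i : block_at (il_val blk i).
Proof. exact: (projT2 (cid block_idem_cgr)). Qed.

Lemma blkM : blk * blk = blk.
Proof. by apply: il_eq => i; have [] := blkP i. Qed.

Lemma blkC a : blk * a = a * blk.
Proof. by apply: il_eq => i; have [_ H _ _ _] := blkP i; exact: H. Qed.

Lemma blk_inv : cgr_inv blk = blk.
Proof. by apply: il_eq => i; have [] := blkP i. Qed.

(** A finite sum of monomials acts on a trivial module through the sum of its coefficients. Modulo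
    [O], the idempotent may be replaced by a finite sum with the same component at a suitable level,
    whose coefficients add up to 1 there by [block_aug]. *)
Lemma blk_trivial (L : profiniteModType A) (x : L) :
  (forall g y, cgr_elt R g *: y = y :> L) -> blk *: x = x.
Proof.
move=> trL; apply: (open_submodule_eq (@cgr_compact R G)) => O oO.
have [I IP] := @open_submodule_ideal R (restr L) (restr_submodule O) oO.
have [N] := open_normal_inhabited G; pose i : index := (I, N).
have [s sE] := @cgr_sum_surj R G i (il_val blk i).
apply: (@submodB_trans _ _ O (cgr_sum s *: x)).
  apply: (@cgr_action_mod R G L O (I, N) oO) => // [r y|n y _]; first by move=> /IP; exact.
  by rewrite trL subrr; exact: submod0.
have -> : cgr_sum s *: x = cgr_scal G (\sum_(z <- s) z.1) *: x.
  rewrite /cgr_sum scaler_suml raddf_sum scaler_suml; apply: eq_bigr => z _.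
  by rewrite cgr_monomE -scalerA trL.
set S := \sum_(z <- s) z.1.
have -> : cgr_scal G S *: x - x = cgr_scal G (S - 1) *: x.
  by rewrite rmorphB rmorph1 scalerBl scale1r.
apply: IP; rewrite -qpi_eq; apply/eqP.
rewrite rmorph1; have [_ _ _ <- _] := blkP i; rewrite -sE /cgr_sum.
rewrite il_val_sum /aug raddf_sum; under [RHS]eq_bigr do rewrite sum_ffunE.
rewrite exchange_big /=; apply: eq_bigr => z _.
exact/esym/aug_monom.
Qed.

(** The exponent is read off at the level given by [N] and by an ideal annihilating [E] modulo [O];
    hence it serves all [x] at once, by [cgr_action_mod]. *)
Lemma blk_torsion (E : profiniteModType A) (O : submodule E) (N : open_normal G)
    (r : nat) (g : G) :
  open (O : set E) -> (forall n x, n \in N -> O (cgr_elt R n *: x - x)) ->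
  prime r -> (r.-elt (\pi_(qgroup N) g : qgroup N))%g ->
  exists K, forall x : E, blk *: x = x -> O ((cgr_elt R g *: x - x) *+ (r ^ K)).
Proof.
move=> oO NO pr rg.
have [I IP] := @open_submodule_ideal R (restr E) (restr_submodule O) oO.
have [_ _ _ _ /(_ r _ pr isT rg) [K HK]] := blkP (I, N).
exists K => x ex.
pose a := (blk * (cgr_elt R g - 1)) *+ (r ^ K).
have -> : (cgr_elt R g *: x - x) *+ r ^ K = a *: x - 0 *: x.
  rewrite scale0r subr0 /a -scalerMnl blkC -scalerA ex scalerBl scale1r.
  by [].
have annO r' y : oideal I r' -> O (cgr_scal G r' *: y) by move=> /IP; exact.
apply: (@cgr_action_mod R G E O (I, N) oO annO NO a 0 x).
rewrite -[RHS]HK /a.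
have vMn n (c : A) : il_val (c *+ n) ((I, N) : index) = il_val c ((I, N) : index) *+ n.
  by elim: n => [|n IH]; rewrite ?mulr0n // !mulrS -IH.
by rewrite vMn /= rmorph1.
Qed.

End CompletedIdempotent.

(** * Semidirect products and derivations *)

(* [E] and [K] have commuting coprime parts, so that the product of their
   r-components is a normal r-subgroup, hence lies in the Fitting subgroup. *)
Lemma nilpotent_extension (gT : finGroupType) (E K G : {group gT}) :
  (E <| G)%g -> abelian E -> nilpotent K -> (E * K)%g = G ->
  (forall r x g, prime r -> x \in E -> g \in K -> (r.-elt g)%g -> (r.-elt [~ x, g])%g) ->
  nilpotent G.
Proof.
move=> nEG abE nilK EKG tors.
have sKG : (K \subset G)%g by rewrite -EKG mulG_subr.
have nEg g : g \in G -> g \in 'N(E)%g by move=> gG; exact: (fintype.subsetP (normal_norm nEG)).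
suff sGF : (G \subset 'F(G))%g by rewrite (nilpotentS sGF) ?Fitting_nil.
have EF : (E \subset 'F(G))%g by rewrite Fitting_max // abelian_nil.
rewrite -{1}EKG mul_subG //; apply/fintype.subsetP => k kK.
rewrite -(prod_constt k); apply: group_prod => r _.
have kr : (k.`_r)%g \in K by exact: groupX.
have [pr|npr] := boolP (prime r); last first.
  suff -> : (k.`_r)%g = 1%g by exact: group1.
  apply/eqP; rewrite -order_eq1 order_constt /=.
  by rewrite p_part lognE (negPf npr).
pose Er := 'O_r(E)%G; pose Kr := 'O_r(K)%G.
have nErG : (Er <| G)%g by apply: char_normal_trans nEG; exact: pcore_char.
have KrG : (Kr \subset G)%g by rewrite (fintype.subset_trans (pcore_sub _ _)).
have joinE : (Er <*> Kr)%g = (Er * Kr)%g.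
  by apply: norm_joinEr; rewrite (fintype.subset_trans KrG) // normal_norm.
have krKr : (k.`_r)%g \in Kr.
  by rewrite (mem_normal_Hall (nilpotent_pcore_Hall r nilK) (pcore_normal _ _)) // p_elt_constt.
have tors' x g : x \in E -> g \in Kr -> [~ x, g]%g \in Er.
  move=> xE gKr; have gK : g \in K by apply: (fintype.subsetP (pcore_sub r K)).
  have gr : (r.-elt g)%g by apply: (mem_p_elt (pcore_pgroup r K)).
  rewrite (mem_normal_Hall (nilpotent_pcore_Hall r (abelian_nil abE)) (pcore_normal _ _)).
    exact: tors.
  rewrite /commg groupM ?groupV // memJ_norm // nEg //.
  exact: (fintype.subsetP sKG).
have EnEr : (E \subset 'N(Er))%g.
  exact: (fintype.subset_trans (normal_sub nEG) (normal_norm nErG)).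
have nJ : (Er <*> Kr <| G)%g.
  apply/andP; split; first by rewrite join_subG KrG (normal_sub nErG).
  rewrite -{1}EKG mul_subG //; last first.
    rewrite normsY //; last exact: normal_norm (pcore_normal _ _).
    exact: (fintype.subset_trans sKG (normal_norm nErG)).
  apply/fintype.subsetP => x xE; rewrite inE joinE.
  apply/fintype.subsetP => _ /imsetP [_ /mulsgP [a g aE gK ->] ->].
  (* An element of [E] changes the r-element [g] of [K] by a commutator, which lies in [Er] by the
     hypothesis on commutators: this is the normality of [Er <*> Kr] under [E]. *)
  rewrite conjMg (_ : (g ^ x)%g = ([~ x, g^-1] * g)%g); last first.
    by rewrite /commg /conjg invgK !mulgA mulgVK.
  rewrite mulgA mem_mulg // groupM //; last by rewrite tors' // groupV.
  by rewrite memJ_norm // (fintype.subsetP EnEr).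
have JF : (Er <*> Kr \subset 'F(G))%g.
  rewrite Fitting_max // (pgroup_nil (p := r)) //= joinE pgroupM.
  by rewrite !pcore_pgroup.
by apply: (fintype.subsetP JF); apply: (fintype.subsetP (joing_subr _ _)).
Qed.

Lemma zhat_nbhs (r : Zhat) (W : set Zhat) : nbhs r W ->
  exists n, forall b : Zhat, il_val b n = il_val r n -> W b.
Proof.
pose F := filter_from [set: nat] (fun n => [set b : Zhat | il_val b n = il_val r n]).
have FF : Filter F.
  apply: filter_from_filter; first by exists 0%N.
  (* Index n stands for the modulus n + 2, so this is the index of the product of the two moduli. *)
  move=> i j _ _; exists (i.+2 * j.+2).-2%N => // b /= ab.
  have e : (i.+2 * j.+2).-2.+2 = (i.+2 * j.+2)%N by [].
  have di : @is_le zhat_system i (i.+2 * j.+2).-2 by rewrite /= e dvdn_mulr.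
  have dj : @is_le zhat_system j (i.+2 * j.+2).-2 by rewrite /= e dvdn_mull.
  by split; [exact: (@il_le_val zhat_system _ _ _ _ di ab)|exact: (@il_le_val zhat_system _ _ _ _ dj ab)].
have Fr : F --> r by apply: il_cvg => i; exists i.
by move=> /Fr [n _ nW]; exists n.
Qed.

Lemma zhat_natE (k n : nat) : il_val (k%:R : Zhat) n = (k%:R : 'Z_(n.+2)).
Proof. by elim: k => [//|k IH]; rewrite !mulrS -IH. Qed.

Lemma zhat_ind (K : set Zhat) : closed K -> K 0 -> K 1 ->
  (forall a b, K a -> K b -> K (a + b)) -> forall r, K r.
Proof.
move=> cK K0 K1 KD r; apply: cK => W /zhat_nbhs [n nW].
have Kn k : K k%:R by elim: k => [//|k IH]; rewrite mulrS; exact: KD.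
exists ((il_val r n : nat)%:R); split; first exact: Kn.
by apply: nW; rewrite zhat_natE natr_Zp.
Qed.

Section SemidirectProduct.
Variables (R : profiniteComRingType) (G : profiniteGroupType).
Local Notation A := (cgr R G).
Variable E : profiniteModType A.

Definition semidirect : Type := (E * G)%type.
Local Notation H := semidirect.
HB.instance Definition _ := Choice.on H.
HB.instance Definition _ := Topological.on H.

Definition sd_mul (y z : H) : H := (y.1 + cgr_elt R y.2 *: z.1, (y.2 * z.2)%g).
Definition sd_one : H := (0, 1%g).
Definition sd_inv (y : H) : H := (- (cgr_elt R y.2^-1%g *: y.1), y.2^-1%g).

Lemma cgr_eltK (g : G) (x : E) : cgr_elt R g *: (cgr_elt R g^-1%g *: x) = x.
Proof. by rewrite scalerA -cgr_eltM mulgV cgr_elt1 scale1r. Qed.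

Lemma sd_mulA : associative sd_mul.
Proof.
move=> y z t; rewrite /sd_mul /= scalerDr addrA scalerA -cgr_eltM.
by rewrite mulgA.
Qed.
Lemma sd_mul1 : left_id sd_one sd_mul.
Proof. by move=> [x g]; rewrite /sd_mul /= cgr_elt1 scale1r add0r mul1g. Qed.
Lemma sd_mulr1 : right_id sd_one sd_mul.
Proof. by move=> [x g]; rewrite /sd_mul /= scaler0 addr0 mulg1. Qed.
Lemma sd_mulV : left_inverse sd_one sd_inv sd_mul.
Proof. by move=> [x g]; rewrite /sd_mul /= addNr mulVg. Qed.
Lemma sd_mulrV : right_inverse sd_one sd_inv sd_mul.
Proof. by move=> [x g]; rewrite /sd_mul /= scalerN cgr_eltK subrr mulgV. Qed.

HB.instance Definition _ := isGroup.Build H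
  sd_mulA sd_mul1 sd_mulr1 sd_mulV sd_mulrV.

Lemma sd_mul_continuous : continuous (fun z : H * H => (z.1 * z.2)%g).
Proof.
have c1 : continuous (fun z : H * H => z.1) by exact: fst_continuous.
have c2 : continuous (fun z : H * H => z.2) by exact: snd_continuous.
have f1 : continuous (fun z : H => z.1) by exact: fst_continuous.
have f2 : continuous (fun z : H => z.2) by exact: snd_continuous.
apply: (pair_continuous (f := fun z : H * H => z.1.1 + cgr_elt R z.1.2 *: z.2.1)
  (g := fun z : H * H => (z.1.2 * z.2.2)%g)).
  apply: (continuousD (M := E)); first exact: (continuous_comp1 f1 c1).
  apply: (continuousZ (M := E)); last exact: (continuous_comp1 f1 c2).
  apply: (continuous_comp1 (@cgr_elt_continuous R G)).
  exact: (continuous_comp1 f2 c1).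
by apply: continuousM; [exact: (continuous_comp1 f2 c1)|exact: (continuous_comp1 f2 c2)].
Qed.

Lemma sd_inv_continuous : continuous (fun z : H => (z^-1)%g).
Proof.
have f1 : continuous (fun z : H => z.1) by exact: fst_continuous.
have f2 : continuous (fun z : H => (z.2)^-1%g) by apply: continuousV; exact: snd_continuous.
apply: (pair_continuous (f := fun z : H => - (cgr_elt R z.2^-1%g *: z.1))
  (g := fun z : H => z.2^-1%g)) => //.
apply: (continuousN (M := E)); apply: (continuousZ (M := E)) => //.
exact: (continuous_comp1 (@cgr_elt_continuous R G) f2).
Qed.

Lemma sd_profinite : profinite_space H.
Proof.
apply: zero_dimensional_profinite.
  rewrite -[X in compact X]/([set: (E * G)%type]) -setXTT; apply: compact_setX.
    exact: profinite_module_compact.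
  exact: profinite_group_compact.
have zE := profinite_zero_dimensional (@profinite_module_space A E).
have zG := profinite_zero_dimensional (@profinite_group_space G).
move=> [x g] [y h] xgyh; have [xy|xy] := eqVneq x y; last first.
  have [C [cC Cx Cy]] := zE _ _ xy; exists (fst @^-1` C); split=> //.
  by apply: preimage_clopen => //; exact: fst_continuous.
have [gh|gh] := eqVneq g h; first by rewrite xy gh eqxx in xgyh.
have [C [cC Cg Ch]] := zG _ _ gh; exists (snd @^-1` C); split=> //.
by apply: preimage_clopen => //; exact: snd_continuous.
Qed.

HB.instance Definition _ := isProfiniteGroup.Build H
  sd_mul_continuous sd_inv_continuous sd_profinite.

End SemidirectProduct.

Section Pronilpotent.
Variables (G : profiniteGroupType) (nilG : pronilpotent G).
Local Notation A := (cgr Zhat G).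
Variable E : profiniteModType A.
Hypothesis blkE : forall x : E, blk Zhat nilG *: x = x.
Local Notation H := (semidirect E).

Let iE (x : E) : H := (x, 1%g).
Let iG (g : G) : H := (0, g).

Let iED x y : iE (x + y) = (iE x * iE y)%g.
Proof. by congr pair; rewrite /= ?cgr_elt1 ?scale1r ?mulg1. Qed.

Let iEN x : iE (- x) = ((iE x)^-1)%g.
Proof. by congr pair; rewrite /= ?invg1 ?cgr_elt1 ?scale1r. Qed.

Let iGM g h : iG (g * h)%g = (iG g * iG h)%g.
Proof. by congr pair; rewrite /= scaler0 addr0. Qed.

Let iGV g : iG (g^-1)%g = ((iG g)^-1)%g.
Proof. by congr pair; rewrite /= scaler0 oppr0. Qed.

Let sdE (z : H) : z = (iE z.1 * iG z.2)%g.
Proof. by case: z => x g; congr pair; rewrite /= ?scaler0 ?addr0 ?mul1g. Qed.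

Let iEJ x g : (iG g * iE x * iG g^-1)%g = iE (cgr_elt Zhat g *: x).
Proof. by congr pair; rewrite /= ?scaler0 ?addr0 ?add0r ?mulg1 ?mulgV. Qed.

Let iE_continuous : continuous iE.
Proof. by apply: pair_continuous; [move=> ?; exact: cvg_id|exact: cst_continuous]. Qed.

Let iG_continuous : continuous iG.
Proof. by apply: pair_continuous; [exact: cst_continuous|move=> ?; exact: cvg_id]. Qed.

Section OneQuotient.
Variable N : open_normal H.

Let NG : open_normal G.
Proof.
exists (fun g => iG g \in N).
- exact: onormal1.
- move=> x y xN yN; change (iG (x^-1 * y)%g \in N).
  by rewrite iGM iGV; exact: onormalV.
- move=> x y xN; change (iG (x ^ y)%g \in N).
  by rewrite /conjg !iGM iGV; exact: (onormalJ (iG y) xN).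
- exact: (open_preimage iG_continuous (@onormal_open _ N)).
Defined.

Let O_set (x : E) : Prop := iE x \in N.

Let O_open : open (O_set : set E).
Proof. exact: (open_preimage iE_continuous (@onormal_open _ N)). Qed.

Let O0 : O_set 0. Proof. exact: onormal1. Qed.

Let OD x y : O_set x -> O_set y -> O_set (x + y).
Proof. by move=> Ox Oy; rewrite /O_set iED; exact: onormalM. Qed.

Let O_closed : closed (O_set : set E).
Proof.
rewrite -[X in closed X]setCK; apply: open_closedC.
rewrite openE => x nOx.
have : open [set y | O_set (y - x)].
  apply: (open_preimage (f := fun y => y - x)) => //.
  by apply: continuousB; [move=> ?; exact: cvg_id|exact: cst_continuous].
move=> oX; apply: filterS (open_nbhs_nbhs (conj oX _)) => [y /= Oyx Oy|]; last first.
  by rewrite /mkset subrr.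
apply: nOx; rewrite -(subrK y x); apply: OD => //.
by rewrite -opprB /O_set iEN; exact: onormalI.
Qed.

(** Stability under G is normality of [N]; stability under Zhat holds for every closed subgroup, by
    density of the natural numbers. So the trace of [N] on [E] is a submodule, although [N] is only
    a subgroup. *)
Let OZ (a : A) x : O_set x -> O_set (a *: x).
Proof.
move=> Ox; move: a; apply: cgr_ind.
- apply: (closed_preimage (f := fun a : A => a *: x)) => //.
  by apply: continuousZ; [move=> ?; exact: cvg_id|exact: cst_continuous].
- by rewrite scale0r.
- by move=> a b Oa Ob; rewrite scalerDl; exact: OD.
move=> r g; rewrite cgr_monomE -scalerA.
have : O_set (cgr_elt Zhat g *: x).
  rewrite /O_set -iEJ; have := onormalJ (iG g^-1%g) Ox.
  by rewrite /conjg iGV invgK mulgA.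
move: (cgr_elt Zhat g *: x) => y Oy; move: r; apply: zhat_ind.
- apply: (closed_preimage (f := fun r : Zhat => cgr_scal G r *: y)) => //.
  by apply: continuousZ; [exact: cgr_scal_continuous|exact: cst_continuous].
- by rewrite rmorph0 scale0r.
- by rewrite rmorph1 scale1r.
- by move=> a b Oa Ob; rewrite rmorphD scalerDl; exact: OD.
Qed.

Let O : submodule E.
Proof. by exists O_set => // a u v Ou Ov; apply: OD => //; exact: OZ. Defined.

Local Notation Q := (qgroup N).
Local Notation pi := (\pi_(qgroup N)).

Let pM y z : pi (y * z)%g = (pi y * pi z)%g.
Proof. exact: pi_qgroupM. Qed.

Let p1 : pi 1%g = 1%g. Proof. by []. Qed.

Let pV y : pi (y^-1)%g = ((pi y)^-1)%g.
Proof. by apply: (mulgI (pi y)); rewrite -pM !mulgV. Qed.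

Let pJ y z : pi (y ^ z)%g = (pi y ^ pi z)%g.
Proof. by rewrite /conjg !pM pV. Qed.

Let pE_eq1 x : O x -> pi (iE x) = 1%g.
Proof. by move=> Ox; rewrite -p1; apply/esym/qgroupP; rewrite invg1 mul1g. Qed.

Let setE : {set Q} := [set q | `[< exists x, q = pi (iE x) >]].

Let setEP q : reflect (exists x, q = pi (iE x)) (q \in setE).
Proof. by rewrite inE; exact: asboolP. Qed.

Let group_setE : group_set setE.
Proof.
apply/group_setP; split; first by apply/setEP; exists 0.
by move=> _ _ /setEP [x ->] /setEP [y ->]; apply/setEP; exists (x + y); rewrite iED pM.
Qed.

Let gE : {group Q} := Group group_setE.

Let phi_fun (c : qgroup NG) : Q := pi (iG (quot_repr c)).

Let phi_pi g : phi_fun (\pi_(qgroup NG) g) = pi (iG g).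
Proof.
apply/esym/qgroupP; rewrite -iGV -iGM.
exact: (@repr_qgroup G NG g).
Qed.

Let phiM : {in [set: qgroup NG]%G &, {morph phi_fun : y z / (y * z)%g}}.
Proof.
move=> y z _ _; have [g ->] := qgroup_pi y; have [h ->] := qgroup_pi z.
by rewrite -pi_qgroupM !phi_pi iGM pM.
Qed.

Let phi : {morphism [set: qgroup NG]%G >-> Q} := Morphism phiM.

Let actN n x : n \in NG -> O (cgr_elt Zhat n *: x - x).
Proof.
move=> nN; have nN' : iG n \in N by exact: nN.
rewrite /O /= /O_set iED iEN -iEJ iGV -!mulgA; apply: onormalM => //.
have := onormalJ (iE x)^-1%g (onormalI nN').
by rewrite /conjg invgK !mulgA.
Qed.

Let piE_X x n : (pi (iE x) ^+ n)%g = pi (iE (x *+ n)).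
Proof.
by elim: n => [|n IH]; rewrite ?expg0 ?mulr0n // expgS IH mulrS iED pM.
Qed.

(** The images of [E] and [G] satisfy the hypotheses of [nilpotent_extension]: the commutator of an
    element x of [E] with an r-element is the class of some g x - x, which [blk_torsion] shows to be
    killed by a power of r. *)
Lemma semidirect_qgroup_nilpotent : nilpotent [set: Q]%G.
Proof.
apply: (@nilpotent_extension _ gE (phi @* [set: qgroup NG])%G).
- apply/andP; split; first by apply/fintype.subsetP => q _; rewrite inE.
  apply/fintype.subsetP => q _; rewrite inE; apply/fintype.subsetP => _ /imsetP [_ /setEP [x ->] ->].
  have [z ->] := qgroup_pi q; apply/setEP; exists ((iE x ^ z)%g).1.
  rewrite -pJ; congr (pi _).
  have e2 : (iE x ^ z)%g.2 = 1%g.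
    by rewrite -[LHS]/(z.2^-1 * (1 * z.2))%g mul1g mulVg.
  by rewrite [LHS]sdE e2 -[iG 1%g]/(1%g : H) mulg1.
- apply/centsP => _ /setEP [x ->] _ /setEP [y ->].
  by rewrite /commute -!pM -!iED addrC.
- by apply: morphim_nil; exact: nilG.
- apply/setP => q; rewrite inE; have [z ->] := qgroup_pi q.
  rewrite [z]sdE pM; apply/mulsgP.
  exists (pi (iE z.1)) (pi (iG z.2)) => //; first by apply/setEP; exists z.1.
  by rewrite -phi_pi; apply: mem_morphim; rewrite inE.
move=> r y k pr /setEP [x ->] /morphimP [c _ _ ->] rc.
(* Only [phi c] is known to be an r-element, so [c] is replaced by its r-constituent. Its inverse is
   then lifted to [g0], since x ^ g is g^-1 x g while the action of [g0] is conjugation g0 x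
   g0^-1. *)
have -> : phi c = phi (c.`_r)%g by rewrite morph_constt ?inE // constt_p_elt.
have [g0 g0E] := qgroup_pi ((c.`_r)^-1)%g.
have -> : phi (c.`_r)%g = pi (iG g0^-1%g).
  by rewrite -[(c.`_r)%g]invgK g0E morphV ?inE //= phi_pi iGV pV.
have rg0 : (r.-elt (\pi_(qgroup NG) g0 : qgroup NG))%g.
  by rewrite -g0E p_eltV p_elt_constt.
have [K HK] := @blk_torsion Zhat G nilG E O NG r g0 O_open actN pr rg0.
have xg : (iE x ^ iG g0^-1)%g = iE (cgr_elt Zhat g0 *: x).
  by rewrite /conjg -iGV invgK mulgA iEJ.
rewrite /commg -pJ xg -pV -pM -iEN -iED addrC.
have := HK x (blkE x); set v := _ - x => Ov.
apply: (@pnat_dvd _ (r ^ K)); last by rewrite pnatX pnat_id ?orbT.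
by rewrite order_dvdn piE_X pE_eq1.
Qed.

End OneQuotient.

Lemma semidirect_pronilpotent : pronilpotent H.
Proof. by move=> N; exact: semidirect_qgroup_nilpotent. Qed.

End Pronilpotent.

(** * Derivations on a free pronilpotent group *)

Section Derivations.
Variables (R : profiniteComRingType) (G : profiniteGroupType).
Local Notation A := (cgr R G).

Definition derivation (E : profiniteModType A) (D : G -> E) : Prop :=
  continuous D /\ forall g h, D (g * h)%g = D g + cgr_elt R g *: D h.

Lemma derivation_comp (E F : profiniteModType A) (D : G -> E) (f : {linear E -> F}) :
  continuous f -> derivation D -> derivation (fun g => f (D g)).
Proof.
move=> cf [cD DM]; split; first exact: (continuous_comp1 cf cD).
by move=> g h; rewrite DM linearD linearZ.
Qed.

Lemma inner_derivation (E : profiniteModType A) (y : E) :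
  derivation (fun g => cgr_elt R g *: y - y).
Proof.
split.
  apply: continuousB; last exact: cst_continuous.
  by apply: continuousZ; [exact: cgr_elt_continuous|exact: cst_continuous].
by move=> g h; rewrite scalerBr scalerA -cgr_eltM [RHS]addrC addrA subrK.
Qed.

End Derivations.

Section FreeDerivations.
Variables (G : profiniteGroupType) (d : nat) (x : 'I_d -> G).
Hypothesis freeG : free_pronilpotent_on x.
Local Notation A := (cgr Zhat G).
Local Notation nilG := (proj1 freeG).
Variable E : profiniteModType A.
Hypothesis blkE : forall y : E, blk Zhat nilG *: y = y.

Lemma free_endo_id (f : G -> G) : continuous f -> {morph f : a b / (a * b)%g} ->
  (forall i, f (x i) = x i) -> f = id.
Proof.
move=> cf fM fx; have [g [_ guniq]] := freeG.2 G x nilG.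
rewrite -(guniq f) //; apply: guniq.
by split=> //; move=> ?; exact: cvg_id.
Qed.

(** Derivations are the first components of homomorphic sections of E ><| G -> G. Freeness gives a
    homomorphism with the prescribed values at the generators, and its second component is an
    endomorphism of G fixing them, hence the identity. *)
Lemma derivation_exists (u : 'I_d -> E) :
  exists D : G -> E, derivation D /\ forall i, D (x i) = u i.
Proof.
have [f [[cf fM fx] _]] := freeG.2 (semidirect E) (fun i => (u i, x i))
  (semidirect_pronilpotent blkE).
have f2 : (fun g => (f g).2) = id.
  apply: free_endo_id.
  - exact: (continuous_comp1 (@snd_continuous E G) cf).
  - by move=> a b; rewrite fM.
  - by move=> i; rewrite fx.
exists (fun g => (f g).1); split; last by move=> i; rewrite fx.
split; first exact: (continuous_comp1 (@fst_continuous E G) cf).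
by move=> g h; rewrite fM /= -[(f g).2]/((fun g => (f g).2) g) f2.
Qed.

Lemma derivation_eq (D D' : G -> E) : derivation D -> derivation D' ->
  (forall i, D (x i) = D' (x i)) -> D = D'.
Proof.
move=> [cD DM] [cD' DM'] DD'.
have [f [_ funiq]] := freeG.2 (semidirect E) (fun i => (D (x i), x i))
  (semidirect_pronilpotent blkE).
have mor F : continuous F -> (forall g h, F (g * h)%g = F g + cgr_elt Zhat g *: F h) ->
    (forall i, F (x i) = D (x i)) -> f = (fun g => (F g, g) : semidirect E).
  move=> cF FM FD; apply: funiq; split.
  - by apply: pair_continuous => // ?; exact: cvg_id.
  - by move=> a b; rewrite FM.
  - by move=> i; rewrite FD.
have := mor D cD DM (fun=> erefl); rewrite (mor D' cD' DM' (fun i => esym (DD' i))) => e.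
by apply/funext => g; have [] := congr1 (fun F => F g) e.
Qed.

(** The inner derivation g |-> g y - y vanishes at the generators, hence everywhere. *)
Lemma invariant_generators (y : E) :
  (forall i, cgr_elt Zhat (x i) *: y = y) -> forall g, cgr_elt Zhat g *: y = y.
Proof.
move=> xy g; have e : (fun g => cgr_elt Zhat g *: y - y) = (fun g => cgr_elt Zhat g *: (0 : E) - 0).
  apply: derivation_eq; [exact: inner_derivation|exact: inner_derivation|].
  by move=> i; rewrite xy subrr scaler0 subrr.
have := congr1 (fun F => F g) e; rewrite /= scaler0 subrr => /eqP.
by rewrite subr_eq0 => /eqP.
Qed.

End FreeDerivations.

(* The summand e M^n of M^n, for a central idempotent e. *)
Section IdempotentPower.
Variables (R : profiniteComRingType) (G : profiniteGroupType).
Local Notation A := (cgr R G).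
Variable e : A.
Hypotheses (eM : e * e = e) (eC : forall a, e * a = a * e).

Section Def.
Variables (M : profiniteModType A) (n : nat).

Let S (f : power 'I_n M) : Prop := e *: f = f.

Let S0 : S 0. Proof. exact: scaler0. Qed.

Let SZD a u v : S u -> S v -> S (a *: u + v).
Proof. by move=> Su Sv; rewrite /S scalerDr scalerA eC -scalerA Su Sv. Qed.

Let S_closed : closed (Submodule S0 SZD : set (power 'I_n M)).
Proof.
apply: closed_eq_fun; last by move=> ?; exact: cvg_id.
by apply: continuousZr; move=> ?; exact: cvg_id.
Qed.

Definition epow_sub : closed_submodule (power 'I_n M) := ClosedSubmodule S_closed.

Definition epow : profiniteModType A := csub epow_sub.

Definition ecoord (p : epow) (i : 'I_n) : M := csval p i.

Lemma ecoordE p i : e *: ecoord p i = ecoord p i.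
Proof. by have := csvalP p; move=> /(congr1 (fun f : power 'I_n M => f i)). Qed.

Lemma epow_fix (p : epow) : e *: p = p.
Proof. by apply: csval_inj; rewrite linearZ; exact: (csvalP p). Qed.

Lemma epow_eq p q : (forall i, ecoord p i = ecoord q i) -> p = q.
Proof. by move=> pq; apply: csval_inj; apply/funext => i; exact: pq. Qed.

Lemma ecoord_linear i : linear (ecoord^~ i).
Proof. by move=> a p q; rewrite /ecoord linearP. Qed.

Lemma ecoord_continuous i : continuous (ecoord^~ i).
Proof.
exact: (continuous_comp1 (@power_proj_continuous A 'I_n M i) (@csval_continuous A _ epow_sub)).
Qed.

Lemma epow_continuous (T : topologicalType) (f : T -> epow) :
  (forall i, continuous (fun t => ecoord (f t) i)) -> continuous f.
Proof. by move=> cf; apply: csub_continuous; exact: power_continuous. Qed.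

Definition epow_mk (f : 'I_n -> M) (fP : forall i, e *: f i = f i) : epow :=
  @csin A _ epow_sub (f : power 'I_n M) (funext fP).

Lemma epow_mkE f fP i : ecoord (@epow_mk f fP) i = f i.
Proof. by []. Qed.

End Def.

Definition ebasis n (i : 'I_n) : epow (cgr_reg R G) n.
Proof.
exists (fun j => if i == j then e else 0); apply/asboolP; apply/funext => j /=.
rewrite -[LHS]/(e *: ((if i == j then e else 0) : cgr_reg R G)).
by case: eqP => _; [exact: eM|exact: scaler0].
Defined.

Lemma ecoord_basis n (i j : 'I_n) :
  ecoord (ebasis i) j = (if i == j then e else 0).
Proof. by []. Qed.

Definition ecoordL (M : profiniteModType A) n (i : 'I_n) (p : epow M n) : M := ecoord p i.
HB.instance Definition _ (M : profiniteModType A) n (i : 'I_n) :=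
  GRing.isLinear.Build A (epow M n) M *:%R (@ecoordL M n i) (@ecoord_linear M n i).

Lemma ecoord_sum (M : profiniteModType A) n (i : 'I_n) (J : Type) (s : seq J)
  (P : pred J) (F : J -> epow M n) :
  ecoord (\sum_(j <- s | P j) F j) i = \sum_(j <- s | P j) ecoord (F j) i.
Proof. exact: (raddf_sum (@ecoordL M n i)). Qed.

Lemma ecoordZ (M : profiniteModType A) n (i : 'I_n) a (p : epow M n) :
  ecoord (a *: p) i = a *: ecoord p i.
Proof. by rewrite -[LHS]/(ecoordL i (a *: p)) linearZ. Qed.

Lemma ecoordD (M : profiniteModType A) n (i : 'I_n) (p q : epow M n) :
  ecoord (p + q) i = ecoord p i + ecoord q i.
Proof. exact: (raddfD (@ecoordL M n i)). Qed.

Lemma ecoordB (M : profiniteModType A) n (i : 'I_n) (p q : epow M n) :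
  ecoord (p - q) i = ecoord p i - ecoord q i.
Proof. exact: (raddfB (@ecoordL M n i)). Qed.

Lemma epow_basis n (p : epow (cgr_reg R G) n) :
  p = \sum_i (ecoord p i : A) *: ebasis i.
Proof.
apply: epow_eq => j; rewrite ecoord_sum (bigD1 j) //= big1 => [|i /negPf ij].
  by rewrite addr0 ecoordZ ecoord_basis eqxx -[LHS]ecoordE; exact: eC.
by rewrite ecoordZ ecoord_basis ij scaler0.
Qed.

Section LinearMaps.
Variables (M : profiniteModType A) (n : nat) (y : 'I_n -> M).

Definition epow_lin (p : epow (cgr_reg R G) n) : M :=
  \sum_i (ecoord p i : A) *: y i.

Lemma epow_lin_is_linear : linear epow_lin.
Proof.
move=> a p q; rewrite /epow_lin scaler_sumr -big_split; apply: eq_bigr => i _ /=.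
by rewrite ecoordD ecoordZ scalerDl scalerA.
Qed.
HB.instance Definition _ := GRing.isLinear.Build A (epow (cgr_reg R G) n) M *:%R
  epow_lin epow_lin_is_linear.

Lemma epow_lin_continuous : continuous epow_lin.
Proof.
apply: continuous_sum => i; apply: continuousZ; last exact: cst_continuous.
exact: ecoord_continuous.
Qed.

Lemma epow_lin_basis i : epow_lin (ebasis i) = e *: y i.
Proof.
rewrite /epow_lin (bigD1 i) //= big1 => [|j /negPf ji].
  by rewrite ecoord_basis eqxx addr0.
by rewrite ecoord_basis eq_sym ji scale0r.
Qed.

End LinearMaps.

Lemma epow_linE (M : profiniteModType A) n (f : epow (cgr_reg R G) n -> M) :
  linear f -> forall p, f p = epow_lin (fun i => f (ebasis i)) p.
Proof.
move=> lf p; pose F : {linear _ -> _} := HB.pack f (GRing.isLinear.Build _ _ _ _ f lf).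
rewrite {1}[p]epow_basis -[f _]/(F _) linear_sum; apply: eq_bigr => i _.
by rewrite linearZ.
Qed.

Lemma epow_projective n : projective_module (epow (cgr_reg R G) n).
Proof.
move=> M N f g [lf cf] sf [lg cg].
pose y i := projT1 (cid (sf (g (ebasis i)))).
have fy i : f (y i) = g (ebasis i) := projT2 (cid (sf (g (ebasis i)))).
pose F : {linear M -> N} := HB.pack f (GRing.isLinear.Build _ _ _ _ f lf).
exists (epow_lin y).
  by split; [exact: epow_lin_is_linear|exact: epow_lin_continuous].
move=> p; rewrite (epow_linE lg) -[f _]/(F _) linear_sum; apply: eq_bigr => i _.
by rewrite linearZ -fy.
Qed.

End IdempotentPower.

(** * The resolution of the trivial module *)

Section Augmentation.
Variables (R : profiniteComRingType) (G : profiniteGroupType).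
Local Notation A := (cgr R G).

Lemma cgr_fun_integral (E : profiniteModType A) (f : G -> E) : continuous f ->
  exists F : A -> E, [/\ continuous F, forall a b, F (a + b) = F a + F b
    & forall r g, F (cgr_monom r g) = cgr_scal G r *: f g].
Proof.
move=> cf; have [|F [cF FD Fm]] := @cgr_integral R G (restr E) G (fun g _ => f g)
  (@profinite_group_compact G).
  exact: (continuous_comp1 cf (@fst_continuous G G)).
exists (F^~ 1%g); split=> [|a b|r g]; [|exact: FD|exact: Fm].
apply: (continuous_comp1 (f := fun a => (a, 1%g)) cF).
by apply: pair_continuous; [move=> ?; exact: cvg_id|exact: cst_continuous].
Qed.

Lemma cgr_aug_exists : exists F : A -> rreg R,
  [/\ continuous F, forall a b, F (a + b) = F a + F b & forall r g, F (cgr_monom r g) = r].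
Proof.
have [|F [cF FD Fm]] := @cgr_integral R G (rreg R) G (fun _ _ => 1)
  (@profinite_group_compact G); first exact: cst_continuous.
exists (F^~ 1%g); split=> [|a b|r g]; [|exact: FD|].
  apply: (continuous_comp1 (f := fun a => (a, 1%g)) cF).
  by apply: pair_continuous; [move=> ?; exact: cvg_id|exact: cst_continuous].
by rewrite Fm -[RHS]mulr1.
Qed.

Definition cgr_aug : A -> R := projT1 (cid cgr_aug_exists).

Let cgr_augP := projT2 (cid cgr_aug_exists).

Lemma cgr_aug_continuous : continuous cgr_aug.
Proof. by have [] := cgr_augP. Qed.

Lemma cgr_augD a b : cgr_aug (a + b) = cgr_aug a + cgr_aug b.
Proof. by have [_ H _] := cgr_augP; exact: H. Qed.

Lemma cgr_aug_monom r g : cgr_aug (cgr_monom r g) = r.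
Proof. by have [_ _ H] := cgr_augP; exact: H. Qed.

Lemma cgr_aug0 : cgr_aug 0 = 0.
Proof. by apply: (addIr (cgr_aug 0)); rewrite -cgr_augD !add0r. Qed.

Lemma cgr_aug_act (E : profiniteModType A) (y : E) (a : A) :
  (forall g, cgr_elt R g *: y = y) -> a *: y = cgr_scal G (cgr_aug a) *: y.
Proof.
move=> gy; move: a; apply: cgr_ind.
- apply: closed_eq_fun.
    by apply: continuousZ; [move=> ?; exact: cvg_id|exact: cst_continuous].
  apply: continuousZ; last exact: cst_continuous.
  exact: (continuous_comp1 (@cgr_scal_continuous R G) cgr_aug_continuous).
- by rewrite cgr_aug0 rmorph0 !scale0r.
- by move=> a b Ha Hb; rewrite cgr_augD rmorphD !scalerDl Ha Hb.
- by move=> r g; rewrite cgr_aug_monom cgr_monomE -scalerA gy.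
Qed.

Lemma trivial_module_act (L : profiniteModType A) : trivial_module L ->
  forall (g : G) (y : L), cgr_elt R g *: y = y.
Proof. by move=> [u [[v uK vK] _ _ _ gu]] g y; rewrite -(vK y) gu. Qed.

Lemma trivial_act_linear (g : G) : linear (fun y : rreg R => y).
Proof. by []. Qed.

Lemma trivial_act_continuous : continuous (fun z : G * rreg R => z.2).
Proof. exact: snd_continuous. Qed.

Definition trivial_gaction : gaction G (rreg R) :=
  @GAction R G (rreg R) (fun _ y => y) trivial_act_linear (fun=> erefl)
    (fun _ _ _ => erefl) trivial_act_continuous.

Lemma trivial_gmod : trivial_module (gmod trivial_gaction).
Proof.
exists (fun r => r); split.
- by exists id.
- by move=> ?; exact: cvg_id.
- by [].
- by move=> r y; rewrite (gmod_scal (s := trivial_gaction)).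
- by move=> g y; rewrite (gmod_elt (s := trivial_gaction)).
Qed.

End Augmentation.

Section FreeResolution.
Variables (G : profiniteGroupType) (d : nat) (x : 'I_d -> G).
Hypothesis freeG : free_pronilpotent_on x.
Local Notation A := (cgr Zhat G).
Local Notation nilG := (proj1 freeG).
Local Notation e := (blk Zhat nilG).
Local Notation elt := (@cgr_elt Zhat G).

Definition eP : e * e = e := blkM Zhat nilG.
Definition eC : forall a, e * a = a * e := @blkC Zhat G nilG.

Local Notation epow := (epow eC).
Local Notation ebasis := (ebasis eP eC).

Definition rank (k : nat) : nat := match k with 0 => 1 | 1 => d | _ => 0 end.

Definition bdmx (k : nat) : 'I_(rank k.+1) -> 'I_(rank k) -> A :=
  match k with
  | 0 => fun i _ => elt (x i) - 1
  | _ => fun _ _ => 0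
  end.

Section Boundary.
Variables (n m : nat) (D : 'I_n -> 'I_m -> A).

Lemma bdrowP i j : e *: (e * D i j : cgr_reg Zhat G) = e * D i j.
Proof. by rewrite -[LHS]/(e * (e * D i j)) mulrA eP. Qed.

Definition bdrow (i : 'I_n) : epow (cgr_reg Zhat G) m := epow_mk eC (bdrowP i).

Definition bd : epow (cgr_reg Zhat G) n -> epow (cgr_reg Zhat G) m := epow_lin bdrow.
HB.instance Definition _ := GRing.Linear.on bd.

Lemma bd_continuous : continuous bd.
Proof. exact: epow_lin_continuous. Qed.

Lemma bdD p q : bd (p + q) = bd p + bd q.
Proof. exact: (raddfD bd). Qed.

Lemma bdZ a p : bd (a *: p) = a *: bd p.
Proof. by rewrite linearZ. Qed.

Lemma bdE p j : ecoord (bd p) j = \sum_i (ecoord p i : A) * D i j.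
Proof.
rewrite /bd /epow_lin ecoord_sum; apply: eq_bigr => i _.
rewrite ecoordZ epow_mkE -[LHS]/((ecoord p i : A) * (e * D i j)).
by rewrite mulrA -eC -[e * _]/(e *: ecoord p i) ecoordE.
Qed.

End Boundary.

(** The components of [D] are Fox derivatives. The last identity is, up to e, the fundamental
    formula g - 1 = sum_i D_i(g) (x_i - 1): both sides are derivations agreeing at the
    generators. *)
Lemma free_derivation : exists D : G -> epow (cgr_reg Zhat G) d,
  [/\ derivation D, forall i, D (x i) = ebasis i
    & forall g, bd (bdmx (k := 0)) (D g) = elt g *: ebasis ord0 - ebasis ord0].
Proof.
have [D0 [derD D0x]] := derivation_exists (epow_fix (e := e) (M := cgr_reg Zhat G) (n := d))
  (fun i => ebasis i).
exists D0; split=> // g.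
have bdD0 : (fun g => bd (bdmx (k := 0)) (D0 g)) =
    (fun g => elt g *: ebasis ord0 - ebasis ord0).
  apply: (derivation_eq (freeG := freeG) (epow_fix (n := rank 0))).
  - exact: derivation_comp (@bd_continuous _ _ _) derD.
  - exact: inner_derivation.
  move=> i; rewrite D0x; apply: epow_eq => j.
  rewrite bdE (bigD1 i) //= big1 => [|k /negPf ki].
    rewrite addr0 ecoord_basis eqxx ecoordB ecoordZ ecoord_basis !ord1 eqxx.
    by rewrite mulrBr mulr1 eC.
  by rewrite ecoord_basis eq_sym ki mul0r.
exact: (congr1 (fun f => f g) bdD0).
Qed.

(** The Fox derivative extended to A by integration contracts the resolution: the identity for a
    (x_i - 1) makes the boundary injective, the one for [bd] gives exactness at eA. *)
Lemma free_contraction : exists D : A -> epow (cgr_reg Zhat G) d,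
  [/\ continuous D, forall a b, D (a + b) = D a + D b,
      forall a i, D (a * (elt (x i) - 1)) = a *: ebasis i
    & forall a, bd (bdmx (k := 0)) (D a) =
        a *: ebasis ord0 - cgr_scal G (cgr_aug a) *: ebasis ord0].
Proof.
have [D0 [derD D0x bdD0]] := free_derivation.
have [F [cF FD Fm]] := cgr_fun_integral derD.1.
have F0 : F 0 = 0 by apply: (addIr (F 0)); rewrite -FD !add0r.
have FB a b : F (a - b) = F a - F b by apply: (addIr (F b)); rewrite -FD !subrK.
exists F; split=> // [a i|].
- move: a; apply: cgr_ind.
  + apply: closed_eq_fun; last first.
      by apply: continuousZ; [move=> ?; exact: cvg_id|exact: cst_continuous].
    apply: (continuous_comp1 (f := fun a : A => a * (elt (x i) - 1)) cF).
    apply: (continuousZ (M := cgr_reg Zhat G)); last exact: cst_continuous.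
    by move=> ?; exact: cvg_id.
  + by rewrite mul0r F0 scale0r.
  + by move=> a b Ha Hb; rewrite mulrDl FD Ha Hb scalerDl.
  + move=> r g; rewrite mulrBr mulr1 FB /cgr_elt cgr_monomM mulr1 !Fm -scalerBr.
    by rewrite derD.2 addrC addKr D0x scalerA -cgr_monomE.
apply: cgr_ind.
- apply: closed_eq_fun; first exact: (continuous_comp1 (@bd_continuous _ _ _) cF).
  apply: continuousB; (apply: continuousZ; last exact: cst_continuous).
    by move=> ?; exact: cvg_id.
  exact: (continuous_comp1 (@cgr_scal_continuous Zhat G) (@cgr_aug_continuous Zhat G)).
- by rewrite F0 linear0 cgr_aug0 rmorph0 !scale0r subrr.
- move=> a b Ha Hb; rewrite FD bdD Ha Hb cgr_augD rmorphD !scalerDl.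
  by rewrite opprD addrACA.
move=> r g; rewrite Fm bdZ cgr_aug_monom cgr_monomE -scalerA -scalerBr.
by rewrite bdD0.
Qed.

Section Resolution.
Variables (L : profiniteModType A) (trL : trivial_module L).

Let u : Zhat -> L := projT1 (cid trL).

Let uP : [/\ bijective u, continuous u, {morph u : y z / y + z},
  forall r y, u (r * y) = cgr_scal G r *: u y & forall g y, elt g *: u y = u y].
Proof. exact: (projT2 (cid trL)). Qed.

Definition freeres_mod (k : nat) : profiniteModType A := epow (cgr_reg Zhat G) (rank k).

Definition freeres_d (k : nat) : {linear freeres_mod k.+1 -> freeres_mod k} :=
  bd (bdmx (k := k)).

Definition freeres_aug : {linear freeres_mod 0 -> L} := epow_lin (fun _ : 'I_1 => u 1).

Let augE p : freeres_aug p = (ecoord p ord0 : A) *: u 1.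
Proof. by rewrite -[LHS]/(\sum_i _) big_ord1. Qed.

Let u1_act (a : A) : a *: u 1 = u (cgr_aug a).
Proof.
have [_ _ _ uZ gu] := uP.
by rewrite cgr_aug_act // -uZ mulr1.
Qed.

Let u0 : u 0 = 0.
Proof. by have [_ _ uD _ _] := uP; apply: (addIr (u 0)); rewrite -uD !add0r. Qed.

Lemma freeres_rank0 k (p : freeres_mod k) : (1 < k)%N -> p = 0.
Proof. by case: k p => [|[|k]] // p _; apply: epow_eq => -[]. Qed.

Lemma freeres_aug_surjective y : exists p, freeres_aug p = y.
Proof.
have [[v uK vK] _ _ _ gu] := uP.
exists (cgr_scal G (v y) *: ebasis ord0).
rewrite augE ecoordZ ecoord_basis eqxx.
rewrite -[_ *: (e : cgr_reg Zhat G)]/(cgr_scal G (v y) * e).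
by rewrite -scalerA blk_trivial ?u1_act ?cgr_aug_monom //; exact: trivial_module_act.
Qed.

Lemma freeres_exact0 p : freeres_aug p = 0 <-> exists q, freeres_d 0 q = p.
Proof.
have [F [cF FD Fx Fbd]] := free_contraction.
have [[v uK vK] _ _ _ gu] := uP.
split=> [|[q <-]].
  rewrite augE u1_act -u0 => /(can_inj uK) p0.
  exists (F (ecoord p ord0)); rewrite -[LHS]/(bd _ _) Fbd p0 rmorph0 scale0r subr0.
  by rewrite [RHS](@epow_basis Zhat G e eP eC 1) big_ord1.
rewrite augE bdE scaler_suml big1 // => i _.
by rewrite -scalerA scalerBl gu scale1r subrr scaler0.
Qed.

Lemma freeres_d0_inj q : freeres_d 0 q = 0 -> q = 0.
Proof.
have [F [cF FD Fx Fbd]] := free_contraction.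
have F0 : F 0 = 0 by apply: (addIr (F 0)); rewrite -FD !add0r.
move=> /(congr1 (fun p => ecoord p ord0)); rewrite bdE => /(congr1 F).
rewrite -[ecoord 0 ord0]/(0 : A) F0 => <-.
rewrite [LHS](epow_basis eP) (big_morph F FD F0); apply: eq_bigr => i _.
by rewrite Fx.
Qed.

Lemma freeres_exact k p : freeres_d k p = 0 <-> exists q, freeres_d k.+1 q = p.
Proof.
have d0 q : freeres_d k.+1 q = 0.
  by rewrite (@freeres_rank0 k.+2 q) // linear0.
case: k p d0 => [|k] p d0.
  by split=> [/freeres_d0_inj ->|[q <-]]; [exists 0; rewrite linear0|rewrite d0 linear0].
rewrite (@freeres_rank0 k.+2 p) //; split=> [_|_]; last by rewrite linear0.
by exists 0; rewrite linear0.
Qed.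

Definition freeres : proj_resolution L :=
  @ProjResolution A L freeres_mod freeres_d freeres_aug
    (fun k => @epow_projective Zhat G e eP eC (rank k))
    (fun k => @bd_continuous _ _ (bdmx (k := k))) (@epow_lin_continuous _ _ _ eC _ _ _)
    freeres_aug_surjective freeres_exact0 freeres_exact.

End Resolution.
End FreeResolution.

(** * Comparison of resolutions *)

Section Homs.
Variable A : topPzRingType.
Implicit Types M N P : profiniteModType A.

Lemma is_hom0 M N (f : M -> N) : is_hom f -> f 0 = 0.
Proof.
move=> [lf _]; have := lf (-1) 0 0; rewrite scaler0 addr0 => ->.
by rewrite scaleN1r addNr.
Qed.

Lemma is_homD M N (f : M -> N) x y : is_hom f -> f (x + y) = f x + f y.
Proof. by move=> [lf _]; have := lf 1 x y; rewrite !scale1r. Qed.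

Lemma is_homZ M N (f : M -> N) a x : is_hom f -> f (a *: x) = a *: f x.
Proof. by move=> hf; have := hf.1 a x 0; rewrite (is_hom0 hf) !addr0. Qed.

Lemma is_homB M N (f : M -> N) x y : is_hom f -> f (x - y) = f x - f y.
Proof. by move=> hf; rewrite -scaleN1r (is_homD _ _ hf) (is_homZ _ _ hf) scaleN1r. Qed.

Lemma is_hom_comp M N P (f : M -> N) (g : N -> P) :
  is_hom f -> is_hom g -> is_hom (fun x => g (f x)).
Proof.
move=> hf hg; split; first by move=> a x y; rewrite hf.1 hg.1.
by apply: (continuous_comp1 (f := f)); [exact: hg.2|exact: hf.2].
Qed.

Lemma is_hom_sub M N (f g : M -> N) :
  is_hom f -> is_hom g -> is_hom (fun x => f x - g x).
Proof.
move=> hf hg; split; last exact: (continuousB hf.2 hg.2).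
by move=> a x y; rewrite hf.1 hg.1 scalerBr opprD addrACA.
Qed.

Lemma is_hom_add M N (f g : M -> N) :
  is_hom f -> is_hom g -> is_hom (fun x => f x + g x).
Proof.
move=> hf hg; split; last exact: (continuousD hf.2 hg.2).
by move=> a x y; rewrite hf.1 hg.1 scalerDr addrACA.
Qed.

Lemma is_hom_id M : is_hom (fun x : M => x).
Proof. by split=> // ?; exact: cvg_id. Qed.

Lemma is_hom_lin M N (f : {linear M -> N}) : continuous f -> is_hom f.
Proof. by move=> cf; split=> // a x y; rewrite linearP. Qed.

Section Kernel.
Variables (M N : profiniteModType A) (f : M -> N).
Hypothesis hf : is_hom f.

Let ker (x : M) := f x = 0.
Let ker0 : ker 0. Proof. exact: is_hom0. Qed.
Let kerZD a x y : ker x -> ker y -> ker (a *: x + y).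
Proof. by rewrite /ker hf.1 => -> ->; rewrite scaler0 addr0. Qed.
Let ker_closed : closed (Submodule ker0 kerZD : set M).
Proof. by apply: closed_eq_fun; [exact: hf.2|exact: cst_continuous]. Qed.

Definition hom_ker : closed_submodule M := ClosedSubmodule ker_closed.
End Kernel.

Lemma projective_lift P M N (K : profiniteModType A) (d1 : M -> N) (d0 : N -> K) (g : P -> N) :
  projective_module P -> is_hom d1 -> is_hom d0 -> is_hom g ->
  (forall y, d0 y = 0 <-> exists z, d1 z = y) -> (forall p, d0 (g p) = 0) ->
  exists2 h : P -> M, is_hom h & forall p, d1 (h p) = g p.
Proof.
move=> projP h1 h0 hg ex dg.
have d01 z : hom_ker h0 (d1 z) by apply/ex; exists z.
pose f' z : csub (hom_ker h0) := csin (d01 z).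
pose g' p : csub (hom_ker h0) := @csin _ _ (hom_ker h0) (g p) (dg p).
have [|||h hh fh] := projP M (csub (hom_ker h0)) f' g'.
- split; last by apply: csub_continuous; exact: h1.2.
  by move=> a y z; apply: csval_inj; rewrite linearP; exact: h1.1.
- move=> y; have /ex [z zy] := csvalP y; exists z; exact: csval_inj.
- split; last by apply: csub_continuous; exact: hg.2.
  by move=> a y z; apply: csval_inj; rewrite linearP; exact: hg.1.
by exists h => // p; have := congr1 (@csval _ _ (hom_ker h0)) (fh p).
Qed.

End Homs.

Section HomPower.
Variables (A : topPzRingType) (M N : profiniteModType A).

Lemma is_hom_sum (I : finType) (F : I -> M -> N) :
  (forall i, is_hom (F i)) -> is_hom (fun m => \sum_i F i m).
Proof.
move=> hF; split; last by apply: continuous_sum => i; exact: (hF i).2.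
move=> a u v; rewrite scaler_sumr -big_split; apply: eq_bigr => i _.
exact: (hF i).1.
Qed.

Lemma power_proj_hom (J : Type) (j : J) : is_hom (fun f : power J M => f j).
Proof. by split=> //; exact: power_proj_continuous. Qed.

Lemma power_hom (J : Type) (F : N -> power J M) :
  (forall j, is_hom (fun n => F n j)) -> is_hom F.
Proof.
move=> hF; split; last by apply: power_continuous => j; exact: (hF j).2.
by move=> a u v; apply/funext => j; exact: (hF j).1.
Qed.

End HomPower.

Section Comparison.
Variables (A : topPzRingType) (L : profiniteModType A).

Lemma res_d_hom (P : proj_resolution L) k : is_hom (res_d P k).
Proof. exact/is_hom_lin/res_d_continuous. Qed.

Lemma res_aug_hom (P : proj_resolution L) : is_hom (res_aug P).
Proof. exact/is_hom_lin/res_aug_continuous. Qed.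

Lemma res_dd (P : proj_resolution L) k (x : P k.+2) : res_d P k (res_d P k.+1 x) = 0.
Proof. by apply/res_exact; exists x. Qed.

Lemma res_augd (P : proj_resolution L) (x : P 1%N) : res_aug P (res_d P 0 x) = 0.
Proof. by apply/res_exact0; exists x. Qed.

Record chain_map (P Q : proj_resolution L) := ChainMap {
  cmap :> forall k, P k -> Q k;
  cmap_hom : forall k, is_hom (@cmap k);
  cmap_d : forall k x, res_d Q k (@cmap k.+1 x) = @cmap k (res_d P k x);
  cmap_aug : forall x, res_aug Q (@cmap 0 x) = res_aug P x
}.
Arguments cmap {P Q} _ k _.

Section Existence.
Variables P Q : proj_resolution L.

Let liftable k : (P k -> Q k) -> Prop :=
  match k with
  | 0 => fun f => forall x, res_aug Q (f (res_d P 0 x)) = 0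
  | k'.+1 => fun f => forall x, res_d Q k' (f (res_d P k'.+1 x)) = 0
  end.

(** A map in one degree bundled with the condition under which it lifts to the next, so that the
    chain map is obtained by plain recursion on the degree. *)
Let stage k := {f : P k -> Q k | is_hom f /\ @liftable k f}.

Let step k (f : stage k) :
  exists g : stage k.+1, forall x, res_d Q k (sval g x) = sval f (res_d P k x).
Proof.
have hf : is_hom (fun x => sval f (res_d P k x)).
  by apply: is_hom_comp; [exact: res_d_hom|exact: (svalP f).1].
have [g hg dg] : exists2 g : P k.+1 -> Q k.+1, is_hom g &
    forall x, res_d Q k (g x) = sval f (res_d P k x).
  case: k f hf => [|k] [f [hf lf]] hfd.
    exact: (projective_lift (@res_projective _ _ P 1) (res_d_hom Q 0) (res_aug_hom Q) hfd
      (@res_exact0 _ _ Q) lf).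
  exact: (projective_lift (@res_projective _ _ P k.+2) (res_d_hom Q k.+1) (res_d_hom Q k) hfd
    (@res_exact _ _ Q k) lf).
have lg : @liftable k.+1 g by move=> x; rewrite dg res_dd is_hom0 //; exact: (svalP f).1.
by exists (exist _ g (conj hg lg)).
Qed.

Lemma chain_map_exists : inhabited (chain_map P Q).
Proof.
have [f0 hf0 af0] := @res_projective _ _ P 0 _ _ _ _ (res_aug_hom Q)
  (@res_aug_surjective _ _ Q) (res_aug_hom P).
have l0 : @liftable 0 f0 by move=> x; rewrite af0 res_augd.
pose chain := fix chain k : stage k :=
  match k with
  | 0 => exist _ f0 (conj hf0 l0)
  | k'.+1 => projT1 (cid (step (chain k')))
  end.
constructor; exists (fun k => sval (chain k)) => [k|k x|x].
- exact: (svalP (chain k)).1.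
- exact: (projT2 (cid (step (chain k)))).
- exact: af0.
Qed.

End Existence.

Definition cmap_comp (P Q S : proj_resolution L) (f : chain_map P Q) (g : chain_map Q S) :
  chain_map P S.
Proof.
exists (fun k x => g k (f k x)) => [k|k x|x].
- by apply: is_hom_comp; exact: cmap_hom.
- by rewrite !cmap_d.
- by rewrite !cmap_aug.
Defined.

Section Homotopy.
Variables (P : proj_resolution L) (f : chain_map P P).

Let hom_1f k : is_hom (fun x : P k => x - f k x).
Proof. by apply: is_hom_sub; [exact: is_hom_id|exact: cmap_hom]. Qed.

Lemma chain_homotopy0 : exists2 s : P 0%N -> P 1%N, is_hom s &
  forall x, x - f 0%N x = res_d P 0 (s x).
Proof.
have [|s hs ds] := projective_lift (@res_projective _ _ P 0) (res_d_hom P 0)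
  (res_aug_hom P) (hom_1f 0) (@res_exact0 _ _ P).
  by move=> x; rewrite raddfB /= cmap_aug subrr.
by exists s.
Qed.

(** The two homotopy components adjacent to one degree determine what happens to (co)homology in
    that degree; the induction hands [s'] on as the next [s]. *)
Lemma chain_homotopyS k : exists s s', [/\ is_hom s, is_hom s' &
  forall x : P k.+1, x - f k.+1 x = res_d P k.+1 (s' x) + s (res_d P k x)].
Proof.
elim: k => [|k [s [s' [hs hs' ds]]]].
  have [s hs ds] := chain_homotopy0.
  have [||s' hs' ds'] := projective_lift (@res_projective _ _ P 1) (res_d_hom P 1)
    (res_d_hom P 0) _ (@res_exact _ _ P 0) (g := fun x => x - f 1%N x - s (res_d P 0 x)).
  - apply: is_hom_sub => //; exact: (is_hom_comp (res_d_hom P 0) hs).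
  - by move=> x; rewrite !raddfB /= cmap_d -ds subrr.
  by exists s, s'; split=> // x; rewrite ds' subrK.
have [||s2 hs2 ds2] := projective_lift (@res_projective _ _ P k.+2) (res_d_hom P k.+2)
  (res_d_hom P k.+1) _ (@res_exact _ _ P k.+1)
  (g := fun x => x - f k.+2 x - s' (res_d P k.+1 x)).
- by apply: is_hom_sub => //; exact: (is_hom_comp (res_d_hom P k.+1) hs').
- move=> x; rewrite !raddfB /= cmap_d ds res_dd (is_hom0 hs) addr0 subrr.
  by [].
by exists s', s2; split=> // x; rewrite ds2 subrK.
Qed.

End Homotopy.
End Comparison.

Section Isom.
Variable R : pzRingType.

Definition isom (U V : lmodType R) : Prop := exists f : {linear U -> V}, bijective f.

Lemma isom_sym U V : isom U V -> isom V U.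
Proof.
move=> [f [g fK gK]]; have lg : linear g.
  by move=> a x y; apply: (can_inj fK); rewrite gK linearP !gK.
pose G : {linear V -> U} := HB.pack g (GRing.isLinear.Build _ _ _ _ g lg).
by exists G; exists f.
Qed.

Lemma isom_trans V U W : isom U V -> isom V W -> isom U W.
Proof.
move=> [f bf] [g bg]; exists (g \o f : {linear U -> W}).
exact: bij_comp.
Qed.

Lemma inj_surj_bij (T S : Type) (f : T -> S) :
  injective f -> (forall y, exists x, f x = y) -> bijective f.
Proof.
move=> fI sf; exists (fun y => projT1 (cid (sf y))) => [x|y].
  by apply: fI; exact: (projT2 (cid (sf (f x)))).
exact: (projT2 (cid (sf y))).
Qed.

Lemma isom_trivial (U V : lmodType R) :
  (forall x : U, x = 0) -> (forall x : V, x = 0) -> isom U V.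
Proof.
move=> U0 V0; exists (\0%R : {linear U -> V}); apply: inj_surj_bij => [x y _|y].
  by rewrite (U0 x) (U0 y).
by exists 0; rewrite (V0 y).
Qed.

Lemma subquot_trivial (V : lmodType R) (Z B : submodule V) :
  (forall x, Z x -> B x) -> forall c : subquot Z B, c = 0.
Proof.
move=> ZB c; have [z ->] := sqpi_surj c.
rewrite -(raddf0 (sqpi B)); apply/sqpiP/asboolP; rewrite subr0.
by apply: ZB; have /asboolP := valP z.
Qed.

Lemma subquot_isom (V V' : lmodType R) (Z B : submodule V) (Z' B' : submodule V')
    (F : {linear V -> V'}) :
  (forall x, Z x -> Z' (F x)) -> (forall x, Z x -> (B' (F x) <-> B x)) ->
  (forall y, Z' y -> exists2 x, Z x & B' (F x - y)) ->
  isom (subquot Z B) (subquot Z' B').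
Proof.
move=> ZF BF sF.
have zP (z : submod_type Z) : Z (val z) by have /asboolP := valP z.
pose Fz (z : submod_type Z) : submod_type Z' := exist _ (F (val z)) (asboolT (ZF _ (zP z))).
have FzB y z : Fz y - Fz z = Fz (y - z) by apply: val_inj; rewrite /= !raddfB.
pose f (c : subquot Z B) : subquot Z' B' := sqpi B' (Fz (quot_repr c)).
have fE z : f (sqpi B z) = sqpi B' (Fz z).
  apply/sqpiP; rewrite FzB; apply/asboolP/BF; first exact: zP.
  by have /sqpiP/asboolP : sqpi B (quot_repr (sqpi B z)) = sqpi B z by rewrite /sqpi reprK.
have lf : linear f.
  move=> a c c'; have [z ->] := sqpi_surj c; have [z' ->] := sqpi_surj c'.
  rewrite -[a *: sqpi B z]/(subquot_scale a (sqpi B z)) subquot_scaleE -raddfD !fE.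
  rewrite -[a *: sqpi B' _]/(subquot_scale a (sqpi B' _)) subquot_scaleE -raddfD.
  by congr (sqpi _ _); apply: val_inj; rewrite /= linearP.
pose f' : {linear subquot Z B -> subquot Z' B'} := HB.pack f (GRing.isLinear.Build _ _ _ _ f lf).
exists f'; apply: inj_surj_bij => [c c'|c].
  have [z ->] := sqpi_surj c; have [z' ->] := sqpi_surj c'.
  rewrite -[f' _]/(f _) -[f' (sqpi B z')]/(f _) !fE => /sqpiP; rewrite FzB => /asboolP/BF BF'.
  by apply/sqpiP/asboolP; apply: BF'; exact: zP.
have [[y py] ->] := sqpi_surj c; have Zy : Z' y by exact/asboolP.
have [x Zx Bxy] := sF y Zy; exists (sqpi B (exist _ x (asboolT Zx))).
by rewrite -[f' _]/(f _) fE; apply/sqpiP/asboolP.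
Qed.

End Isom.

Section CohomologyComparison.
Variables (R : profiniteComRingType) (G : profiniteGroupType).
Local Notation A := (cgr R G).
Variables (L : profiniteModType A) (P Q : proj_resolution L).

Lemma cohomology_isom (M : profiniteModType A) k :
  isom (cohomology_nat P M k) (cohomology_nat Q M k).
Proof.
have [phi] := chain_map_exists P Q; have [psi] := chain_map_exists Q P.
pose F (f : cochain_space P M k) : cochain_space Q M k := fun y => f (psi k y).
have lF : linear F by [].
pose F' : {linear cochain_space P M k -> cochain_space Q M k} :=
  HB.pack F (GRing.isLinear.Build _ _ _ _ F lF).
have chainF j (f : P j -> M) : is_hom f -> is_hom (fun y => f (psi j y)).
  by move=> hf; apply: is_hom_comp => //; exact: cmap_hom.
apply: (@subquot_isom _ _ _ _ _ _ _ F').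
- move=> f [hf df]; split; first exact: chainF.
  by move=> y; rewrite -[F' f _]/(f _) -cmap_d df.
- move=> f [hf df].
  change (is_coboundary (P := Q) (fun y => f (psi k y)) <-> is_coboundary (P := P) f).
  case: k f hf df {F lF F'} => [|k] f hf df; split=> /=.
  + have [s hs ds] := chain_homotopy0 (cmap_comp phi psi).
    move=> Ff; apply/funext => y; have fy := congr1 (fun h => h (phi 0%N y)) Ff.
    rewrite -(subrK (cmap_comp phi psi 0%N y) y) (is_homD _ _ hf) ds df add0r.
    exact: fy.
  + by move=> ->.
  + move=> [g hg fg]; have [s [s' [hs hs' ds]]] := chain_homotopyS (cmap_comp phi psi) k.
    exists (fun y => f (s y) + g (phi k y)).
      by apply: is_hom_add; apply: is_hom_comp => //; exact: cmap_hom.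
    move=> y; rewrite -{1}(subrK (cmap_comp phi psi k.+1 y) y) (is_homD _ _ hf) ds.
    rewrite (is_homD _ _ hf) df add0r -[f (cmap_comp _ _ _ _)]/(f (psi k.+1 (phi k.+1 y))).
    by rewrite fg cmap_d.
  + move=> [g hg fg]; exists (fun y => g (psi k y)); first exact: chainF.
    by move=> y; rewrite fg cmap_d.
move=> f [hf df]; exists (fun y => f (phi k y)).
  split; first by apply: is_hom_comp => //; exact: cmap_hom.
  by move=> y; rewrite -cmap_d df.
change (is_coboundary (P := Q) (fun y => f (phi k (psi k y)) - f y)).
case: k f hf df {F lF F'} => [|k] f hf df /=.
  have [s hs ds] := chain_homotopy0 (cmap_comp psi phi).
  apply/funext => y; rewrite -(is_homB _ _ hf) -opprB.
  by rewrite -[X in y - X]/(cmap_comp psi phi 0%N y) ds -raddfN df.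
have [s [s' [hs hs' ds]]] := chain_homotopyS (cmap_comp psi phi) k.
exists (fun y => - f (s y)).
  split; last exact: (continuousN (is_hom_comp hs hf).2).
  by move=> a y z; rewrite (is_hom_comp hs hf).1 opprD scalerN.
move=> y; rewrite -(is_homB _ _ hf) -opprB.
rewrite -[X in y - X]/(cmap_comp psi phi k.+1 y) ds opprD (is_homB _ _ hf) -raddfN df sub0r.
by [].
Qed.

End CohomologyComparison.

(** * Comparison of homology through the universal property of tensor products *)

Section Tensors.
Variables (R : profiniteComRingType) (G : profiniteGroupType).
Local Notation A := (cgr R G).
Implicit Types P Q M : profiniteModType A.

Lemma balanced_comp P M (T Z : profiniteModType R) (t : P -> M -> T) (h : T -> Z) :
  is_balanced t -> is_hom h -> is_balanced (fun p m => h (t p m)).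
Proof.
move=> [[tl tr tc] tb] hh; split; last by move=> a p m; rewrite tb.
split=> [m a p q|p a m n|].
- by have := tl m a p q => /= ->; exact: hh.1.
- by have := tr p a m n => /= ->; exact: hh.1.
exact: (continuous_comp1 hh.2 tc).
Qed.

Lemma tensor_ext P M (T Z : profiniteModType R) (t : P -> M -> T) (h h' : T -> Z) :
  is_cgr_tensor t -> is_hom h -> is_hom h' ->
  (forall p m, h (t p m) = h' (t p m)) -> forall y, h y = h' y.
Proof.
move=> [bt ut] hh hh' ht y.
have [f [_ funiq]] := ut Z _ (balanced_comp bt hh).
by rewrite -(funiq h (conj hh (fun _ _ => erefl))) (funiq h' (conj hh' (fun p m => esym (ht p m)))).
Qed.

Lemma tensor_map P Q M (T S : profiniteModType R) (t : P -> M -> T) (s : Q -> M -> S)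
  (f : P -> Q) : is_cgr_tensor t -> is_balanced s -> is_hom f ->
  exists2 h : T -> S, is_hom h & forall p m, h (t p m) = s (f p) m.
Proof.
move=> [bt ut] [[sl sr sc] sb] hf.
have [|h [[hh ht] _]] := ut S (fun p m => s (f p) m); last by exists h.
split; last by move=> a p m; rewrite (is_homZ _ _ hf) sb.
split=> [m a p q|p a m n|]; last 1 first.
- apply: (continuous_comp2 sc); last exact: snd_continuous.
  exact: (continuous_comp1 hf.2 (@fst_continuous P M)).
- rewrite -[a *: (p : restr P)]/(cgr_scal G a *: (p : P)) -[_ + q]/((_ : P) + (q : P)).
  rewrite (is_homD _ _ hf) (is_homZ _ _ hf).
  exact: (sl m a (f p) (f q)).
- exact: (sr (f p) a m n).
Qed.

End Tensors.

Section HomologyComparison.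
Variables (R : profiniteComRingType) (G : profiniteGroupType).
Local Notation A := (cgr R G).
Variables (L : profiniteModType A) (M : profiniteModType A).

Lemma tc_d_hom (P : proj_resolution L) (X : tensor_complex P M) k : is_hom (tc_d X k).
Proof. exact/is_hom_lin/tc_d_continuous. Qed.

Definition induced (P Q : proj_resolution L) (X : tensor_complex P M)
    (Y : tensor_complex Q M) (f : chain_map P Q) k (h : X k -> Y k) : Prop :=
  is_hom h /\ forall p m, h (tc_tensor X p m) = tc_tensor Y (f k p) m.

Lemma induced_exists (P Q : proj_resolution L) (X : tensor_complex P M)
    (Y : tensor_complex Q M) (f : chain_map P Q) k :
  exists h : X k -> Y k, induced f h.
Proof.
have [h hh ht] := tensor_map (@tc_tensorP _ _ _ _ _ X k) (@tc_tensorP _ _ _ _ _ Y k).1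
  (cmap_hom f k).
by exists h.
Qed.

Lemma induced_d (P Q : proj_resolution L) (X : tensor_complex P M)
    (Y : tensor_complex Q M) (f : chain_map P Q) k (h : X k -> Y k) (h' : X k.+1 -> Y k.+1) :
  induced f h -> induced f h' -> forall y, tc_d Y k (h' y) = h (tc_d X k y).
Proof.
move=> [hh ht] [hh' ht']; apply: (tensor_ext (@tc_tensorP _ _ _ _ _ X k.+1)).
- exact: is_hom_comp (tc_d_hom Y k).
- exact: is_hom_comp (tc_d_hom X k) hh.
by move=> p m; rewrite ht' !tc_dE ht cmap_d.
Qed.

Lemma induced_cycle (P Q : proj_resolution L) (X : tensor_complex P M)
    (Y : tensor_complex Q M) (f : chain_map P Q) k (h : X k -> Y k) :
  induced f h -> forall y, is_cycle (tc_d X) y -> is_cycle (tc_d Y) (h y).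
Proof.
case: k h => [//|k] h ih y /= dy.
have [h0 ih0] := induced_exists X Y f k.
by rewrite (induced_d ih0 ih) dy (is_hom0 ih0.1).
Qed.

Lemma induced_boundary (P Q : proj_resolution L) (X : tensor_complex P M)
    (Y : tensor_complex Q M) (f : chain_map P Q) k (h : X k -> Y k) :
  induced f h -> forall y, is_boundary (tc_d X) y -> is_boundary (tc_d Y) (h y).
Proof.
move=> ih y [z <-]; have [h1 ih1] := induced_exists X Y f k.+1.
by exists (h1 z); rewrite (induced_d ih ih1).
Qed.

Lemma induced_homotopy (P : proj_resolution L) (X : tensor_complex P M)
    (f : chain_map P P) k (h : X k -> X k) : induced f h ->
  forall y, is_cycle (tc_d X) y -> is_boundary (tc_d X) (y - h y).
Proof.
move=> [hh ht] y cy; have bX j := (@tc_tensorP _ _ _ _ _ X j).1.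
have tB j p q m : tc_tensor X (p - q) m = @tc_tensor _ _ _ _ _ X j p m - tc_tensor X q m.
  have [[tl _ _] _] := bX j; have := tl m (-1) q p.
  by rewrite !scaleN1r => H; rewrite [p - q]addrC [RHS]addrC; exact: H.
have tD j p q m : tc_tensor X (p + q) m = @tc_tensor _ _ _ _ _ X j p m + tc_tensor X q m.
  have [[tl _ _] _] := bX j; have := tl m 1 p q.
  by rewrite !scale1r => H; exact: H.
have h1 := is_hom_sub (is_hom_id _) hh.
case: k h hh ht y cy h1 => [|k] h hh ht y cy h1.
  have [s hs ds] := chain_homotopy0 f.
  have [s1 hs1 st] := tensor_map (@tc_tensorP _ _ _ _ _ X 0) (bX 1%N) hs.
  exists (s1 y); apply/esym; move: y {cy}.
  apply: (tensor_ext (@tc_tensorP _ _ _ _ _ X 0)) => //.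
    exact: is_hom_comp (tc_d_hom X 0).
  by move=> p m; rewrite ht st tc_dE -ds tB.
have [s [s' [hs hs' ds]]] := chain_homotopyS f k.
have [s1 hs1 st] := tensor_map (@tc_tensorP _ _ _ _ _ X k) (bX k.+1) hs.
have [s2 hs2 st2] := tensor_map (@tc_tensorP _ _ _ _ _ X k.+1) (bX k.+2) hs'.
have e z : z - h z = tc_d X k.+1 (s2 z) + s1 (tc_d X k z).
  move: z; apply: (tensor_ext (@tc_tensorP _ _ _ _ _ X k.+1) h1).
    apply: is_hom_add; first exact: (is_hom_comp hs2 (tc_d_hom X k.+1)).
    exact: (is_hom_comp (tc_d_hom X k) hs1).
  by move=> p m; rewrite ht st2 !tc_dE st -tD -ds tB.
by exists (s2 y); rewrite e cy (is_hom0 hs1) addr0.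
Qed.

Lemma homology_isom (P Q : proj_resolution L) (X : tensor_complex P M)
    (Y : tensor_complex Q M) k :
  isom (chain_homology (tc_d X) k) (chain_homology (tc_d Y) k).
Proof.
have [phi] := chain_map_exists P Q; have [psi] := chain_map_exists Q P.
have [h ih] := induced_exists X Y phi k; have [g ig] := induced_exists Y X psi k.
have igh : induced (cmap_comp phi psi) (fun y => g (h y)).
  by split; [exact: is_hom_comp ih.1 ig.1|move=> p m; rewrite ih.2 ig.2].
have ihg : induced (cmap_comp psi phi) (fun y => h (g y)).
  by split; [exact: is_hom_comp ig.1 ih.1|move=> p m; rewrite ig.2 ih.2].
pose F : {linear X k -> Y k} := HB.pack h (GRing.isLinear.Build _ _ _ _ h ih.1.1).
apply: (@subquot_isom _ _ _ _ _ _ _ F) => /=.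
- exact: (induced_cycle ih).
- move=> y cy; split; last exact: (induced_boundary ih).
  move=> /(induced_boundary ig) bgh.
  have := submodD (W := boundaries (tc_d X) k) (induced_homotopy igh cy) bgh.
  by rewrite subrK.
move=> y cy; exists (g y); first exact: (induced_cycle ig).
have := submodN (W := boundaries (tc_d Y) k) (induced_homotopy ihg cy).
by rewrite opprB.
Qed.

End HomologyComparison.

(** * The explicit tensor complex of the free resolution *)

Section ExplicitTensor.
Variables (R : profiniteComRingType) (G : profiniteGroupType).
Local Notation A := (cgr R G).
Variable e : A.
Hypotheses (eM : e * e = e) (eC : forall a, e * a = a * e) (eV : cgr_inv e = e).
Variable T : profiniteModType A.
Local Notation F n := (epow eC (cgr_reg R G) n).
Local Notation ET n := (epow eC T n).

Lemma etensorP n (p : F n) (m : T) i :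
  e *: (cgr_inv (ecoord p i) *: m) = cgr_inv (ecoord p i) *: m.
Proof.
rewrite scalerA -{1}eV -cgr_invM -eC.
by rewrite -[e * _]/(e *: (ecoord p i)) ecoordE.
Qed.

(** This realizes (eA)^n (x)_A T as (eT)^n. The coordinates of [p] are inverted because the left
    factor is a right module through g |-> g^-1; the values stay in eT because e is fixed by the
    inversion. *)
Definition etensor n (p : F n) (m : T) : ET n := epow_mk eC (etensorP p m).

Lemma etensor_balanced n :
  is_balanced (etensor (n := n) : F n -> T -> restr (ET n)).
Proof.
split; last first.
  move=> a p m; apply: epow_eq => i; rewrite !epow_mkE ecoordZ.
  by rewrite -[cgr_inv a *: _]/(cgr_inv a * ecoord p i) cgr_invM cgr_invK scalerA.
split=> [m a p q|p a m m'|].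
- apply: epow_eq => i; rewrite -[a *: (p : restr _) + q]/(cgr_scal G a *: p + q).
  rewrite -[a *: (etensor p m : restr _) + _]/(cgr_scal G a *: etensor p m + etensor q m).
  rewrite ecoordD ecoordZ !epow_mkE ecoordD ecoordZ raddfD /=.
  rewrite -[cgr_scal G a *: ecoord p i]/(cgr_scal G a * ecoord p i) cgr_invM.
  by rewrite cgr_inv_scal -cgr_scal_central scalerDl scalerA.
- apply: epow_eq => i; rewrite -[a *: (m : restr _) + m']/(cgr_scal G a *: m + m').
  rewrite -[a *: (etensor p m : restr _) + _]/(cgr_scal G a *: etensor p m + etensor p m').
  rewrite ecoordD ecoordZ !epow_mkE scalerDr !scalerA.
  by rewrite cgr_scal_central.
apply: (epow_continuous (M := T)) => i.
apply: (continuousZ (M := T)); last exact: snd_continuous.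
apply: (continuous_comp1 (@cgr_inv_continuous R G)).
exact: (continuous_comp1 (@ecoord_continuous R G e eC (cgr_reg R G) n i) (@fst_continuous _ T)).
Qed.

Lemma etensor_basis n (y : ET n) :
  y = \sum_i etensor (ebasis eM eC i) (ecoord y i).
Proof.
apply: epow_eq => j; rewrite ecoord_sum (bigD1 j) //= big1 => [|i /negPf ij].
  by rewrite addr0 epow_mkE ecoord_basis eqxx eV ecoordE.
by rewrite epow_mkE ecoord_basis ij raddf0 scale0r.
Qed.

Lemma etensor_tensor n :
  is_cgr_tensor (etensor (n := n) : F n -> T -> restr (ET n)).
Proof.
split; first exact: etensor_balanced.
move=> Z b [[bl br bc] bb].
have bD p q m : b (p + q) m = b p m + b q m.
  by have := bl m 1 p q; rewrite !scale1r => H; exact: H.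
have b0 m : b 0 m = 0 by apply: (addIr (b 0 m)); rewrite -bD !add0r.
have bc1 p : continuous (fun m => b p m).
  apply: (continuous_comp1 (f := fun m => (p, m)) bc).
  by apply: pair_continuous; [exact: cst_continuous|move=> ?; exact: cvg_id].
pose h (y : restr (ET n)) : Z := \sum_i b (ebasis eM eC i) (ecoord (y : ET n) i).
have hh : is_hom h.
  split; last first.
    apply: continuous_sum => i.
    exact: (continuous_comp1 (@bc1 _) (@ecoord_continuous R G e eC T n i)).
  move=> a y z; rewrite /h scaler_sumr -big_split; apply: eq_bigr => i _ /=.
  rewrite -[a *: y + z]/(cgr_scal G a *: (y : ET n) + (z : ET n)) ecoordD ecoordZ.
  exact: (br (ebasis eM eC i) a (ecoord (y : ET n) i) (ecoord (z : ET n) i)).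
exists h; split.
  split=> // p m; rewrite /h [in RHS](epow_basis eM p) (big_morph (b^~ m) (fun p q => bD p q m) (b0 m)).
  by apply: eq_bigr => i _; rewrite epow_mkE -bb cgr_invK.
move=> h' [hh' h't]; apply/funext => y; rewrite [in RHS](etensor_basis y).
rewrite (big_morph h' (fun y z => is_homD y z hh') (is_hom0 hh')).
by apply: eq_bigr => i _; rewrite h't.
Qed.

Section Boundary.
Variables (n m : nat) (D : 'I_n -> 'I_m -> A).

Lemma bdtP (y : ET n) j :
  e *: (\sum_i cgr_inv (D i j) *: ecoord y i) = \sum_i cgr_inv (D i j) *: ecoord y i.
Proof.
rewrite scaler_sumr; apply: eq_bigr => i _.
by rewrite scalerA eC -scalerA ecoordE.
Qed.

Definition bdt (y : restr (ET n)) : restr (ET m) := epow_mk eC (bdtP y).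

Lemma bdt_is_linear : linear bdt.
Proof.
move=> a y z; apply: (@epow_eq R G e eC T m) => j.
rewrite -[a *: y + z]/(cgr_scal G a *: (y : ET n) + (z : ET n)).
rewrite -[a *: bdt y + bdt z]/(cgr_scal G a *: (bdt y : ET m) + (bdt z : ET m)).
rewrite ecoordD ecoordZ !epow_mkE scaler_sumr -big_split; apply: eq_bigr => i _ /=.
by rewrite ecoordD ecoordZ scalerDr !scalerA cgr_scal_central.
Qed.
HB.instance Definition _ := GRing.isLinear.Build R (restr (ET n)) (restr (ET m)) *:%R
  bdt bdt_is_linear.

Lemma bdt_continuous : continuous bdt.
Proof.
apply: (epow_continuous (M := T)) => j; apply: (continuous_sum (M := T)) => i.
by apply: (continuousZr (M := T)); exact: ecoord_continuous.
Qed.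

End Boundary.
End ExplicitTensor.

Section FreeTensorComplex.
Variables (G : profiniteGroupType) (d : nat) (x : 'I_d -> G).
Hypothesis freeG : free_pronilpotent_on x.
Local Notation A := (cgr Zhat G).
Local Notation nilG := (proj1 freeG).
Local Notation e := (blk Zhat nilG).
Variables (L : profiniteModType A) (trL : trivial_module L) (T : profiniteModType A).

Definition free_tc_mod (k : nat) : profiniteModType Zhat :=
  restr (epow (eC freeG) T (rank d k)).

Definition free_tc_d (k : nat) : {linear free_tc_mod k.+1 -> free_tc_mod k} :=
  bdt (eC := eC freeG) (T := T) (bdmx x (k := k)).

Lemma free_tc_dE k (p : freeres freeG trL k.+1) (m : T) :
  free_tc_d k (@etensor _ _ e (eC freeG) (blk_inv Zhat nilG) T (rank d k.+1) p m) =
  @etensor _ _ e (eC freeG) (blk_inv Zhat nilG) T (rank d k) (res_d (freeres freeG trL) k p) m.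
Proof.
apply: (@epow_eq _ _ _ (eC freeG) T) => j; rewrite !epow_mkE.
rewrite -[res_d _ _ _]/(@bd G d x freeG _ _ (bdmx x (k := k)) p) bdE cgr_inv_sum scaler_suml.
by apply: eq_bigr => i _; rewrite epow_mkE cgr_invM scalerA.
Qed.

Definition free_tc : tensor_complex (freeres freeG trL) T :=
  @TensorComplex _ _ _ (freeres freeG trL) T free_tc_mod
    (fun k => @etensor _ _ e (eC freeG) (blk_inv Zhat nilG) T (rank d k))
    (fun k => @etensor_tensor _ _ e (eP freeG) (eC freeG) (blk_inv Zhat nilG) T (rank d k))
    free_tc_d (fun k => @bdt_continuous _ _ _ (eC freeG) T _ _ (bdmx x (k := k))) free_tc_dE.

End FreeTensorComplex.

(** * Measures on G with values in a module *)

(* The module M[[G]] of M-valued measures on G, as the closure of the finite sums of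
   point masses in the space of all M-valued functions of clopen subsets of G. *)
Section Measures.
Variables (R : profiniteComRingType) (G : profiniteGroupType).
Local Notation A := (cgr R G).
Variable M : profiniteModType A.

Definition clopens : Type := {C : set G | clopen C}.
Local Notation W := (power clopens (restr M)).

Definition point_fun (m : restr M) (g : G) : W :=
  fun C => if `[< sval C g >] then m else 0.

Definition point_sum (s : seq (restr M * G)) : W := \sum_(z <- s) point_fun z.1 z.2.

Lemma point_funZ a m g : a *: point_fun m g = point_fun (a *: m) g.
Proof.
apply/funext => C; rewrite -[LHS]/(a *: point_fun m g C) /point_fun.
by case: ifP => _ //; rewrite scaler0.
Qed.

Lemma point_sumZD a s t : a *: point_sum s + point_sum t =
  point_sum ([seq (a *: z.1, z.2) | z <- s] ++ t).
Proof.
rewrite /point_sum big_cat big_map scaler_sumr; congr (_ + _).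
by apply: eq_bigr => z _; rewrite point_funZ.
Qed.

Let meas_set : set W := closure [set f | exists s, f = point_sum s].

Let meas0 : meas_set 0.
Proof. by apply: subset_closure; exists [::]; rewrite /point_sum big_nil. Qed.

Let cl_meas : closed meas_set. Proof. exact: closed_closure. Qed.

Let measZD a u v : meas_set u -> meas_set v -> meas_set (a *: u + v).
Proof.
have ind (K : set W) : closed K -> (forall s, K (point_sum s)) -> forall f, meas_set f -> K f.
  by move=> cK Ks f; rewrite closure_id in cK; rewrite cK; apply: closureS => _ [s ->].
have cid (T : topologicalType) : continuous (fun t : T => t) by move=> ?; exact: cvg_id.
move=> mu mv; move: u mu; apply: (ind [set u | meas_set (a *: u + v)]).
  apply: (closed_preimage (f := fun u : W => a *: u + v)) => //.
  by apply: continuousD; [apply: continuousZr; exact: cid|exact: cst_continuous].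
move=> s; move: v mv; apply: (ind [set v | meas_set (a *: point_sum s + v)]).
  apply: (closed_preimage (f := fun v : W => a *: point_sum s + v)) => //.
  by apply: continuousD; [exact: cst_continuous|exact: cid].
move=> t; apply: subset_closure; rewrite point_sumZD.
by eexists.
Qed.

Definition meas_sub : closed_submodule W :=
  @ClosedSubmodule _ _ (Submodule meas0 measZD) cl_meas.

Definition meas : profiniteModType R := csub meas_sub.

Definition mval (v : meas) (C : clopens) : restr M := csval v C.

Let point_in m g : meas_sub (point_fun m g).
Proof.
by apply: subset_closure; exists [:: (m, g)]; rewrite /point_sum big_seq1.
Qed.

Definition point (m : restr M) (g : G) : meas := csin (@point_in m g).

Lemma point_val m g C : mval (point m g) C = if `[< sval C g >] then m else 0.
Proof. by []. Qed.

Lemma mval_eq v w : (forall C, mval v C = mval w C) -> v = w.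
Proof. by move=> vw; apply: csval_inj; apply/funext => C; exact: vw. Qed.

Lemma mval_linear C : linear (mval^~ C).
Proof. by move=> a v w; rewrite /mval linearP. Qed.

Lemma mval_continuous C : continuous (mval^~ C).
Proof.
exact: (continuous_comp1 (@power_proj_continuous _ _ _ C) (@csval_continuous _ _ meas_sub)).
Qed.

Lemma mval_hom C : is_hom (mval^~ C).
Proof. by split; [exact: mval_linear|exact: mval_continuous]. Qed.

Lemma meas_continuous (T : topologicalType) (f : T -> meas) :
  (forall C, continuous (fun t => mval (f t) C)) -> continuous f.
Proof. by move=> cf; apply: csub_continuous; exact: power_continuous. Qed.

Lemma point_linear g : linear (point^~ g).
Proof.
move=> a m m'; apply: mval_eq => C; rewrite mval_linear !point_val.
by case: ifP => // _; rewrite scaler0 addr0.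
Qed.

Lemma point_continuous : continuous (fun z : restr M * G => point z.1 z.2).
Proof.
apply: meas_continuous => C z U; rewrite point_val => zU.
have near_g : \forall w \near z, sval C w.2 <-> sval C z.2.
  have [oC cC] := svalP C; have [Cz|nCz] := pselect (sval C z.2).
    have : nbhs z [set w | sval C w.2].
      by apply: open_nbhs_nbhs; split=> //; apply: open_preimage => //; exact: snd_continuous.
    by apply: filterS => w /= Cw; tauto.
  have : nbhs z [set w | ~ sval C w.2].
    apply: open_nbhs_nbhs; split=> //; apply: (open_preimage (C := ~` sval C)).
      exact: snd_continuous.
    exact: closed_openC.
  by apply: filterS => w /= Cw; tauto.
have [Cz|nCz] := pselect (sval C z.2).
  rewrite asboolT // in zU; have /= z1U := @fst_continuous _ _ z _ zU.
  apply: filterS2 near_g z1U => w /= Cw Uw.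
  by rewrite point_val asboolT //; apply/Cw.
rewrite asboolF // in zU; apply: filterS near_g => w /= Cw.
by rewrite point_val asboolF; [exact: nbhs_singleton|move=> /Cw].
Qed.

Definition meas_sum (s : seq (restr M * G)) : meas := \sum_(z <- s) point z.1 z.2.

Lemma csval_meas_sum s : csval (meas_sum s) = point_sum s.
Proof. exact: raddf_sum. Qed.

Lemma meas_sum_dense : closure [set v | exists s, v = meas_sum s] = setT.
Proof.
apply/seteqP; split=> // v _ U [B [[B' oB' <-] B'v] BU].
have clv : closure [set f | exists s, f = point_sum s] (csval v) by exact: (csvalP v).
have [_ [[s ->] B's]] := clv _ (open_nbhs_nbhs (conj oB' B'v)).
exists (meas_sum s); split; first by exists s.
by apply: BU; rewrite -[_ (meas_sum s)]/(B' (csval (meas_sum s))) csval_meas_sum.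
Qed.

Lemma meas_sum_ind (K : set meas) : closed K -> (forall s, K (meas_sum s)) -> forall v, K v.
Proof.
move=> cK Ks v; apply: cK.
have : closure [set v | exists s, v = meas_sum s] v by rewrite meas_sum_dense.
by apply: closureS => _ [s ->].
Qed.

Lemma meas_ind (K : set meas) : closed K -> K 0 ->
  (forall v w, K v -> K w -> K (v + w)) -> (forall m g, K (point m g)) -> forall v, K v.
Proof.
move=> cK K0 KD Kp; apply: meas_sum_ind => // s.
by rewrite /meas_sum; elim/big_ind: _ => // i _; exact: Kp.
Qed.

Lemma meas_hom_ext (Z : profiniteModType R) (f f' : meas -> Z) :
  is_hom f -> is_hom f' -> (forall m g, f (point m g) = f' (point m g)) ->
  forall v, f v = f' v.
Proof.
move=> hf hf' ff'; apply: meas_ind => //.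
- by apply: closed_eq_fun; [exact: hf.2|exact: hf'.2].
- by rewrite (is_hom0 hf) (is_hom0 hf').
- by move=> v w fv fw; rewrite (is_homD _ _ hf) (is_homD _ _ hf') fv fw.
Qed.

Lemma qgroup_clopen (N : open_normal G) (q : qgroup N) :
  clopen [set g | \pi_(qgroup N) g = q].
Proof.
split.
  by rewrite openE => g /= gq; apply: filterS (qgroup_pi_near N g) => h /= ->.
rewrite -[X in closed X]setCK; apply: open_closedC.
by rewrite openE => g /= gq; apply: filterS (qgroup_pi_near N g) => h /= ->.
Qed.

Definition fibre (N : open_normal G) (q : qgroup N) : clopens := exist _ _ (qgroup_clopen q).

Section Integral.
Variables (Y : topologicalType) (Z : profiniteModType R) (b : Y -> G -> restr M -> Z).
Hypothesis cY : compact [set: Y].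
Hypothesis cb : continuous (fun z : G * (Y * restr M) => b z.2.1 z.1 z.2.2).
Hypothesis lb : forall y g, linear (b y g).

Let bhom y g : is_hom (b y g).
Proof.
split=> //; apply: (continuous_comp1 (f := fun m => (g, (y, m))) cb).
apply: pair_continuous; first exact: cst_continuous.
by apply: pair_continuous; [exact: cst_continuous|move=> ?; exact: cvg_id].
Qed.

(** Modulo an open submodule, [b] is constant on the cosets of some open normal subgroup, and the
    Riemann sum over these cosets is correct on finite sums of point masses; [dense_extension] then
    yields the integral. *)
Lemma meas_integral : exists F : Y -> meas -> Z,
  [/\ continuous (fun z : Y * meas => F z.1 z.2), forall y, linear (F y)
    & forall y m g, F y (point m g) = b y g m].
Proof.
pose Gamma (z : Y * meas) (t : Z) := exists2 s, z.2 = meas_sum s &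
  t = \sum_(w <- s) b z.1 w.2 w.1.
have [||F cF FG] := @dense_extension R (@profinite_ring_compact R) Z (Y * meas)%type Gamma.
- apply/seteqP; split=> // -[y v] _ U [[U1 U2] [/= yU1 vU2] sU].
  have : closure [set v | exists s, v = meas_sum s] v by rewrite meas_sum_dense.
  move=> /(_ U2 vU2) [_ [[s ->] Us]]; exists (y, meas_sum s); split.
    by exists (\sum_(w <- s) b y w.2 w.1); exists s.
  by apply: sU; split=> //=; exact: nbhs_singleton.
- move=> O oO.
  have cYM : compact [set: Y * restr M].
    by rewrite -setXTT; apply: compact_setX => //; exact: (@profinite_module_compact R (restr M)).
  have [N NP] := locally_constant_mod (b := fun g z => b z.1 g z.2) cYM cb oO.
  pose phi (z : Y * meas) := \sum_(q : qgroup N) b z.1 (quot_repr q) (mval z.2 (fibre q)).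
  exists phi; split.
    have cphi : continuous phi.
      apply: continuous_sum => q.
      apply: (continuous_comp1 (f := fun z : Y * meas => (quot_repr q, (z.1, mval z.2 (fibre q)))) cb).
      apply: pair_continuous; first exact: cst_continuous.
      apply: pair_continuous; first exact: fst_continuous.
      exact: (continuous_comp1 (@mval_continuous (fibre q)) (@snd_continuous Y meas)).
    by move=> z; exact: (@cphi z _ (near_submodule (phi z) oO)).
  move=> [y v] t [s /= -> ->]; rewrite /phi /=.
  have -> : \sum_(q : qgroup N) b y (quot_repr q) (mval (meas_sum s) (fibre q)) =
      \sum_(w <- s) b y (quot_repr (\pi_(qgroup N) w.2)) w.1.
    rewrite /meas_sum.
    transitivity (\sum_(q : qgroup N) \sum_(w <- s) b y (quot_repr q) (mval (point w.1 w.2) (fibre q))).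
      apply: eq_bigr => q _; have hC := is_hom_comp (mval_hom (fibre q)) (bhom y (quot_repr q)).
      by rewrite (big_morph _ (fun v w => is_homD v w hC) (is_hom0 hC)).
    rewrite exchange_big /=; apply: eq_bigr => w _.
    rewrite (bigD1 (\pi_(qgroup N) w.2)) //= big1 => [|q qw].
      by rewrite addr0 point_val asboolT.
    rewrite point_val asboolF ?(is_hom0 (bhom _ _)) //= => wq.
    by rewrite wq eqxx in qw.
  rewrite -sumrB; apply: submod_sum => -[m g] _ /=.
  rewrite -[quot_repr _](mulKVg g); apply: (NP _ _ g (y, m)).
  exact: repr_qgroup.
have FS y s : F (y, meas_sum s) = \sum_(w <- s) b y w.2 w.1 by apply: FG; exists s.
have cFy y : continuous (fun v => F (y, v)).
  apply: (continuous_comp1 (f := fun v => (y, v)) cF).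
  by apply: pair_continuous; [exact: cst_continuous|move=> ?; exact: cvg_id].
exists (fun y v => F (y, v)); split.
- by rewrite (_ : (fun _ => _) = F) //; apply/funext; case.
- move=> y a v w; move: v; apply: meas_sum_ind.
    apply: closed_eq_fun.
      apply: (continuous_comp1 (f := fun v => a *: v + w) (cFy y)).
      by apply: continuousD; [apply: continuousZr => ?; exact: cvg_id|exact: cst_continuous].
    by apply: continuousD; [apply: continuousZr; exact: cFy|exact: cst_continuous].
  move=> s; move: w; apply: meas_sum_ind.
    apply: closed_eq_fun.
      apply: (continuous_comp1 (f := fun w => a *: meas_sum s + w) (cFy y)).
      by apply: continuousD; [exact: cst_continuous|move=> ?; exact: cvg_id].
    by apply: continuousD; [exact: cst_continuous|exact: cFy].
  move=> t; have -> : a *: meas_sum s + meas_sum t =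
      meas_sum ([seq (a *: z.1, z.2) | z <- s] ++ t).
    apply: csval_inj; rewrite [RHS]csval_meas_sum -point_sumZD -!csval_meas_sum.
    by rewrite linearP.
  rewrite /= !FS big_cat big_map scaler_sumr; congr (_ + _).
  by apply: eq_bigr => z _; rewrite (is_homZ _ _ (bhom _ _)).
- move=> y m g; have -> : point m g = meas_sum [:: (m, g)] by rewrite /meas_sum big_seq1.
  by rewrite FS big_seq1.
Qed.

End Integral.
End Measures.

Lemma restr_scale_hom (R : profiniteComRingType) (G : profiniteGroupType)
    (T : profiniteModType (cgr R G)) (a : cgr R G) :
  is_hom (fun y : restr T => a *: (y : T) : restr T).
Proof.
split; last by apply: (continuousZr (M := T)) => ?; exact: cvg_id.
move=> r y z; rewrite -[r *: y + z]/(cgr_scal G r *: (y : T) + (z : T)).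
by rewrite scalerDr scalerA -cgr_scal_central -scalerA.
Qed.

(** * Left and right translation of measures *)

Section MeasureActions.
Variables (R : profiniteComRingType) (G : profiniteGroupType).
Local Notation A := (cgr R G).
Variable M : profiniteModType A.
Local Notation V := (meas M).
Local Notation elt := (@cgr_elt R G).

Lemma meas_gaction (alpha : G -> restr M -> restr M) (beta : G -> G -> G) :
  continuous (fun z : G * restr M => alpha z.1 z.2) ->
  continuous (fun z : G * G => beta z.1 z.2) -> (forall h, linear (alpha h)) ->
  (forall m, alpha 1%g m = m) -> (forall g, beta 1%g g = g) ->
  (forall h k m, alpha (h * k)%g m = alpha h (alpha k m)) ->
  (forall h k g, beta (h * k)%g g = beta h (beta k g)) ->
  exists s : gaction G V, forall h m g, s h (point m g) = point (alpha h m) (beta h g).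
Proof.
move=> ca cb la a1 b1 aM bM.
have [||F [cF lF FE]] := @meas_integral R G M G V
    (fun h g m => point (alpha h m) (beta h g)) (@profinite_group_compact G).
- have c1 : continuous (fun z : G * (G * restr M) => z.1) by exact: fst_continuous.
  have c2 : continuous (fun z : G * (G * restr M) => z.2) by exact: snd_continuous.
  have c21 := continuous_comp1 (@fst_continuous G (restr M)) c2.
  have c22 := continuous_comp1 (@snd_continuous G (restr M)) c2.
  apply: (continuous_comp2 (@point_continuous R G M)).
    exact: (continuous_comp2 ca c21 c22).
  exact: (continuous_comp2 cb c21 c1).
- by move=> h g r m m'; rewrite la (point_linear _ _ _ _).
have hF h : is_hom (F h).
  split; first exact: lF.
  apply: (continuous_comp1 (f := fun v => (h, v)) cF).
  by apply: pair_continuous; [exact: cst_continuous|move=> ?; exact: cvg_id].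
have F1 v : F 1%g v = v.
  move: v; apply: meas_hom_ext (hF _) (is_hom_id _) _ => m g.
  by rewrite FE a1 b1.
have FM h k v : F (h * k)%g v = F h (F k v).
  move: v; apply: meas_hom_ext (hF _) (is_hom_comp (hF k) (hF h)) _ => m g.
  by rewrite !FE aM bM.
by exists (GAction lF F1 FM cF) => h m g; rewrite -FE.
Qed.

Lemma meas_left_exists : exists s : gaction G V,
  forall h m g, s h (point m g) = point m (h * g)%g.
Proof.
have [|||||||s sE] := @meas_gaction (fun _ m => m) (fun h g => (h * g)%g); last by exists s.
- exact: snd_continuous.
- exact: profinite_mulg_continuous.
- by [].
- by [].
- exact: mul1g.
- by [].
- by move=> h k g; rewrite mulgA.
Qed.

(** The twist of the coefficient by [h] is dictated by the map to M (x) D: as g h^-1 (h m (x) c) = g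
    (m (x) h^-1 c), this action becomes that of [h^-1] on the second factor ([tau_ract]), while left
    translation becomes the action on the tensor product ([tau_lact]). *)
Lemma meas_right_exists : exists s : gaction G V,
  forall h m g, s h (point m g) = point (elt h *: (m : M) : restr M) (g * h^-1)%g.
Proof.
have [|||||||s sE] := @meas_gaction (fun h m => elt h *: (m : M)) (fun h g => (g * h^-1)%g);
  last by exists s.
- apply: (continuousZ (M := M)); last exact: snd_continuous.
  exact: (continuous_comp1 (@cgr_elt_continuous R G) (@fst_continuous G (restr M))).
- apply: continuousM; first exact: snd_continuous.
  by apply: continuousV; exact: fst_continuous.
- by move=> h; exact: (restr_scale_hom M (elt h)).1.
- by move=> m; rewrite cgr_elt1 scale1r.
- by move=> g; rewrite invg1 mulg1.
- by move=> h k m; rewrite cgr_eltM scalerA.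
- by move=> h k g; rewrite invgM mulgA.
Qed.

Definition meas_left : gaction G V := projT1 (cid meas_left_exists).
Definition meas_right : gaction G V := projT1 (cid meas_right_exists).

Definition lact (a : A) (v : V) : V := a *: (v : gmod meas_left).
Definition ract (a : A) (v : V) : V := a *: (v : gmod meas_right).

Lemma lact_point h m g : lact (elt h) (point m g) = point m (h * g)%g.
Proof. by rewrite /lact gmod_elt; exact: (projT2 (cid meas_left_exists)). Qed.

Lemma ract_point h m g :
  ract (elt h) (point m g) = point (elt h *: (m : M) : restr M) (g * h^-1)%g.
Proof. by rewrite /ract gmod_elt; exact: (projT2 (cid meas_right_exists)). Qed.

Lemma lact_continuous : continuous (fun z : A * V => lact z.1 z.2).
Proof. exact: (@profinite_scale_continuous A (gmod meas_left)). Qed.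

Lemma ract_continuous : continuous (fun z : A * V => ract z.1 z.2).
Proof. exact: (@profinite_scale_continuous A (gmod meas_right)). Qed.

Lemma lactA a b v : lact a (lact b v) = lact (a * b) v.
Proof. exact: (@scalerA A (gmod meas_left)). Qed.
Lemma ractA a b v : ract a (ract b v) = ract (a * b) v.
Proof. exact: (@scalerA A (gmod meas_right)). Qed.
Lemma lactDl a b v : lact (a + b) v = lact a v + lact b v.
Proof. exact: (@scalerDl A (gmod meas_left)). Qed.
Lemma ractDl a b v : ract (a + b) v = ract a v + ract b v.
Proof. exact: (@scalerDl A (gmod meas_right)). Qed.
Lemma lact0l v : lact 0 v = 0.
Proof. exact: (@scale0r A (gmod meas_left)). Qed.
Lemma ract0l v : ract 0 v = 0.
Proof. exact: (@scale0r A (gmod meas_right)). Qed.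
Lemma lactBl a b v : lact (a - b) v = lact a v - lact b v.
Proof. exact: (@scalerBl A (gmod meas_left)). Qed.
Lemma ractBl a b v : ract (a - b) v = ract a v - ract b v.
Proof. exact: (@scalerBl A (gmod meas_right)). Qed.
Lemma lact1 v : lact 1 v = v.
Proof. exact: (@scale1r A (gmod meas_left)). Qed.
Lemma ract1 v : ract 1 v = v.
Proof. exact: (@scale1r A (gmod meas_right)). Qed.
Lemma lact_scal r v : lact (cgr_scal G r) v = r *: v.
Proof. exact: (gmod_scal (s := meas_left)). Qed.
Lemma ract_scal r v : ract (cgr_scal G r) v = r *: v.
Proof. exact: (gmod_scal (s := meas_right)). Qed.

Lemma lact_hom a : is_hom (lact a).
Proof.
split=> [r v w|].
  have -> : r *: lact a v = lact a (r *: v).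
    by rewrite -!lact_scal !lactA cgr_scal_central.
  exact: (@scalerDr A (gmod meas_left) a (r *: v) w).
apply: (continuous_comp1 (f := fun v => (a, v)) lact_continuous).
by apply: pair_continuous; [exact: cst_continuous|move=> ?; exact: cvg_id].
Qed.

Lemma ract_hom a : is_hom (ract a).
Proof.
split=> [r v w|].
  have -> : r *: ract a v = ract a (r *: v).
    by rewrite -!ract_scal !ractA cgr_scal_central.
  exact: (@scalerDr A (gmod meas_right) a (r *: v) w).
apply: (continuous_comp1 (f := fun v => (a, v)) ract_continuous).
by apply: pair_continuous; [exact: cst_continuous|move=> ?; exact: cvg_id].
Qed.

Lemma lact_continuousl v : continuous (lact^~ v).
Proof.
apply: (continuous_comp1 (f := fun a => (a, v)) lact_continuous).
by apply: pair_continuous; [move=> ?; exact: cvg_id|exact: cst_continuous].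
Qed.

Lemma ract_continuousl v : continuous (ract^~ v).
Proof.
apply: (continuous_comp1 (f := fun a => (a, v)) ract_continuous).
by apply: pair_continuous; [move=> ?; exact: cvg_id|exact: cst_continuous].
Qed.

Lemma lact_ract a b v : lact a (ract b v) = ract b (lact a v).
Proof.
have eltC g h w : lact (elt g) (ract (elt h) w) = ract (elt h) (lact (elt g) w).
  move: w; apply: meas_hom_ext.
  - exact: is_hom_comp (ract_hom _) (lact_hom _).
  - exact: is_hom_comp (lact_hom _) (ract_hom _).
  by move=> m k; rewrite ract_point !lact_point ract_point mulgA.
have eltC' g c w : lact (elt g) (ract c w) = ract c (lact (elt g) w).
  move: c; apply: cgr_ind.
  - apply: closed_eq_fun; last exact: ract_continuousl.
    exact: (continuous_comp1 (lact_hom _).2 (@ract_continuousl _)).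
  - by rewrite !ract0l (is_hom0 (lact_hom _)).
  - by move=> c c' Hc Hc'; rewrite !ractDl (is_homD _ _ (lact_hom _)) Hc Hc'.
  - move=> r h; rewrite cgr_monomE -!ractA !ract_scal (is_homZ _ _ (lact_hom _)).
    by rewrite eltC.
move: a; apply: cgr_ind.
- apply: closed_eq_fun; first exact: lact_continuousl.
  exact: (continuous_comp1 (ract_hom _).2 (@lact_continuousl _)).
- by rewrite !lact0l (is_hom0 (ract_hom _)).
- by move=> c c' Hc Hc'; rewrite !lactDl (is_homD _ _ (ract_hom _)) Hc Hc'.
- move=> r h; rewrite cgr_monomE -!lactA !lact_scal (is_homZ _ _ (ract_hom _)).
  by rewrite eltC'.
Qed.

Definition total_clopen : clopens G := exist _ _ (@clopenT G).
Definition mtot (v : V) : M := mval v total_clopen.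

Lemma mtot_hom : is_hom (mtot : V -> restr M).
Proof. exact: mval_hom. Qed.

Lemma mtot_point m g : mtot (point m g) = m.
Proof. by rewrite /mtot point_val asboolT. Qed.

Lemma mtot_lact a v : mtot (lact a v) = cgr_scal G (cgr_aug a) *: mtot v.
Proof.
move: a; apply: cgr_ind.
- apply: closed_eq_fun; first exact: (continuous_comp1 mtot_hom.2 (@lact_continuousl _)).
  apply: continuousZ; last exact: cst_continuous.
  exact: (continuous_comp1 (@cgr_scal_continuous R G) (@cgr_aug_continuous R G)).
- by rewrite lact0l cgr_aug0 rmorph0 scale0r; exact: (is_hom0 mtot_hom).
- move=> a b Ha Hb; rewrite lactDl cgr_augD rmorphD scalerDl -Ha -Hb.
  exact: (is_homD _ _ mtot_hom).
move=> r g; rewrite cgr_aug_monom cgr_monomE -lactA lact_scal.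
rewrite -[RHS]/(r *: (mtot v : restr M)) -(is_homZ _ _ mtot_hom) -!lact_scal.
move: v; apply: (meas_hom_ext (Z := restr M)).
- exact: is_hom_comp (is_hom_comp (lact_hom _) (lact_hom _)) mtot_hom.
- exact: is_hom_comp (lact_hom _) mtot_hom.
by move=> m h; rewrite lact_point !lact_scal !(is_homZ _ _ mtot_hom) !mtot_point.
Qed.

Lemma mtot_ract a v : mtot (ract a v) = a *: mtot v.
Proof.
move: a; apply: cgr_ind.
- apply: closed_eq_fun; first exact: (continuous_comp1 mtot_hom.2 (@ract_continuousl _)).
  by apply: continuousZ; [move=> ?; exact: cvg_id|exact: cst_continuous].
- by rewrite ract0l scale0r; exact: (is_hom0 mtot_hom).
- move=> a b Ha Hb; rewrite ractDl scalerDl -Ha -Hb.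
  exact: (is_homD _ _ mtot_hom).
move=> r g; rewrite cgr_monomE -ractA ract_scal -scalerA.
rewrite -[RHS]/(r *: (elt g *: mtot v : restr M)).
suff -> : elt g *: mtot v = mtot (ract (elt g) v) by exact: (is_homZ _ _ mtot_hom).
have hg := restr_scale_hom M (elt g).
move: v; apply: (meas_hom_ext (Z := restr M)).
- exact: is_hom_comp mtot_hom hg.
- exact: is_hom_comp (ract_hom _) mtot_hom.
by move=> m h; rewrite ract_point !mtot_point.
Qed.

Definition dirac (m : M) : V := point (m : restr M) 1%g.

Lemma dirac_hom : is_hom (dirac : restr M -> V).
Proof.
split; first exact: point_linear.
apply: (continuous_comp1 (f := fun m => (m, 1%g)) (@point_continuous R G M)).
by apply: pair_continuous; [move=> ?; exact: cvg_id|exact: cst_continuous].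
Qed.

Lemma mtot_dirac m : mtot (dirac m) = m.
Proof. exact: mtot_point. Qed.

Lemma lact_dirac g m : lact (elt g) (dirac m) = point m g.
Proof. by rewrite lact_point mulg1. Qed.

Lemma ract_dirac g m : ract (elt g) (dirac m) = lact (elt g^-1%g) (dirac (elt g *: m)).
Proof. by rewrite ract_point lact_dirac mul1g. Qed.

Lemma mval_ract h (v : V) (C D : clopens G) :
  (forall g, sval D g <-> sval C (g * h^-1)%g) ->
  mval (ract (elt h) v) C = elt h *: (mval v D : M).
Proof.
move=> CD.
have hg := restr_scale_hom M (elt h).
move: v; apply: (meas_hom_ext (Z := restr M)).
- exact: (is_hom_comp (ract_hom (elt h)) (@mval_hom R G M C)).
- exact: (is_hom_comp (@mval_hom R G M D) hg).
move=> m g; rewrite ract_point !point_val.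
have -> : `[< sval C (g * h^-1)%g >] = `[< sval D g >] by apply/asboolP/asboolP => /CD.
by case: ifP => _ //; rewrite scaler0.
Qed.

Lemma mval_partition n (c : G -> nat) (C : clopens G) (D : 'I_n -> clopens G) (v : V) :
  (forall g, sval C g -> (c g < n)%N) ->
  (forall l g, sval (D l) g <-> sval C g /\ c g = l) ->
  mval v C = \sum_l mval v (D l).
Proof.
move=> cn DC; have hS : is_hom (fun v : V => \sum_l mval v (D l)).
  split; last by apply: continuous_sum => l; exact: mval_continuous.
  by move=> a w w'; rewrite scaler_sumr -big_split; apply: eq_bigr => l _; exact: mval_linear.
move: v; apply: (meas_hom_ext (Z := restr M)) => //; first exact: mval_hom.
move=> m g; rewrite point_val; have [Cg|nCg] := pselect (sval C g).
  rewrite asboolT // (bigD1 (Ordinal (cn g Cg))) //= big1 => [|l ln].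
    by rewrite point_val asboolT ?addr0 //; apply/DC.
  rewrite point_val asboolF // => /DC [_ cl].
  by case/eqP: ln; apply: val_inj.
rewrite asboolF // big1 // => l _; rewrite point_val asboolF //.
by move=> /DC [].
Qed.

End MeasureActions.

(** * Measures invariant under right translation by one element *)

Lemma clopen_near (T : topologicalType) (C : set T) (t : T) :
  clopen C -> \forall s \near t, C s <-> C t.
Proof.
move=> [oC cC]; have [Ct|nCt] := pselect (C t).
  by apply: filterS (open_nbhs_nbhs (conj oC Ct)) => s Cs; tauto.
by apply: filterS (open_nbhs_nbhs (conj (closed_openC cC) nCt)) => s /= nCs; tauto.
Qed.

(** Adding [j] modulo [j * m] raises the quotient by [j] by one, except at the wrap-around, where m
    - 1 becomes 0; neither of these values interferes as l + 1 lies strictly between 0 and [m]. *)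
Lemma shift_quotient (j m a b l : nat) : (0 < j)%N -> (l.+1 < m)%N -> (b < j * m)%N ->
  a = ((b + j) %% (j * m))%N -> (a %/ j == l.+1)%N = (b %/ j == l)%N.
Proof.
move=> j0 lm bjm ->; have [lt|ge] := ltnP (b + j) (j * m).
  by rewrite modn_small // divnDr // divnn j0 addn1 eqSS.
have bj : (b %/ j = m.-1)%N.
  apply/eqP; rewrite eqn_leq -ltnS prednK; last exact: leq_ltn_trans lm.
  rewrite ltn_divLR // mulnC bjm leq_divRL //=.
  by case: m lm ge {bjm} => // m _; rewrite mulnS addnC leq_add2r mulnC.
rewrite bj; have -> : ((b + j) %% (j * m) = b + j - j * m)%N.
  by rewrite -{1}(subnK ge) modnDr modn_small //; move: bjm ge; lia.
rewrite divn_small; last by move: bjm ge; lia.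
by have /negPf -> : m.-1 != l by move: lm; lia.
Qed.

Lemma zhat_valD (a b : Zhat) (n : nat) :
  (il_val (a + b) n : 'Z_(n.+2)) =
  (((il_val a n : 'Z_(n.+2)) + (il_val b n : 'Z_(n.+2))) %% n.+2)%N :> nat.
Proof. by []. Qed.

Lemma zhat_val_nat (k n : nat) : (il_val (k%:R : Zhat) n : 'Z_(n.+2)) = (k %% n.+2)%N :> nat.
Proof. by rewrite zhat_natE val_Zp_nat. Qed.

Section RightInvariant.
Variables (G : profiniteGroupType) (M : profiniteModType (cgr Zhat G)).
Variables (theta : G -> Zhat) (x : G).
Hypotheses (ctheta : continuous theta) (thetaM : forall g h, theta (g * h)%g = theta g + theta h).
Hypothesis (thetax : theta x = 1).
Local Notation A := (cgr Zhat G).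
Local Notation elt := (@cgr_elt Zhat G).

(* Modulo an open submodule, the measure of a clopen set is a sum of m equal terms,
   for arbitrarily divisible m. *)
Lemma right_invariant_eq0 (v : meas M) : ract (elt x) v = v -> v = 0.
Proof.
move=> xv; apply: mval_eq => C; rewrite (is_hom0 (@mval_hom _ _ M C)).
apply: (open_submodule_eq (M := M) (@cgr_compact Zhat G)) => U oU; rewrite subr0.
have [N1 N1P] : exists N : open_normal G, forall n y, n \in N -> U (elt n *: y - y).
  have [||N NP] := @locally_constant_mod Zhat G (restr M) (restr M)
    (fun g y => elt g *: (y : M)) _ _ (restr_submodule U) oU.
  - exact: (@profinite_module_compact Zhat (restr M)).
  - apply: (continuousZ (M := M)); last exact: snd_continuous.
    exact: (continuous_comp1 (@cgr_elt_continuous Zhat G) (@fst_continuous G (restr M))).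
  exists N => n y nN; have := NP n nN 1%g y.
  by rewrite mul1g cgr_elt1 scale1r.
have [N2 N2P] : exists N : open_normal G, forall n g, n \in N ->
    sval C (g * n)%g <-> sval C g.
  have [||N NP] := @open_normal_invariant G (restr M) Prop (fun g _ => sval C g).
  - exact: (@profinite_module_compact Zhat (restr M)).
  - move=> z; have Cz : \forall w \near z, sval C w.1 <-> sval C z.1.
      exact: (@fst_continuous G (restr M) z _ (clopen_near z.1 (svalP C))).
    by apply: filterS Cz => w /= Cw; apply/propext.
  by exists N => n g nN; have := NP n nN g 1%g 0; rewrite !mulg1 => ->.
pose N := open_normal_meet N1 N2.
(* The power [h] = x^j lies in [N]: translating by it on the right preserves [C] and changes
   elements of [M] only modulo [U], while [theta] still moves, by [j]. *)
pose j := #[\pi_(qgroup N) x : qgroup N]%g.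
have piX k : \pi_(qgroup N) (x ^+ k)%g = (\pi_(qgroup N) x ^+ k)%g :> qgroup N.
  by elim: k => [//|k IH]; rewrite !expgS pi_qgroupM IH.
have j0 : (0 < j)%N by exact: order_gt0.
have xjN : (x ^+ j)%g \in N.
  have : \pi_(qgroup N) 1%g = \pi_(qgroup N) (x ^+ j)%g by rewrite piX expg_order.
  by move=> /qgroupP; rewrite invg1 mul1g.
set h := (x ^+ j)%g in xjN; have /andP[hN1 hN2] := xjN.
have hv : ract (elt h) v = v.
  rewrite /h; elim: (j) => [|k IH]; first by rewrite expg0 cgr_elt1 ract1.
  by rewrite expgS cgr_eltM -ractA IH.
have thX k : theta (x ^+ k)%g = k%:R.
  elim: k => [|k IH]; last by rewrite expgS thetaM IH thetax mulrS.
  by apply: (addIr (theta 1%g)); rewrite expg0 -thetaM mulg1 add0r.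
have [n0 n0P] : exists n, forall y, U (y *+ n.+2).
  have oI := annihilating_open (O := restr_submodule U) oU.
  have nI : nbhs (0 : Zhat) (annihilating (restr_submodule U)).
    by apply: open_nbhs_nbhs; split=> // y; rewrite scale0r; exact: submod0.
  have [n nP] := zhat_nbhs nI; exists n => y.
  have /nP /(_ y) : il_val (n.+2%:R : Zhat) n = il_val (0 : Zhat) n.
    by rewrite zhat_natE; exact: pchar_Zp.
  by rewrite scaler_nat.
set m := n0.+2 in n0P; pose n1 := (j * m).-2.
have n1E : n1.+2 = (j * m)%N by rewrite /n1 /m; case: (j) j0 => // k _; rewrite mulSn !addSn.
pose t g : nat := il_val (theta g) n1.
have tlt g : (t g < j * m)%N by rewrite -n1E /t; exact: ltn_ord.
have tnear g : \forall k \near g, t k = t g.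
  have tg : \forall k \near g, il_val (theta k) n1 = il_val (theta g) n1.
    exact: (@ctheta g _ (@il_near zhat_system (theta g) n1)).
  by apply: filterS tg => k /= tk; rewrite /t tk.
(* This colours G with [m] colours, through [theta] modulo [j * m]; right multiplication by [h]
   raises the colour by one, cyclically. The number [m] was chosen to kill [M] modulo [U]. *)
pose c g := (t g %/ j)%N.
have cm g : (c g < m)%N by rewrite /c ltn_divLR // mulnC.
pose Dset l := [set g | sval C g /\ c g = l].
have Dcl l : clopen (Dset l).
  have cc : clopen [set g | c g = l].
    split; first by rewrite openE => g /= <-; apply: filterS (tnear g) => k /= tk; rewrite /c tk.
    rewrite -[X in closed X]setCK; apply: open_closedC.
    by rewrite openE => g /= cg; apply: filterS (tnear g) => k /= tk; rewrite /c tk.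
  exact: clopenI (svalP C) cc.
pose D l : clopens G := exist _ _ (Dcl l).
have Dstep l : (l.+1 < m)%N -> mval v (D l) = elt h *: (mval v (D l.+1) : M).
  move=> lm; rewrite -{1}hv; apply: mval_ract => g /=.
  have Cg : sval C (g * h^-1)%g <-> sval C g by apply: N2P; exact: onormalI.
  have cg : (c g == l.+1) = (c (g * h^-1)%g == l).
    apply: (shift_quotient j0 lm (tlt _)).
    have thg : theta g = theta (g * h^-1)%g + (j%:R : Zhat) by rewrite -(thX j) -thetaM mulgVK.
    rewrite [X in X = _]/t thg.
    by rewrite zhat_valD zhat_val_nat -n1E modnDmr.
  rewrite /Dset /=; split=> -[Cgh /eqP cgh].
    by split; [apply/Cg|apply/eqP; rewrite -cg].
  by split; [apply/Cg|apply/eqP; rewrite cg].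
have D0 l : (l < m)%N -> U ((mval v (D l) : M) - mval v (D 0%N)).
  elim: l => [|l IH] lm; first by rewrite subrr; exact: submod0.
  apply: submodB_trans (IH (ltnW lm)); rewrite (Dstep l lm).
  by apply: submodBC; exact: N1P.
have DC g : sval C g -> (c g < m)%N by [].
have Dpart l g : sval (D (l : 'I_m)) g <-> sval C g /\ c g = l by [].
rewrite (mval_partition (D := fun l : 'I_m => D l) v DC Dpart).
have -> : (\sum_(l < m) mval v (D l) : M) =
    \sum_(l < m) ((mval v (D l) : M) - mval v (D 0%N)) + (mval v (D 0%N) : M) *+ m.
  by rewrite sumrB sumr_const card_ord subrK.
by apply: submodD; [apply: submod_sum => l _; exact: D0|exact: n0P].
Qed.

End RightInvariant.

Section FreeMeasures.
Variables (G : profiniteGroupType) (d : nat) (x : 'I_d -> G).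
Hypothesis freeG : free_pronilpotent_on x.
Local Notation A := (cgr Zhat G).
Local Notation nilG := (proj1 freeG).
Local Notation e := (blk Zhat nilG).
Local Notation elt := (@cgr_elt Zhat G).
Local Notation blk_invE := (blk_inv Zhat nilG).

(** A derivation with values in a trivial module is a homomorphism. *)
Lemma zhat_character : exists theta : G -> Zhat, [/\ continuous theta,
  forall g h, theta (g * h)%g = theta g + theta h & forall i, theta (x i) = 1].
Proof.
pose L : profiniteModType A := gmod (trivial_gaction Zhat G).
have trL (g : G) (y : L) : elt g *: y = y.
  exact: trivial_module_act (trivial_gmod Zhat G) g y.
have blkL (y : L) : e *: y = y by exact: blk_trivial.
have [D [[cD DM] Dx]] := derivation_exists blkL (fun _ => 1 : Zhat).
by exists D; split=> // g h; rewrite DM trL.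
Qed.

Lemma blk_aug : cgr_aug e = 1.
Proof.
pose L : profiniteModType A := gmod (trivial_gaction Zhat G).
have trL (g : G) (y : L) : elt g *: y = y.
  exact: trivial_module_act (trivial_gmod Zhat G) g y.
have := blk_trivial nilG ((1 : Zhat) : L) trL.
rewrite cgr_aug_act // (gmod_scal (s := trivial_gaction Zhat G)) => H.
by rewrite -[LHS]mulr1; exact: H.
Qed.

Variable M : profiniteModType A.
Local Notation V := (meas M).

Lemma lact_point_sum (n : nat) (a b : 'I_n -> A) (v : V) :
  \sum_i lact (a i) (lact (b i) v) = lact (\sum_i a i * b i) v.
Proof.
rewrite (big_morph (fun c => lact c v) (fun c c' => lactDl c c' v) (lact0l v)).
by apply: eq_bigr => i _; rewrite lactA.
Qed.

(* [F i] is the convolution with g |-> inv (delta (g^-1))_i, where delta is the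
   derivation with delta (x_i) = b_i, the i-th basis vector. *)
Lemma meas_contraction : exists F : 'I_d -> V -> V,
  [/\ forall i, is_hom (F i),
      forall v, \sum_i lact (elt (x i)^-1%g - 1) (F i v) =
        lact e v - lact e (dirac (mtot v))
    & forall i j v, F i (lact (elt (x j)^-1%g - 1) v) = if i == j then lact e v else 0].
Proof.
have [D [[cD DM] Dx Dbd]] := free_derivation freeG.
pose D' (i : 'I_d) (g : G) : A := cgr_inv (ecoord (D g^-1%g) i).
have cD' i : continuous (D' i).
  have cE := @ecoord_continuous _ _ _ (eC freeG) (cgr_reg Zhat G) d i.
  have cDV := continuous_comp1 cD (@profinite_invg_continuous G).
  exact: (continuous_comp1 (@cgr_inv_continuous _ _) (continuous_comp1 cE cDV)).
have FP i : exists F : G -> V -> V,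
    [/\ continuous (fun z : G * V => F z.1 z.2), forall y, linear (F y)
      & forall y m g, F y (point m g) = lact (D' i g) (dirac m)].
  apply: (@meas_integral Zhat G M G V (fun _ g m => lact (D' i g) (dirac m)) (@profinite_group_compact G)).
    have c1 : continuous (fun z : G * (G * restr M) => z.1) by exact: fst_continuous.
    have c2 : continuous (fun z : G * (G * restr M) => z.2) by exact: snd_continuous.
    have c22 := continuous_comp1 (@snd_continuous G (restr M)) c2.
    apply: (continuous_comp2 (@lact_continuous _ _ M)).
      exact: (continuous_comp1 (cD' i) c1).
    exact: (continuous_comp1 (@dirac_hom _ _ M).2 c22).
  move=> _ g r m m'; rewrite (@dirac_hom _ _ M).1.
  by have := (@lact_hom Zhat G M (D' i g)).1 r (dirac m) (dirac m').
pose F i := projT1 (cid (FP i)) 1%g.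
have Fpt i m g : F i (point m g) = lact (D' i g) (dirac m).
  by rewrite /F; case: (cid _) => /= F0 [_ _ ->].
have Fhom i : is_hom (F i).
  rewrite /F; case: (cid _) => /= F0 [cF lF _]; split; first exact: lF.
  apply: (continuous_comp1 (f := fun v => (1%g, v)) cF).
  by apply: pair_continuous; [exact: cst_continuous|move=> ?; exact: cvg_id].
exists F; split=> //.
- apply: meas_hom_ext.
  + split.
      move=> r v w; rewrite scaler_sumr -big_split; apply: eq_bigr => i _ /=.
      by rewrite (Fhom i).1 (lact_hom M _).1.
    by apply: continuous_sum => i; exact: (continuous_comp1 (lact_hom M _).2 (Fhom i).2).
  + apply: is_hom_sub; first exact: (lact_hom M).
    apply: is_hom_comp; last exact: (lact_hom M).
    exact: (is_hom_comp (@mtot_hom _ _ M) (@dirac_hom _ _ M)).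
  move=> m g; under eq_bigr do rewrite Fpt.
  rewrite lact_point_sum mtot_point.
  (* The Fox formula at [g^-1], reversed by the anti-automorphism of A: the factors x_i - 1 on the
     right become x_i^-1 - 1 on the left. *)
  have := congr1 (fun p : epow (eC freeG) (cgr_reg Zhat G) 1 => cgr_inv (ecoord p ord0 : A)) (Dbd g^-1%g).
  rewrite bdE cgr_inv_sum ecoordB ecoordZ ecoord_basis eqxx.
  rewrite -[elt g^-1%g *: (e : cgr_reg Zhat G)]/(elt g^-1%g * e).
  rewrite cgr_invB cgr_invM cgr_inv_elt invgK blk_invE => sumE.
  rewrite -lact_dirac lactA -lactBl -sumE; congr (lact _ _).
  apply: eq_bigr => i _; rewrite cgr_invM cgr_invB cgr_inv_elt.
  by congr ((_ - _) * _); rewrite -cgr_elt1 cgr_inv_elt invg1.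
- move=> i j; apply: meas_hom_ext.
  + exact: is_hom_comp (lact_hom M _) (Fhom i).
  + case: eqP => _; first exact: (lact_hom M).
    by split; [move=> r v w; rewrite scaler0 addr0|exact: cst_continuous].
  move=> m g; rewrite lactBl lact1 lact_point (is_homB _ _ (Fhom i)) !Fpt.
  rewrite /D' invgM invgK DM Dx ecoordD cgr_inv_additive lactDl addrC addKr.
  rewrite ecoordZ ecoord_basis eq_sym; case: eqP => _; last first.
    by rewrite scaler0 raddf0 lact0l.
  rewrite -[elt _ *: (e : cgr_reg Zhat G)]/(elt g^-1%g * e) cgr_invM blk_invE.
  by rewrite cgr_inv_elt invgK -lactA lact_dirac.
Qed.

End FreeMeasures.

(** * The dualizing module *)

Section TensorUniqueness.
Variables (R : profiniteComRingType) (M N T : profiniteModType R) (t : M -> N -> T).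

Lemma bilinear_homl n : is_bilinear t -> is_hom (t^~ n).
Proof.
move=> [tl _ tc]; split; first exact: tl.
apply: (continuous_comp1 (f := fun m => (m, n)) tc).
by apply: pair_continuous; [move=> ?; exact: cvg_id|exact: cst_continuous].
Qed.

Lemma bilinear_homr m : is_bilinear t -> is_hom (t m).
Proof.
move=> [_ tr tc]; split; first exact: tr.
apply: (continuous_comp1 (f := fun n => (m, n)) tc).
by apply: pair_continuous; [exact: cst_continuous|move=> ?; exact: cvg_id].
Qed.

Hypothesis tt : is_tensor t.

Lemma bilinear_comp (Z : profiniteModType R) (h : T -> Z) :
  is_hom h -> is_bilinear (fun m n => h (t m n)).
Proof.
have [[tl tr tc] _] := tt; move=> hh; split=> [n a p q|m a p q|].
- by have := tl n a p q => /= ->; exact: hh.1.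
- by have := tr m a p q => /= ->; exact: hh.1.
exact: (continuous_comp1 hh.2 tc).
Qed.

Lemma tensor_hom_ext (Z : profiniteModType R) (h h' : T -> Z) : is_hom h -> is_hom h' ->
  (forall m n, h (t m n) = h' (t m n)) -> forall y, h y = h' y.
Proof.
move=> hh hh' ht y; have [f [_ funiq]] := tt.2 Z _ (bilinear_comp hh).
by rewrite -(funiq h (conj hh (fun _ _ => erefl))) (funiq h' (conj hh' (fun m n => esym (ht m n)))).
Qed.

(** The projection to T/K and the zero map agree on pure tensors, hence coincide by uniqueness in
    the universal property. *)
Lemma tensor_generated (K : closed_submodule T) :
  (forall m n, K (t m n)) -> forall y, K y.
Proof.
move=> Kt y; apply/(cqpi0 (@profinite_ring_compact R)).
have hq : is_hom (cqpi (@profinite_ring_compact R) K).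
  by split; [exact: cqpi_is_linear|exact: cqpi_continuous].
have h0 : is_hom (fun _ : T => 0 : cquot K (@profinite_ring_compact R)).
  by split; [move=> a u v; rewrite scaler0 addr0|exact: cst_continuous].
apply: (tensor_hom_ext hq h0) => m n; exact/cqpi0.
Qed.

End TensorUniqueness.

Section Dualizing.
Variables (G : profiniteGroupType) (d : nat) (x : 'I_d -> G).
Hypothesis freeG : free_pronilpotent_on x.
Local Notation A := (cgr Zhat G).
Local Notation nilG := (proj1 freeG).
Local Notation e := (blk Zhat nilG).
Local Notation elt := (@cgr_elt Zhat G).
Local Notation P1 := (epow (eC freeG) (cgr_reg Zhat G) d).
Local Notation cA := (@cgr_compact Zhat G).
Local Notation cR := (@profinite_ring_compact Zhat).

Let relP (a : A) (i : 'I_d) :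
  e *: (e * a * (elt (x i)^-1%g - 1) : cgr_reg Zhat G) = e * a * (elt (x i)^-1%g - 1).
Proof. by rewrite -[LHS]/(e * (e * a * _)) !mulrA (eP freeG). Qed.

Definition dual_rel (a : A) : P1 := epow_mk (eC freeG) (relP a).

Let dual_rel_linear (a : A) (b c : cgr_reg Zhat G) :
  dual_rel (a *: b + c) = a *: dual_rel b + dual_rel c.
Proof.
apply: epow_eq => i; rewrite ecoordD ecoordZ !epow_mkE.
have H (b' c' z : A) : e * (a * b' + c') * z = a * (e * b' * z) + e * c' * z.
  by rewrite mulrDr mulrDl !mulrA (eC freeG a).
exact: H.
Qed.

Let rels (p : P1) : Prop := exists a, dual_rel a = p.
Let rels0 : rels 0.
Proof.
exists 0; have := dual_rel_linear 0 0 0; rewrite !scale0r add0r => ->.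
by rewrite add0r; apply: epow_eq => i; rewrite epow_mkE mulr0 mul0r.
Qed.
Let relsZD a p q : rels p -> rels q -> rels (a *: p + q).
Proof. by move=> [b <-] [c <-]; exists (a *: (b : cgr_reg Zhat G) + c); exact: dual_rel_linear. Qed.

Let rels_closed : closed (Submodule rels0 relsZD : set P1).
Proof.
apply: (@closed_image A P1 dual_rel (@cgr_compact Zhat G)).
  exact: profinite_module_hausdorff.
apply: epow_continuous => i.
apply: (continuousZ (M := cgr_reg Zhat G)); last exact: cst_continuous.
apply: (continuousZr (M := cgr_reg Zhat G)) => ?; exact: cvg_id.
Qed.

Definition dual_relations : closed_submodule P1 := ClosedSubmodule rels_closed.

(* The cokernel of Hom(P_0, A) -> Hom(P_1, A), for the resolution [freeres]. *)
Definition dual : profiniteModType A := cquot dual_relations cA.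

Definition dual_gen (i : 'I_d) : dual := cqpi cA dual_relations (ebasis (eP freeG) (eC freeG) i).

Lemma dual_gen_blk i : e *: dual_gen i = dual_gen i.
Proof. by rewrite /dual_gen -linearZ epow_fix. Qed.

Lemma dual_relation : \sum_i (elt (x i)^-1%g - 1) *: dual_gen i = 0.
Proof.
rewrite /dual_gen; under eq_bigr do rewrite -linearZ.
rewrite -raddf_sum; apply/(cqpi0 cA); exists 1; apply: epow_eq => j.
rewrite ecoord_sum (bigD1 j) //= big1 => [|i /negPf ij].
  by rewrite addr0 ecoordZ ecoord_basis eqxx epow_mkE mulr1; exact: eC.
by rewrite ecoordZ ecoord_basis ij scaler0.
Qed.

Lemma dual_decompose (c : dual) : exists a : 'I_d -> A, c = \sum_i a i *: dual_gen i.
Proof.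
have [p ->] := cqpi_surj c; exists (fun i => ecoord p i).
rewrite [p in LHS](epow_basis (eP freeG)) raddf_sum; apply: eq_bigr => i _.
by rewrite /= linearZ.
Qed.

Section TensorWithDual.
Variables (M T : profiniteModType A) (t : M -> dual -> T).
Hypothesis tt : is_diag_tensor t.
Local Notation V := (meas M).

Let tr : is_bilinear (t : restr M -> restr dual -> restr T).
Proof. by have [[]] := tt. Qed.

Let t_continuous : continuous (fun z : M * dual => t z.1 z.2).
Proof. by have [] := tr. Qed.

Lemma tensor_homl c : is_hom (t^~ c : restr M -> restr T).
Proof. exact: bilinear_homl tr. Qed.

Lemma tensor_homr m : is_hom (t m : restr dual -> restr T).
Proof. exact: bilinear_homr tr. Qed.

Lemma tensor_elt g m c : elt g *: t m c = t (elt g *: m) (elt g *: c).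
Proof. by have [_ H] := tt; exact: H. Qed.

Lemma tau_exists : exists F : dual -> V -> restr T,
  [/\ continuous (fun z : dual * V => F z.1 z.2), forall c, linear (F c)
    & forall c m g, F c (point m g) = elt g *: t m c].
Proof.
apply: (@meas_integral Zhat G M dual (restr T) (fun c g m => elt g *: t m c)).
- exact: profinite_module_compact.
- have c1 : continuous (fun z : G * (dual * restr M) => z.1) by exact: fst_continuous.
  have c2 : continuous (fun z : G * (dual * restr M) => z.2) by exact: snd_continuous.
  have c21 := continuous_comp1 (@fst_continuous dual (restr M)) c2.
  have c22 := continuous_comp1 (@snd_continuous dual (restr M)) c2.
  apply: (continuousZ (M := T)); first exact: (continuous_comp1 (@cgr_elt_continuous Zhat G) c1).
  exact: (continuous_comp2 (h := t) t_continuous c22 c21).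
by move=> c g; have [] := is_hom_comp (tensor_homl c) (restr_scale_hom T (elt g)).
Qed.

Definition tau : dual -> V -> T := projT1 (cid tau_exists).

Let tauP : [/\ continuous (fun z : dual * V => tau z.1 z.2), forall c, linear (tau c : V -> restr T)
    & forall c m g, tau c (point m g) = elt g *: t m c].
Proof. exact: (projT2 (cid tau_exists)). Qed.

Lemma tau_point c m g : tau c (point m g) = elt g *: t m c.
Proof. by have [_ _ H] := tauP; exact: H. Qed.

Lemma tau_dirac c m : tau c (dirac m) = t m c.
Proof. by rewrite tau_point cgr_elt1 scale1r. Qed.

Lemma tau_hom c : is_hom (tau c : V -> restr T).
Proof.
have [cF lF _] := tauP; split; first exact: lF.
apply: (continuous_comp1 (f := fun v => (c, v)) cF).
by apply: pair_continuous; [exact: cst_continuous|move=> ?; exact: cvg_id].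
Qed.

Lemma tau_continuousl (v : V) : continuous (fun c => tau c v).
Proof.
have [cF _ _] := tauP; apply: (continuous_comp1 (f := fun c => (c, v)) cF).
by apply: pair_continuous; [move=> ?; exact: cvg_id|exact: cst_continuous].
Qed.

Lemma tauDl c c' v : tau (c + c') v = tau c v + tau c' v.
Proof.
move: v; apply: (meas_hom_ext (Z := restr T)) (tau_hom _) (is_hom_add (tau_hom c) (tau_hom c')) _.
move=> m g; have H : t m (c + c') = t m c + t m c' := is_homD _ _ (tensor_homr m).
by rewrite !tau_point H; exact: (@scalerDr A T).
Qed.

Lemma tau0l v : tau 0 v = 0.
Proof. by apply: (addIr (tau 0 v)); rewrite -tauDl !add0r. Qed.

Lemma tauZl r c v : tau (cgr_scal G r *: c) v = cgr_scal G r *: tau c v.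
Proof.
move: v; apply: (meas_hom_ext (Z := restr T)) (tau_hom _) _ _.
  exact: is_hom_comp (tau_hom c) (restr_scale_hom T _).
move=> m g; have H : t m (cgr_scal G r *: c) = cgr_scal G r *: t m c := is_homZ r (c : restr dual) (tensor_homr m).
by rewrite !tau_point H !scalerA cgr_scal_central.
Qed.

Lemma tau_lact c a v : tau c (lact a v) = a *: tau c v.
Proof.
move: a; apply: cgr_ind.
- apply: closed_eq_fun; first exact: (continuous_comp1 (tau_hom c).2 (@lact_continuousl _ _ M v)).
  by apply: continuousZ; [move=> ?; exact: cvg_id|exact: cst_continuous].
- by rewrite lact0l scale0r; exact: (is_hom0 (tau_hom c)).
- move=> a b Ha Hb; rewrite lactDl scalerDl -Ha -Hb; exact: (is_homD _ _ (tau_hom c)).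
move=> r g; rewrite cgr_monomE -lactA lact_scal -scalerA.
rewrite [LHS](is_homZ r _ (tau_hom c)) -[LHS]/(cgr_scal G r *: tau c _); congr (_ *: _).
move: v; apply: (meas_hom_ext (Z := restr T)).
- exact: is_hom_comp (lact_hom M _) (tau_hom c).
- exact: is_hom_comp (tau_hom c) (restr_scale_hom T _).
by move=> m h; rewrite lact_point !tau_point cgr_eltM scalerA.
Qed.

Lemma tau_ract c a v : tau c (ract a v) = tau (cgr_inv a *: c) v.
Proof.
move: a; apply: cgr_ind.
- apply: closed_eq_fun; first exact: (continuous_comp1 (tau_hom c).2 (@ract_continuousl _ _ M v)).
  apply: (continuous_comp1 (f := fun a => cgr_inv a *: c) (@tau_continuousl v)).
  by apply: continuousZ; [exact: cgr_inv_continuous|exact: cst_continuous].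
- by rewrite ract0l raddf0 scale0r tau0l; exact: (is_hom0 (tau_hom c)).
- move=> a b Ha Hb; rewrite ractDl cgr_inv_additive scalerDl tauDl -Ha -Hb.
  exact: (is_homD _ _ (tau_hom c)).
move=> r g; rewrite cgr_inv_monom !cgr_monomE -ractA ract_scal -scalerA tauZl.
rewrite [LHS](is_homZ r _ (tau_hom c)) -[LHS]/(cgr_scal G r *: tau c _); congr (_ *: _).
move: v; apply: (meas_hom_ext (Z := restr T)).
- exact: is_hom_comp (ract_hom M _) (tau_hom c).
- exact: tau_hom.
move=> m h; rewrite ract_point !tau_point cgr_eltM -scalerA tensor_elt.
by rewrite scalerA -cgr_eltM mulVg cgr_elt1 scale1r.
Qed.

Lemma tau_blk i v : tau (dual_gen i) (ract e v) = tau (dual_gen i) v.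
Proof. by rewrite tau_ract blk_inv dual_gen_blk. Qed.

(** This is [dual_relation] carried over to measures by [tau_ract]. Up to e there are no other
    relations, by [tau_kernel]. *)
Lemma tau_relation v : \sum_i tau (dual_gen i) (ract (elt (x i)) v - v) = 0.
Proof.
transitivity (\sum_i tau ((elt (x i)^-1%g - 1) *: dual_gen i) v).
  apply: eq_bigr => i _; rewrite [LHS](is_homB _ _ (tau_hom _)) tau_ract cgr_inv_elt.
  rewrite scalerBl scale1r; apply: (addIr (tau (dual_gen i) v)).
  by rewrite -tauDl !subrK.
rewrite -(big_morph (fun c => tau c v) (fun c c' => tauDl c c' v) (tau0l v)).
by rewrite dual_relation tau0l.
Qed.

Lemma tau_surjective (y : T) : exists v : 'I_d -> V, y = \sum_i tau (dual_gen i) (v i).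
Proof.
pose S (v : power 'I_d V) : restr T := \sum_i tau (dual_gen i) (v i).
have hS : is_hom S.
  by apply: is_hom_sum => i; exact: is_hom_comp (power_proj_hom V i) (tau_hom _).
pose im (y : restr T) := exists v, S v = y.
have im0 : im 0 by exists 0; exact: is_hom0.
have imZD r y1 y2 : im y1 -> im y2 -> im (r *: y1 + y2).
  by move=> [v <-] [w <-]; exists (r *: v + w); exact: hS.1.
have cim : closed (Submodule im0 imZD : set (restr T)).
  apply: closed_image; [exact: profinite_module_compact|exact: profinite_module_hausdorff|].
  exact: hS.2.
have [v <-] : im y; last by exists v.
apply: (@tensor_generated _ _ _ _ _ tt.1 (ClosedSubmodule cim)) => m c.
have [a ->] := dual_decompose c.
exists (fun i => ract (cgr_inv (a i)) (dirac m)); rewrite /S.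
have hm := tensor_homr m.
transitivity (\sum_i t m (a i *: dual_gen i)).
  by apply: eq_bigr => i _; rewrite tau_ract cgr_invK tau_dirac.
exact/esym/(big_morph (t m : restr dual -> restr T) (fun c c' => is_homD c c' hm) (is_hom0 hm)).
Qed.

End TensorWithDual.
End Dualizing.

(** * The kernel of the presentation of M (x) D by measures *)

Section TensorKernel.
Variables (G : profiniteGroupType) (d : nat) (x : 'I_d -> G).
Hypothesis freeG : free_pronilpotent_on x.
Local Notation A := (cgr Zhat G).
Local Notation nilG := (proj1 freeG).
Local Notation e := (blk Zhat nilG).
Local Notation elt := (@cgr_elt Zhat G).
Local Notation D := (dual freeG).
Local Notation gen := (dual_gen freeG).
Local Notation P1 := (epow (eC freeG) (cgr_reg Zhat G) d).
Local Notation cA := (@cgr_compact Zhat G).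
Local Notation cR := (@profinite_ring_compact Zhat).

Variables (M T : profiniteModType A) (t : M -> D -> T).
Hypothesis tt : is_diag_tensor t.
Local Notation V := (meas M).
Local Notation W := (power 'I_d V).
Local Notation tau := (tau tt).

Let ract_e (p : W) : W := fun i => ract e (p i).
Let ract_shift (u : V) : W := fun i => ract e (ract (elt (x i)) u - u).

Let ract_e_hom : is_hom ract_e.
Proof. by apply: power_hom => i; exact: is_hom_comp (power_proj_hom V i) (ract_hom M e). Qed.

Let ract_shift_hom : is_hom ract_shift.
Proof.
apply: power_hom => i; apply: is_hom_comp (ract_hom M e).
exact: is_hom_sub (ract_hom M _) (is_hom_id _).
Qed.

(** The asserted kernel. It is compared after applying [ract e] because e fixes the generators of D,
    so that [tau] at a generator cannot see the complementary summand ([tau_blk]). *)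
Let kerv (p : W) : Prop := exists u, ract_shift u = ract_e p.

Let kerv0 : kerv 0.
Proof. by exists 0; rewrite (is_hom0 ract_e_hom) (is_hom0 ract_shift_hom). Qed.

Let kervZD r p q : kerv p -> kerv q -> kerv (r *: p + q).
Proof.
move=> [u up] [v vq]; exists (r *: u + v).
by rewrite ract_shift_hom.1 ract_e_hom.1 up vq.
Qed.

Let kerv_closed : closed (Submodule kerv0 kervZD : set W).
Proof.
apply: (@closed_preimage W W ract_e [set q | exists u, ract_shift u = q]).
  exact: ract_e_hom.2.
apply: closed_image; [exact: profinite_module_compact|exact: profinite_module_hausdorff|].
exact: ract_shift_hom.2.
Qed.

Local Notation K := (ClosedSubmodule kerv_closed).
Local Notation Z := (cquot K cR).
Local Notation pr := (cqpi cR K).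

(** A lift to V^d of the tensor of [m] with the class of [p]: by [tau_ract], the i-th component is
    sent to m (x) p_i b_i. *)
Let cocycle (m : M) (p : P1) : W := fun i => ract (cgr_inv (ecoord p i : A)) (dirac m).

Let cocycle_continuous : continuous (fun z : M * P1 => cocycle z.1 z.2).
Proof.
apply: power_continuous => i.
apply: (continuous_comp2 (@ract_continuous _ _ M)).
  apply: (continuous_comp1 (@cgr_inv_continuous _ _)).
  exact: (continuous_comp1 (@ecoord_continuous _ _ _ (eC freeG) (cgr_reg Zhat G) d i) (@snd_continuous M P1)).
exact: (continuous_comp1 (@dirac_hom _ _ M).2 (@fst_continuous M P1)).
Qed.

Let cocycleB m p q : cocycle m (p - q) = cocycle m p - cocycle m q.
Proof.
by apply/funext => i; rewrite /cocycle ecoordB cgr_invB ractBl.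
Qed.

Let cocycle_rel m a : kerv (cocycle m (dual_rel freeG a)).
Proof.
exists (ract (cgr_inv a) (dirac m)); apply/funext => i.
rewrite /ract_e /cocycle /ract_shift epow_mkE !cgr_invM cgr_invB cgr_inv_elt invgK.
rewrite -cgr_elt1 cgr_inv_elt invg1 cgr_elt1 blk_inv.
set a' := cgr_inv a; set y := elt (x i) - 1.
have ey : e * (y * (a' * e)) = e * (y * a').
  by rewrite [y * _]mulrA -(eC freeG (y * a')) mulrA (eP freeG).
rewrite [RHS]ractA ey -!ractA; congr (ract e _).
by rewrite /y ractBl ract1.
Qed.

Let rep (c : D) : P1 := projT1 (cid (cqpi_surj c)).
Let repK c : cqpi cA (dual_relations freeG) (rep c) = c.
Proof. exact/esym/(projT2 (cid (cqpi_surj c))). Qed.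

Let form (m : M) (c : D) : Z := pr (cocycle m (rep c)).

Let form_pi m p : form m (cqpi cA (dual_relations freeG) p) = pr (cocycle m p).
Proof.
apply/cqpi_eq; rewrite -cocycleB.
have /cqpi_eq [a <-] := repK (cqpi cA (dual_relations freeG) p).
exact: cocycle_rel.
Qed.

Let form_bilinear : is_bilinear (form : restr M -> restr D -> Z).
Proof.
split.
- move=> c r m m'; rewrite /form -linearP; congr (pr _); apply/funext => i.
  rewrite /cocycle (@dirac_hom _ _ M).1.
  exact: (ract_hom M _).1.
- move=> m r c c'; rewrite -(repK c) -(repK c').
  set p := rep c; set q := rep c'.
  rewrite -[r *: _ + _]/(cgr_scal G r *: cqpi cA (dual_relations freeG) p + cqpi cA (dual_relations freeG) q).
  rewrite -linearP !form_pi -linearP; congr (pr _); apply/funext => i.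
  rewrite /cocycle ecoordD ecoordZ cgr_inv_additive ractDl.
  rewrite -[cgr_scal G r *: _]/(cgr_scal G r * (ecoord p i : A)) cgr_invM cgr_inv_scal.
  by rewrite -cgr_scal_central -ractA ract_scal.
- apply: (cquot_continuous2 (f := fun (m : restr M) (c : D) => form m c)).
  rewrite (_ : (fun _ => _) = fun z : restr M * P1 => pr (cocycle z.1 z.2)).
    exact: (continuous_comp1 (@cqpi_continuous _ _ _ K) cocycle_continuous).
  by apply/funext => z; rewrite form_pi.
Qed.

Let single (i : 'I_d) (v : V) : W := fun j => if i == j then v else 0.

Let single_hom i : is_hom (single i).
Proof.
apply: power_hom => j; rewrite /single; case: eqP => _; first exact: is_hom_id.
by split; [move=> r u v; rewrite scaler0 addr0|exact: cst_continuous].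
Qed.

(* The bilinear form [form], with values in the quotient of V^d by the asserted kernel,
   factors through the tensor product and thus detects the kernel. *)
Lemma tau_kernel (v : 'I_d -> V) : \sum_i tau (gen i) (v i) = 0 ->
  exists u, forall i, ract e (v i) = ract e (ract (elt (x i)) u - u).
Proof.
have [h [[hh ht] _]] := tt.1.2 Z _ form_bilinear => v0.
have htau i w : h (tau (gen i) w) = pr (single i w).
  have hpr : is_hom pr by split; [exact: cqpi_is_linear|exact: cqpi_continuous].
  move: w; apply: (meas_hom_ext (Z := Z)).
  - exact: is_hom_comp (tau_hom tt _) hh.
  - exact: is_hom_comp (single_hom i) hpr.
  move=> m g; rewrite tau_point (tensor_elt tt) ht /dual_gen -linearZ form_pi.
  (* Both sides lift g (m (x) b_i) and coincide after applying [ract e], so 0 serves as the witness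
     in [kerv]. *)
  apply/cqpi_eq; exists 0; rewrite (is_hom0 ract_shift_hom); apply/esym/funext => j.
  rewrite /ract_e -[(_ - _) j]/(cocycle _ _ j - single i (point m g) j) /cocycle /single.
  rewrite ecoordZ ecoord_basis eq_sym; case: eqP => _; last first.
    by rewrite scaler0 raddf0 ract0l subr0; exact: (is_hom0 (ract_hom M _)).
  rewrite -[elt g *: (e : cgr_reg Zhat G)]/(elt g * e) cgr_invM blk_inv cgr_inv_elt -ractA.
  rewrite ract_point mul1g invgK scalerA -cgr_eltM mulVg cgr_elt1 scale1r.
  by rewrite (is_homB _ _ (ract_hom M _)) ractA (eP freeG); exact: subrr.
have : pr v = 0.
  rewrite -(is_hom0 hh) -v0 (big_morph h (fun a b => is_homD a b hh) (is_hom0 hh)).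
  under eq_bigr do rewrite htau.
  rewrite -raddf_sum; congr (pr _); apply/funext => j.
  rewrite fct_sumE (bigD1 j) //= big1 ?addr0 => [|i /negPf ij]; rewrite /single ?eqxx //.
  by rewrite ij.
move=> /cqpi0 [u uv]; exists u => i.
by have /(congr1 (fun p : W => p i)) := uv.
Qed.
End TensorKernel.

(** * Cycles and boundaries with values in M (x) D *)

Section DualityElements.
Variables (G : profiniteGroupType) (d : nat) (x : 'I_d -> G).
Hypothesis freeG : free_pronilpotent_on x.
Local Notation A := (cgr Zhat G).
Local Notation nilG := (proj1 freeG).
Local Notation e := (blk Zhat nilG).
Local Notation elt := (@cgr_elt Zhat G).
Local Notation D := (dual freeG).
Local Notation gen := (dual_gen freeG).

(** [invariant_generators] asks e to act as 1 on the whole module, whereas here only [m] is fixed;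
    it is applied to eM, realized as [epow] of rank 1. *)
Lemma blk_invariant (M : profiniteModType A) (m : M) : e *: m = m ->
  (forall i, elt (x i) *: m = m) -> forall g, elt g *: m = m.
Proof.
move=> em xm g.
pose y : epow (eC freeG) M 1 := epow_mk (eC freeG) (fun=> em).
have ey i : elt (x i) *: y = y by apply: epow_eq => j; rewrite ecoordZ epow_mkE; exact: xm.
have eE (z : epow (eC freeG) M 1) : e *: z = z by exact: epow_fix.
have := invariant_generators eE ey g.
by move/(congr1 (fun z => ecoord z ord0)); rewrite ecoordZ epow_mkE.
Qed.

Variables (M T : profiniteModType A) (t : M -> D -> T).
Hypothesis tt : is_diag_tensor t.
Local Notation V := (meas M).
Local Notation tau := (tau tt).

Lemma tensor_invariant_act m a c : (forall g, elt g *: m = m) -> a *: t m c = t m (a *: c).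
Proof.
move=> gm; have hm := tensor_homr tt m; move: a; apply: cgr_ind.
- apply: closed_eq_fun.
    by apply: continuousZ; [move=> ?; exact: cvg_id|exact: cst_continuous].
  apply: (continuous_comp1 hm.2).
  by apply: (continuousZ (M := D)); [move=> ?; exact: cvg_id|exact: cst_continuous].
- by rewrite !scale0r; exact/esym/(is_hom0 hm).
- by move=> a b Ha Hb; rewrite !scalerDl Ha Hb; exact/esym/(is_homD _ _ hm).
move=> r g; rewrite cgr_monomE -!scalerA (tensor_elt tt) gm.
exact/esym/(is_homZ r (elt g *: c : restr D) hm).
Qed.

Let tau_sum (I : finType) c (v : I -> V) : tau c (\sum_i v i) = \sum_i tau c (v i).
Proof. exact: (big_morph _ (fun a b => is_homD a b (tau_hom tt c)) (is_hom0 (tau_hom tt c))). Qed.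
Let tauB c (v w : V) : tau c (v - w) = tau c v - tau c w.
Proof. exact: (is_homB _ _ (tau_hom tt c)). Qed.
Let lact_sum (I : finType) a (v : I -> V) : lact a (\sum_i v i) = \sum_i lact a (v i).
Proof. exact: (big_morph _ (fun p q => is_homD p q (lact_hom M a)) (is_hom0 (lact_hom M a))). Qed.
Let ract_sum (I : finType) a (v : I -> V) : ract a (\sum_i v i) = \sum_i ract a (v i).
Proof. exact: (big_morph _ (fun p q => is_homD p q (ract_hom M a)) (is_hom0 (ract_hom M a))). Qed.
Let mtot_sum (I : finType) (v : I -> V) : mtot (\sum_i v i) = \sum_i (mtot (v i) : restr M) :> restr M.
Proof.
exact: (big_morph (@mtot _ _ M : V -> restr M) (fun p q => is_homD p q (@mtot_hom _ _ M)) (is_hom0 (@mtot_hom _ _ M))).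
Qed.
Let mtotB (v w : V) : mtot (v - w) = mtot v - mtot w.
Proof. exact: (is_homB _ _ (@mtot_hom _ _ M)). Qed.
Let lactB a (v w : V) : lact a (v - w) = lact a v - lact a w.
Proof. exact: (is_homB _ _ (lact_hom M a)). Qed.
Let ractB a (v w : V) : ract a (v - w) = ract a v - ract a w.
Proof. exact: (is_homB _ _ (ract_hom M a)). Qed.

Let mtot_aug0 i (v : V) : mtot (lact (elt (x i)^-1%g - 1) v) = 0.
Proof.
have aug1 g : cgr_aug (elt g) = 1 by exact: cgr_aug_monom.
have H g : mtot (lact (elt g) v) = mtot v.
  by rewrite mtot_lact aug1 rmorph1 scale1r.
by rewrite lactBl mtotB H -cgr_elt1 H subrr.
Qed.

(** Surjectivity of H^0 -> H_1. Lift the [z j] to measures [w0 j i]. The cycle condition puts their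
    left boundaries [c i] into the kernel of the presentation, so they are the right differences of
    one measure [u], and [m] is its total mass. The contraction then lets [w0] be corrected to
    multiples of the point mass of [m] on the diagonal. *)
Lemma tensor_dual_cycles (z : 'I_d -> T) : (forall j, e *: z j = z j) ->
  \sum_j (elt (x j)^-1%g - 1) *: z j = 0 ->
  exists m, [/\ e *: m = m, forall i, elt (x i) *: m = m & forall j, z j = t m (gen j)].
Proof.
move=> ez z0.
have [w wP] := choice (fun j => tau_surjective tt (z j)).
have e2 a : e * (e * a) = e * a by rewrite mulrA (eP freeG).
pose w0 j i := lact e (ract e (w j i)).
have w0P j : z j = \sum_i tau (gen i) (w0 j i).
  rewrite -ez wP scaler_sumr; apply: eq_bigr => i _.
  by rewrite /w0 tau_lact tau_blk.
have lw0 j i : lact e (w0 j i) = w0 j i by rewrite /w0 lactA (eP freeG).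
have rw0 j i : ract e (w0 j i) = w0 j i by rewrite /w0 -lact_ract ractA (eP freeG).
pose c i := \sum_j lact (elt (x j)^-1%g - 1) (w0 j i).
have lc i : lact e (c i) = c i.
  rewrite /c lact_sum; apply: eq_bigr => j _.
  by rewrite lactA (eC freeG) -lactA lw0.
have rc i : ract e (c i) = c i.
  by rewrite /c ract_sum; apply: eq_bigr => j _; rewrite -lact_ract rw0.
have c0 : \sum_i tau (gen i) (c i) = 0.
  rewrite -[RHS]z0 /c; under eq_bigr do rewrite tau_sum.
  rewrite exchange_big; apply: eq_bigr => j _.
  by rewrite w0P scaler_sumr; apply: eq_bigr => i _; rewrite tau_lact.
have [u0 u0P] := tau_kernel c0.
pose u := lact e (ract e u0).
have lu : lact e u = u by rewrite /u lactA (eP freeG).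
have ru : ract e u = u by rewrite /u -lact_ract ractA (eP freeG).
have uP i : c i = ract (elt (x i)) u - u.
  rewrite -lc -rc u0P lact_ract lactB ractB lact_ract !ractA (eC freeG) -ractA -/u.
  by rewrite -lact_ract.
have [F [hF Fsum Fd]] := meas_contraction freeG M.
pose m := mtot u.
(* Left differences have total mass 0, so by [uP] the right differences of [u] do too; that is
   invariance of [m]. *)
have xm i : elt (x i) *: m = m.
  apply/subr0_eq; rewrite /m -mtot_ract -mtotB -uP /c mtot_sum big1 // => j _.
  exact: mtot_aug0.
have em : e *: m = m by rewrite /m -mtot_ract ru.
exists m; split=> // j.
pose dm := lact e (ract e (dirac m)).
(* Subtracting the right differences of these measures leaves every [z k] unchanged, by
   [tau_relation], and replaces [u] by [dm] in the boundary. As [m] is invariant, the right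
   difference of [dm] by x_i equals its left difference by x_i^-1 ([rd]). *)
pose w' k := ract e (F k u).
pose w'' k i := w0 k i - (ract (elt (x i)) (w' k) - w' k).
have rd i : ract (elt (x i)) dm - dm = lact (elt (x i)^-1%g - 1) dm.
  rewrite lactBl lact1; congr (_ - _).
  rewrite /dm -lact_ract ractA -(eC freeG) -ractA ract_dirac xm.
  by rewrite -!lact_ract !lactA (eC freeG).
have w''P i : \sum_k lact (elt (x k)^-1%g - 1) (w'' k i) = lact (elt (x i)^-1%g - 1) dm.
  transitivity (c i - (ract (elt (x i) - 1) (ract e (\sum_k lact (elt (x k)^-1%g - 1) (F k u))))).
    rewrite /c !ract_sum -sumrB; apply: eq_bigr => k _.
    by rewrite lactB -!lact_ract ractBl ract1.
  have -> : ract e (\sum_k lact (elt (x k)^-1%g - 1) (F k u)) = u - dm.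
    by rewrite Fsum lu ractB ru -lact_ract.
  rewrite uP ractBl ract1 (ractB _ u dm) -rd.
  set a := ract _ u; set b := ract _ dm.
  by rewrite !opprB addrA [a - u + _]addrA subrK addrC addrA subrK.
have lw'' k i : lact e (w'' k i) = if k == i then dm else 0.
  have := congr1 (F k) (w''P i); rewrite Fd.
  rewrite (big_morph _ (fun p q => is_homD p q (hF k)) (is_hom0 (hF k))) (bigD1 k) //= Fd eqxx.
  rewrite big1 ?addr0 => [->|l /negPf lk]; last by rewrite Fd eq_sym lk.
  by case: eqP => // _; rewrite /dm lactA (eP freeG).
rewrite -ez w0P.
transitivity (e *: \sum_i tau (gen i) (w'' j i)).
  congr (e *: _); apply/esym; under eq_bigr do rewrite tauB.
  by rewrite sumrB tau_relation subr0.
rewrite scaler_sumr (bigD1 j) //= big1 ?addr0 => [|i /negPf ij]; last first.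
  by rewrite -tau_lact lw'' eq_sym ij; exact: (is_hom0 (tau_hom tt _)).
rewrite -tau_lact lw'' eqxx /dm tau_lact tau_blk tau_dirac.
by rewrite tensor_invariant_act ?dual_gen_blk //; exact: blk_invariant.
Qed.

(** If every m (x) b_j vanishes, [tau_kernel] gives [u j] whose right difference by x_i is, up to e,
    the point mass of [m] when i = j and 0 otherwise. The left boundary [v] of these has the same
    right difference by x_i0 as the point mass of [m], so the two agree up to e by
    [right_invariant_eq0]. But [v] has total mass 0. *)
Lemma tensor_dual_injective (i0 : 'I_d) (m : M) : e *: m = m -> (forall i, elt (x i) *: m = m) ->
  (forall j, t m (gen j) = 0) -> m = 0.
Proof.
move=> em xm tm0.
have /choice [u uP] j : exists u, forall i,
    ract e (if i == j then dirac m else 0) = ract e (ract (elt (x i)) u - u).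
  apply: (@tau_kernel _ _ _ _ _ _ _ tt (fun i => if i == j then dirac m else 0)).
  rewrite (bigD1 j) //= eqxx tau_dirac tm0 big1 ?addr0 // => i /negPf ->.
  exact: (is_hom0 (tau_hom tt _)).
pose v := \sum_j lact (elt (x j)^-1%g - 1) (ract e (u j)).
pose y := v - ract e (dirac m).
have y0 : y = 0.
  have [theta [ct tM tx]] := zhat_character freeG.
  apply: (right_invariant_eq0 ct tM (tx i0)); apply/subr0_eq.
  pose i := i0; rewrite -/i.
  have -> : ract (elt (x i)) y - y = ract (elt (x i) - 1) y by rewrite ractBl ract1.
  rewrite /y ractB /v ract_sum (bigD1 i) //= big1 => [|j /negPf ji]; last first.
    rewrite -lact_ract ractA -(eC freeG) -ractA ractBl ract1 -uP eq_sym ji.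
    by rewrite (is_hom0 (ract_hom M _)); exact: (is_hom0 (lact_hom M _)).
  rewrite addr0 -lact_ract ractA -(eC freeG) -ractA ractBl ract1 -uP eqxx.
  rewrite ractA -(eC freeG) -ractA ractBl ract1 ract_dirac xm ractB.
  by rewrite lactBl lact1 lact_ract subrr.
rewrite -em -[m in LHS]mtot_dirac -mtot_ract.
have -> : ract e (dirac m) = v by apply/esym/subr0_eq.
by rewrite /v mtot_sum big1 // => j _; exact: mtot_aug0.
Qed.

(** Surjectivity of H^1 -> H_0: by the contraction, a measure differs from the point mass of its
    total mass by left differences, up to e, and left differences become boundaries. *)
Lemma tensor_dual_generated (y : T) : e *: y = y -> exists (m : 'I_d -> M) (z : 'I_d -> T),
  [/\ forall i, e *: m i = m i, forall i, e *: z i = z i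
    & e *: (\sum_i t (m i) (gen i)) - y = \sum_i (elt (x i)^-1%g - 1) *: z i].
Proof.
move=> ey; have [v vP] := tau_surjective tt y.
have [F [hF Fsum Fd]] := meas_contraction freeG M.
have {vP} vP : y = \sum_j tau (gen j) (ract e (v j)) by rewrite vP; apply: eq_bigr => j _; rewrite tau_blk.
exists (fun j => mtot (ract e (v j))), (fun i => - (e *: \sum_j tau (gen j) (F i (ract e (v j))))).
split=> [j|i|]; first by rewrite mtot_ract scalerA (eP freeG).
  by rewrite scalerN scalerA (eP freeG).
have key j : \sum_i (elt (x i)^-1%g - 1) *: tau (gen j) (F i (ract e (v j))) =
    e *: (tau (gen j) (ract e (v j)) - t (mtot (ract e (v j))) (gen j)).
  rewrite scalerBr -tau_dirac -!tau_lact -tauB -Fsum tau_sum.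
  by apply: eq_bigr => i _; rewrite tau_lact.
under [RHS]eq_bigr do rewrite scalerN scalerA -(eC freeG) -scalerA scaler_sumr.
rewrite sumrN -scaler_sumr exchange_big /=; under [in RHS]eq_bigr do rewrite key.
by rewrite -scaler_sumr scalerA (eP freeG) sumrB -vP scalerBr ey opprB.
Qed.

(** Injectivity of H^1 -> H_0: take total masses in the conclusion of [tau_kernel]. The left
    differences coming from the boundary disappear, and a right difference of [u] becomes x_i m - m
    for its total mass m. *)
Lemma tensor_dual_boundary (m : 'I_d -> M) (z : 'I_d -> T) : (forall i, e *: m i = m i) ->
  e *: (\sum_i t (m i) (gen i)) = \sum_i (elt (x i)^-1%g - 1) *: z i ->
  exists2 m0 : M, e *: m0 = m0 & forall i, m i = elt (x i) *: m0 - m0.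
Proof.
move=> em mz.
have [v vP] := choice (fun i => tau_surjective tt (z i)).
pose w j := lact e (dirac (m j)) - \sum_i lact (elt (x i)^-1%g - 1) (v i j).
have w0 : \sum_j tau (gen j) (w j) = 0.
  under eq_bigr do rewrite tauB tau_lact tau_dirac tau_sum.
  rewrite sumrB -scaler_sumr mz exchange_big /=; apply/eqP; rewrite subr_eq0; apply/eqP.
  apply: eq_bigr => i _; rewrite vP scaler_sumr; apply: eq_bigr => j _.
  by rewrite tau_lact.
have [u uP] := tau_kernel w0.
exists (e *: mtot u) => [|j]; first by rewrite scalerA (eP freeG).
have := congr1 (@mtot _ _ M) (uP j); rewrite !mtot_ract !mtotB mtot_ract mtot_sum.
rewrite big1 => [|i _]; last exact: mtot_aug0.
rewrite mtot_lact blk_aug rmorph1 scale1r mtot_dirac subr0 em => ->.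
by rewrite scalerBr !scalerA (eC freeG).
Qed.

(** The relation [tau_relation] at the point mass of [m] reads sum_i x_i^-1 (x_i m (x) b_i) = sum_i
    m (x) b_i, which exhibits the sum of the (x_i m - m) (x) b_i as a boundary. *)
Lemma tensor_dual_coboundary (m : M) : e *: m = m -> exists2 z : 'I_d -> T,
  forall i, e *: z i = z i &
  e *: (\sum_i t (elt (x i) *: m - m) (gen i)) = \sum_i (elt (x i)^-1%g - 1) *: z i.
Proof.
move=> em; exists (fun i => - (e *: t (elt (x i) *: m) (gen i))) => [i|].
  by rewrite scalerN scalerA (eP freeG).
under [RHS]eq_bigr do rewrite scalerN scalerA -(eC freeG) -scalerA.
rewrite sumrN -scaler_sumr -scalerN; congr (e *: _); apply/eqP; rewrite -addr_eq0 -big_split /=.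
rewrite -[X in _ == X](tau_relation tt (dirac m)); apply/eqP; apply: eq_bigr => i _.
rewrite ract_dirac tauB tau_lact !tau_dirac scalerBl scale1r.
rewrite (is_homB _ _ (tensor_homl tt (gen i))).
by rewrite -[_ - _ :> restr T]/(t (elt (x i) *: m) (gen i) - t m (gen i)) addrC addrA subrK.
Qed.

End DualityElements.

(** * Duality *)

Section FreeDuality.
Variables (G : profiniteGroupType) (d : nat) (x : 'I_d -> G).
Hypothesis freeG : free_pronilpotent_on x.
Local Notation A := (cgr Zhat G).
Local Notation nilG := (proj1 freeG).
Local Notation e := (blk Zhat nilG).
Local Notation elt := (@cgr_elt Zhat G).
Local Notation D := (dual freeG).
Local Notation gen := (dual_gen freeG).
Local Notation epow := (epow (eC freeG)).
Local Notation ebasis := (ebasis (eP freeG) (eC freeG)).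
Variables (L : profiniteModType A) (trL : trivial_module L).
Local Notation Q := (freeres freeG trL).

Section Cochains.
Variable M : profiniteModType A.

Lemma hom_ebasis_fix n (f : epow (cgr_reg Zhat G) n -> M) i :
  is_hom f -> e *: f (ebasis i) = f (ebasis i).
Proof. by move=> hf; rewrite -(is_homZ _ _ hf) epow_fix. Qed.

Lemma hom_basis_ext n (f g : epow (cgr_reg Zhat G) n -> M) : is_hom f -> is_hom g ->
  (forall i, f (ebasis i) = g (ebasis i)) -> forall p, f p = g p.
Proof.
move=> hf hg fg p; rewrite (epow_linE (eP freeG) hf.1) (epow_linE (eP freeG) hg.1).
by apply: eq_bigr => i _; rewrite fg.
Qed.

Lemma epow_lin_hom n (m : 'I_n -> M) : is_hom (epow_lin (eC := eC freeG) m).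
Proof. by split; [exact: epow_lin_is_linear|exact: epow_lin_continuous]. Qed.

Lemma epow_lin_fix n (m : 'I_n -> M) i : e *: m i = m i ->
  epow_lin (eC := eC freeG) m (ebasis i) = m i.
Proof. by move=> em; rewrite epow_lin_basis. Qed.

Lemma freeres_d_basis i : res_d Q 0 (ebasis i) = elt (x i) *: ebasis ord0 - ebasis ord0.
Proof.
apply: epow_eq => j; rewrite bdE (bigD1 i) //= big1 => [|k /negPf ki].
  rewrite addr0 ecoord_basis eqxx ecoordB ecoordZ ecoord_basis !ord1 eqxx.
  by rewrite mulrBr mulr1 (eC freeG).
by rewrite ecoord_basis eq_sym ki mul0r.
Qed.

Lemma cochain_d_basis (f : Q 0%N -> M) i : is_hom f ->
  f (res_d Q 0 (ebasis i)) = elt (x i) *: f (ebasis ord0) - f (ebasis ord0).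
Proof. by move=> hf; rewrite freeres_d_basis (is_homB _ _ hf) (is_homZ _ _ hf). Qed.

End Cochains.

Variables (M T : profiniteModType A) (t : M -> D -> T).
Hypothesis tt : is_diag_tensor t.
Local Notation X := (free_tc freeG trL T).

Let fixP (m : 'I_d -> T) j : e *: (e *: m j) = e *: m j.
Proof. by rewrite scalerA (eP freeG). Qed.

(** The factor e forces the values into the summand on which e acts as 1, for an arbitrary function
    [f]. On cocycles it changes nothing: f(b) is invariant, so e acts on f(b) (x) b_j through b_j,
    which it fixes. *)
Definition dual0 (f : cochain_space Q M 0) : X 1%N :=
  epow_mk (eC freeG) (fixP (fun j => t (f (ebasis ord0)) (gen j))).

Lemma dual0_is_linear : linear dual0.
Proof.
move=> r f g; apply: (@epow_eq _ _ _ (eC freeG) T) => j.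
rewrite -[r *: dual0 f + _]/(cgr_scal G r *: (dual0 f : epow T d) + (dual0 g : epow T d)).
rewrite ecoordD ecoordZ !epow_mkE.
have := (is_hom_comp (tensor_homl tt (gen j)) (restr_scale_hom T e)).1 r.
exact.
Qed.
HB.instance Definition _ := GRing.isLinear.Build _ _ _ _ dual0 dual0_is_linear.

Let fixP1 (y : T) (_ : 'I_1) : e *: (e *: y) = e *: y.
Proof. by rewrite scalerA (eP freeG). Qed.

Definition dual1 (f : cochain_space Q M 1) : X 0%N :=
  epow_mk (eC freeG) (fixP1 (\sum_i t (f (ebasis i)) (gen i))).

Lemma dual1_is_linear : linear dual1.
Proof.
move=> r f g; apply: (@epow_eq _ _ _ (eC freeG) T) => j.
rewrite -[r *: dual1 f + _]/(cgr_scal G r *: (dual1 f : epow T 1) + (dual1 g : epow T 1)).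
rewrite ecoordD ecoordZ !epow_mkE scalerA cgr_scal_central -scalerA -scalerDr.
congr (e *: _); rewrite scaler_sumr -big_split; apply: eq_bigr => i _.
exact: (tensor_homl tt (gen i)).1.
Qed.
HB.instance Definition _ := GRing.isLinear.Build _ _ _ _ dual1 dual1_is_linear.

Let tc_dE (y : X 1%N) j : ecoord (free_tc_d freeG T 0 y : epow T 1) j =
  \sum_i (elt (x i)^-1%g - 1) *: ecoord (y : epow T d) i.
Proof.
rewrite epow_mkE; apply: eq_bigr => i _.
by rewrite cgr_invB cgr_inv_elt -cgr_elt1 cgr_inv_elt invg1.
Qed.

Let cocycle_invariant (f : cochain_space Q M 0) : is_cocycle f ->
  forall g, elt g *: (f (ebasis ord0) : M) = f (ebasis ord0).
Proof.
move=> [hf f0]; apply: (blk_invariant (freeG := freeG)); first exact: hom_ebasis_fix.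
move=> i; apply/subr0_eq; rewrite -(cochain_d_basis i hf).
exact: f0.
Qed.

Lemma free_duality0 (i0 : 'I_d) :
  isom (cohomology_nat Q M 0) (chain_homology (tc_d X) 1).
Proof.
apply: (@subquot_isom _ _ _ _ _ _ _ dual0) => [f cf|f cf|y cy].
- have gm := cocycle_invariant cf.
  apply: (@epow_eq _ _ _ (eC freeG) T) => j; rewrite tc_dE.
  under eq_bigr do rewrite epow_mkE !(tensor_invariant_act tt) //.
  rewrite -(big_morph _ (fun c c' => is_homD c c' (tensor_homr tt _)) (is_hom0 (tensor_homr tt _))).
  rewrite -[RHS](is_hom0 (tensor_homr tt (f (ebasis ord0)))); congr (t _ _).
  by rewrite -[RHS](dual_relation freeG); apply: eq_bigr => i _; rewrite dual_gen_blk.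
- have gm := cocycle_invariant cf; split=> [[z]|->]; last by rewrite raddf0; exact: submod0.
  rewrite (_ : z = 0); last by apply: (@epow_eq _ _ _ (eC freeG) T) => -[].
  rewrite raddf0 => f0.
  have m0 : f (ebasis ord0) = 0 :> M.
    apply: (tensor_dual_injective tt i0) => [|i|j]; first exact: (hom_ebasis_fix _ cf.1).
      exact: gm.
    have := congr1 (fun y : epow T d => ecoord y j) (esym f0).
    by rewrite epow_mkE (tensor_invariant_act tt) // dual_gen_blk.
  apply/funext => p; apply: (hom_basis_ext (g := fun=> 0) cf.1).
    by split; [move=> a u v; rewrite scaler0 addr0|exact: cst_continuous].
  by move=> i; rewrite ord1.
have [m [em xm ym]] : exists m, [/\ e *: m = m, forall i, elt (x i) *: m = m &
    forall j, ecoord (y : epow T d) j = t m (gen j)].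
  apply: (tensor_dual_cycles tt) => [j|]; first exact: ecoordE.
  by rewrite -(tc_dE y ord0) cy.
have gm := blk_invariant em xm.
pose f : cochain_space Q M 0 := epow_lin (eC := eC freeG) (fun _ : 'I_1 => m).
have hf : is_cochain f := epow_lin_hom (M := M) (fun _ : 'I_1 => m).
have fm : f (ebasis ord0) = m by rewrite /f epow_lin_fix.
exists f; first split=> // p.
  apply: (hom_basis_ext (f := fun p => f (res_d Q 0 p)) (g := fun=> 0)).
  - exact: is_hom_comp (res_d_hom Q 0) hf.
  - by split; [move=> a u v; rewrite scaler0 addr0|exact: cst_continuous].
  by move=> i; rewrite cochain_d_basis // fm gm subrr.
rewrite (_ : dual0 f - y = 0); first exact: submod0.
apply/eqP; rewrite subr_eq0; apply/eqP/(@epow_eq _ _ _ (eC freeG) T) => j.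
by rewrite epow_mkE fm (tensor_invariant_act tt) // dual_gen_blk ym.
Qed.

Lemma free_duality1 : isom (cohomology_nat Q M 1) (chain_homology (tc_d X) 0).
Proof.
apply: (@subquot_isom _ _ _ _ _ _ _ dual1) => [//|f [hf f0]|y _]; first split.
- move=> [z zf]; have [||m0 em0 fm] := @tensor_dual_boundary _ _ _ _ _ _ _ tt
    (fun i => f (ebasis i)) (fun i => ecoord (z : epow T d) i).
  + by move=> i; exact: hom_ebasis_fix.
  + by rewrite -(tc_dE z ord0) [free_tc_d _ _ _ _]zf epow_mkE.
  exists (epow_lin (eC := eC freeG) (fun _ : 'I_1 => m0)); first exact: epow_lin_hom.
  apply: (hom_basis_ext hf); first exact: is_hom_comp (res_d_hom Q 0) (epow_lin_hom _).
  move=> i; rewrite fm cochain_d_basis ?epow_lin_fix //; exact: epow_lin_hom.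
- move=> [g hg fg]; have [z ez zP] := tensor_dual_coboundary tt (hom_ebasis_fix ord0 hg).
  exists (epow_mk (eC freeG) ez); apply: (@epow_eq _ _ _ (eC freeG) T) => j.
  rewrite tc_dE -zP epow_mkE; congr (e *: _); apply: eq_bigr => i _.
  by rewrite fg cochain_d_basis.
have [m [z [em ez zP]]] := tensor_dual_generated tt (ecoordE (y : epow T 1) ord0).
pose f : cochain_space Q M 1 := epow_lin (eC := eC freeG) m.
have hf : is_cochain f := epow_lin_hom m.
exists f.
  split=> // p; rewrite (freeres_rank0 (freeG := freeG) (k := 2) p) // raddf0.
  exact: is_hom0 hf.
exists (epow_mk (eC freeG) ez); apply: (@epow_eq _ _ _ (eC freeG) T) => j.
rewrite tc_dE -zP -[_ - _ in RHS]/((dual1 f : epow T 1) - y) ecoordB epow_mkE !ord1.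
by congr (e *: _ - _); apply: eq_bigr => i _; rewrite /f epow_lin_fix.
Qed.

End FreeDuality.

Section FreeDualityGroup.
Variables (G : profiniteGroupType) (d : nat) (x : 'I_d -> G).
Hypothesis freeG : free_pronilpotent_on x.
Local Notation A := (cgr Zhat G).
Local Notation nilG := (proj1 freeG).
Local Notation e := (blk Zhat nilG).
Local Notation elt := (@cgr_elt Zhat G).
Local Notation epow := (epow (eC freeG)).
Local Notation ebasis := (ebasis (eP freeG) (eC freeG)).

Lemma epow0 (M : profiniteModType A) n (p : epow M n) : n = 0%N -> p = 0.
Proof. by move=> n0; apply: (@epow_eq _ _ _ (eC freeG) M) => i; have := ltn_ord i; rewrite {2}n0. Qed.

Section Resolution.
Variables (L : profiniteModType A) (trL : trivial_module L) (M T : profiniteModType A).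
Local Notation Q := (freeres freeG trL).
Local Notation X := (free_tc freeG trL T).

Lemma free_cohomology_trivial k : rank d k = 0%N -> forall c : cohomology_nat Q M k, c = 0.
Proof.
move=> rk; apply: subquot_trivial => f [hf _].
rewrite (_ : f = 0); first exact: submod0.
by apply/funext => p; rewrite (epow0 p rk); exact: (is_hom0 hf).
Qed.

Lemma free_homology_trivial k : rank d k = 0%N -> forall c : chain_homology (tc_d X) k, c = 0.
Proof.
move=> rk; apply: subquot_trivial => y _.
by rewrite (epow0 (y : epow T _) rk); exact: submod0.
Qed.

Lemma free_cohomology_finite k : finite_set [set: M] ->
  finite_set [set: cohomology_nat Q M k].
Proof.
move=> fM; apply: (finite_set_surj (f := sqpi (coboundaries Q M k))); last first.
  by move=> c; have [z ->] := sqpi_surj c; exists z.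
apply: (finite_set_inj (f := fun z : submod_type (cocycles Q M k) =>
  [ffun i => val z (ebasis i) : M])); last exact: finite_set_ffun.
move=> z z' /ffunP zz'; apply: val_inj; apply/funext.
have /asboolP [hz _] := valP z; have /asboolP [hz' _] := valP z'.
by apply: hom_basis_ext => // i; have := zz' i; rewrite !ffunE.
Qed.

(** The comparison isomorphisms reduce any resolution and tensor complex to the explicit ones.
    Outside the degrees 0 to [n] both sides vanish, by [rk] or because a degree is negative. *)
Lemma free_duality n (P : proj_resolution L) (Y : tensor_complex P T) (k : int) :
  (forall j, (n < j)%N -> rank d j = 0%N) ->
  (forall j, (j <= n)%N ->
    isom (cohomology_nat Q M (n - j)) (chain_homology (tc_d X) j)) ->
  isom (homology Y k) (cohomology P M (n%:Z - k)).
Proof.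
move=> rk iso.
have hY j : isom (chain_homology (tc_d Y) j) (chain_homology (tc_d X) j) by exact: homology_isom.
have hP j : isom (cohomology_nat P M j) (cohomology_nat Q M j) by exact: cohomology_isom.
have z0 (y : 'rV[Zhat]_0) : y = 0 by apply/rowP => -[].
case: k => [j|j].
  have [jn|nj] := leqP j n.
    have -> : n%:Z - Posz j = Posz (n - j)%N by lia.
    apply: isom_trans (hY j) _; apply: isom_trans (isom_sym (iso j jn)) _.
    exact/isom_sym/hP.
  have -> : n%:Z - Posz j = Negz (j - n).-1 by lia.
  apply: isom_trans (hY j) _; apply: isom_trivial => //.
  exact: free_homology_trivial (rk j nj).
have -> : n%:Z - Negz j = Posz (n + j.+1)%N by lia.
apply: isom_trans _ (isom_sym (hP _)); apply: isom_trivial => //.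
by apply: free_cohomology_trivial; apply: rk; lia.
Qed.

End Resolution.

Lemma duality_group_free n (D : profiniteModType A) :
  (forall j, (n < j)%N -> rank d j = 0%N) ->
  (forall L : profiniteModType A, trivial_module L ->
    forall m, proj_dim_le L m -> (n <= m)%N) ->
  (forall L (trL : trivial_module L) (M T : profiniteModType A) (t : M -> D -> T) j,
    is_diag_tensor t -> (j <= n)%N ->
    isom (cohomology_nat (freeres freeG trL) M (n - j)) (chain_homology (tc_d (free_tc freeG trL T)) j)) ->
  duality_group_of_dim Zhat G n.
Proof.
move=> rk low iso; split.
- exists (gmod (trivial_gaction Zhat G)); first exact: trivial_gmod.
  split; last exact/low/trivial_gmod.
  exists (freeres freeG (trivial_gmod Zhat G)) => k nk p.
  exact: epow0 (rk k nk).
- move=> L P M [k|k] trL fM; last first.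
    rewrite (_ : setT = [set 0 : 'rV[Zhat]_0]); first exact: finite_set1.
    by apply/seteqP; split=> // y _; apply/rowP => -[].
  have [f [g fK gK]] := cohomology_isom (freeres freeG trL) P M k.
  apply: (finite_set_surj (f := f)); first exact: free_cohomology_finite.
  by move=> y; exists (g y).
exists D => L P M T t Y k trL tt.
by apply: (free_duality (trL := trL) Y k rk) => j; exact: iso tt.
Qed.

(** A resolution concentrated in degree 0 would make H^1(G, L) vanish. On the free resolution, the
    cochain sending every basis vector to 1 is a cocycle, but coboundaries with values in the
    trivial module vanish on basis vectors. *)
Lemma trivial_proj_dim_gt0 (i0 : 'I_d) (L : profiniteModType A) : trivial_module L ->
  forall m, proj_dim_le L m -> (1 <= m)%N.
Proof.
move=> trL [|m] // [P P0].
have trg (g : G) (y : L) : elt g *: y = y by exact: trivial_module_act.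
have [f [g fK gK]] := cohomology_isom P (freeres freeG trL) L 1.
have z0 (c : cohomology_nat (freeres freeG trL) L 1) : c = 0.
  rewrite -(gK c) (_ : g c = 0) ?raddf0 //; apply: subquot_trivial => h [hh _].
  rewrite (_ : h = 0); first exact: submod0.
  by apply/funext => p; rewrite (P0 1%N isT p); exact: (is_hom0 hh).
have [u [[v uK vK] _ uD _ _]] := trL.
have bu y : e *: (y : L) = y by exact: blk_trivial.
pose h : cochain_space (freeres freeG trL) L 1 := epow_lin (eC := eC freeG) (fun _ : 'I_d => u 1).
have hh : is_cocycle h.
  split; first exact: epow_lin_hom.
  move=> p; rewrite (freeres_rank0 (freeG := freeG) (k := 2) p) // raddf0.
  exact: (is_hom0 (epow_lin_hom _ _)).
pose z : submod_type (cocycles (freeres freeG trL) L 1) := exist _ h (asboolT hh).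
have : sqpi (coboundaries (freeres freeG trL) L 1) z = sqpi _ 0 by rewrite raddf0; exact: z0.
move=> /sqpiP/asboolP; rewrite subr0 => -[g' hg hgd].
have := hgd (ebasis i0); rewrite /= /h epow_lin_fix // (cochain_d_basis (freeG := freeG)) //.
rewrite trg subrr => u10; have /eqP := @oner_neq0 Zhat; case.
apply: (can_inj uK); rewrite u10.
by apply: (addIr (u 0)); rewrite -uD !add0r.
Qed.

End FreeDualityGroup.

(* [dual] is 0 in rank 0, where the dualizing module is instead the trivial module. *)
Section RankZero.
Variables (G : profiniteGroupType) (x : 'I_0 -> G).
Hypothesis freeG : free_pronilpotent_on x.
Local Notation A := (cgr Zhat G).
Local Notation nilG := (proj1 freeG).
Local Notation e := (blk Zhat nilG).
Local Notation elt := (@cgr_elt Zhat G).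
Local Notation epow := (epow (eC freeG)).
Local Notation ebasis := (ebasis (eP freeG) (eC freeG)).
Local Notation D := (gmod (trivial_gaction Zhat G)).
Local Notation one := ((1 : Zhat) : D).

Variables (M T : profiniteModType A) (t : M -> D -> T).
Hypothesis tt : is_diag_tensor t.

Let tr : is_bilinear (t : restr M -> restr D -> restr T).
Proof. by have [[]] := tt. Qed.

Let t1_hom : is_hom (t^~ one : restr M -> restr T).
Proof. exact: bilinear_homl tr. Qed.

Lemma trivial_tensor_act a m : a *: t m one = t (a *: m) one.
Proof.
move: a; apply: cgr_ind.
- apply: closed_eq_fun.
    by apply: continuousZ; [move=> ?; exact: cvg_id|exact: cst_continuous].
  apply: (continuous_comp1 t1_hom.2).
  by apply: (continuousZ (M := M)); [move=> ?; exact: cvg_id|exact: cst_continuous].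
- by rewrite !scale0r; exact/esym/(is_hom0 t1_hom).
- by move=> a b Ha Hb; rewrite !scalerDl Ha Hb; exact/esym/(is_homD _ _ t1_hom).
move=> r g; rewrite cgr_monomE -!scalerA tt.2 (gmod_elt (s := trivial_gaction Zhat G)).
exact/esym/(is_homZ r (elt g *: m : restr M) t1_hom).
Qed.

(** The inverse M (x) Zhat -> M is induced by the bilinear map (m, r) |-> r m. *)
Lemma trivial_tensor_bijective : bijective (t^~ one).
Proof.
have scalD (r s : Zhat) : cgr_scal G r *: (s : D) = (r * s : Zhat).
  exact: (gmod_scal (s := trivial_gaction Zhat G)).
pose b (m : restr M) (r : restr D) : restr M := (r : Zhat) *: m.
have bb : is_bilinear b.
  split.
  - by move=> r s m m'; rewrite /b scalerDr !scalerA mulrC.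
  - move=> m s r r'; rewrite /b -[s *: r + r']/(cgr_scal G s *: (r : D) + r') scalD.
    by rewrite (@scalerDl Zhat (restr M) m (s * r) r') scalerA.
  apply: (continuousZ (M := restr M)); [exact: snd_continuous|exact: fst_continuous].
have [h [[hh ht] _]] := tt.1.2 _ _ bb.
exists h => [m|y]; first by rewrite ht /b scale1r.
move: y; apply: (tensor_hom_ext tt.1); first exact: is_hom_comp hh t1_hom.
  exact: is_hom_id.
move=> m r; rewrite ht /b; transitivity ((r : Zhat) *: (t m one : restr T)).
  exact: (is_homZ _ _ t1_hom).
rewrite -[LHS](is_homZ (r : Zhat) (one : restr D) (bilinear_homr m tr)); congr (t m _).
by rewrite -[RHS]mulr1; exact: scalD.
Qed.

Variables (L : profiniteModType A) (trL : trivial_module L).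
Local Notation Q := (freeres freeG trL).
Local Notation X := (free_tc freeG trL T).

Let fixP (y : T) (_ : 'I_1) : e *: (e *: y) = e *: y.
Proof. by rewrite scalerA (eP freeG). Qed.

Definition trivial_dual (f : cochain_space Q M 0) : X 0%N :=
  epow_mk (eC freeG) (fixP (t (f (ebasis ord0)) one)).

Lemma trivial_dual_is_linear : linear trivial_dual.
Proof.
move=> r f g; apply: (@epow_eq _ _ _ (eC freeG) T) => j.
rewrite -[r *: trivial_dual f + _]/(cgr_scal G r *: (trivial_dual f : epow T 1) + (trivial_dual g : epow T 1)).
rewrite ecoordD ecoordZ !epow_mkE.
exact: (is_hom_comp t1_hom (restr_scale_hom T e)).1.
Qed.
HB.instance Definition _ := GRing.isLinear.Build _ _ _ _ trivial_dual trivial_dual_is_linear.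

(** Both complexes are concentrated in degree 0, where they reduce to eM and e (M (x) Zhat). *)
Lemma rank0_duality : isom (cohomology_nat Q M 0) (chain_homology (tc_d X) 0).
Proof.
have [h hK hK'] := trivial_tensor_bijective.
have d0 (p : Q 1%N) : p = 0 by exact: (epow0 (p : epow (cgr_reg Zhat G) 0) erefl).
have bd0 (z : X 1%N) : z = 0 by exact: (epow0 (z : epow T 0) erefl).
apply: (@subquot_isom _ _ _ _ _ _ _ trivial_dual) => [//|f [hf _]|y _]; first split.
- move=> [z]; rewrite (bd0 z) raddf0 => f0.
  apply/funext => p; apply: (hom_basis_ext (g := fun=> 0) hf).
    by split; [move=> a u v; rewrite scaler0 addr0|exact: cst_continuous].
  move=> i; rewrite ord1; apply: (can_inj hK).
  have := congr1 (fun y : epow T 1 => ecoord y ord0) (esym f0).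
  rewrite epow_mkE trivial_tensor_act hom_ebasis_fix // => ->.
  exact/esym/(is_hom0 t1_hom).
- by move=> ->; rewrite raddf0; exact: submod0.
pose m := h (ecoord (y : epow T 1) ord0).
have em : e *: m = m.
  by apply: (can_inj hK); rewrite -trivial_tensor_act hK' ecoordE.
pose f : cochain_space Q M 0 := epow_lin (eC := eC freeG) (fun _ : 'I_1 => m).
have hf : is_cochain f := epow_lin_hom freeG (M := M) (fun _ : 'I_1 => m).
exists f; first by split=> // p; rewrite (d0 p) raddf0; exact: (is_hom0 hf).
rewrite (_ : trivial_dual f - y = 0); first exact: submod0.
apply/eqP; rewrite subr_eq0; apply/eqP/(@epow_eq _ _ _ (eC freeG) T) => j.
by rewrite epow_mkE /f epow_lin_fix // hK' ecoordE (ord1 (j : 'I_1)).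
Qed.

End RankZero.

Theorem proposition6p2 (G : profiniteGroupType) :
  fg_free_pronilpotent G -> duality_group Zhat G.
Proof.
move=> [[|d] [x freeG]].
  exists 0%N; apply: (duality_group_free (freeG := freeG) (D := gmod (trivial_gaction Zhat G))) => [[|[|j]] //|//|L trL M T t [|//] tt _].
  exact: (rank0_duality freeG tt trL).
exists 1%N; apply: (duality_group_free (freeG := freeG) (D := dual freeG)) => [[|[|j]] //||].
  by move=> L trL m; exact: (trivial_proj_dim_gt0 freeG ord0 trL).
move=> L trL M T t [|[|//]] tt _; first exact: free_duality1 tt.
exact: free_duality0 tt ord0.
Qed.
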